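(* Let $X=X(\mathbb T)$ be a Banach lattice satisfying Assumption A, and let $r,s\in\mathbb N$ with $2r\ge s$. Let $(G_n)_{n\in\mathbb N}$ be linear sampling operators for which there are constants $K_1,K_2,K_3>0$ such that for all $n\in\mathbb N$ $$K_2\|f\|_{X_n}\le\|G_nf\|_X\le K_1\|f\|_{X_n}\ \ (f\in X),\qquad \|T-G_nT\|_X\le K_3n^{-s}\|T^{(s)}\|_X\ \ (T\in\mathcal T_n).$$ Then for all $f\in X$ and all $\alpha\in(0,s)$ the following are equivalent: (i) $\|f-G_nf\|_X=\mathcal O(n^{-\alpha})$ as $n\to\infty$; (ii) $\|(I-A_{\gamma/n})^rf\|_{X_n}+\|(I-\dot A_{\gamma/n})^sf\|_X=\mathcal O(n^{-\alpha})$ as $n\to\infty$.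
   Context: $\mathbb T$ is the unit circle identified with $[-\pi,\pi)$ (functions on $\mathbb T$ are $2\pi$-periodic), with normalized Lebesgue measure $\mu$. A Banach lattice $X=X(\mathbb T)$ is a Banach space of measurable functions on $\mathbb T$ such that: 1) if $f$ is measurable, $g\in X$ and $|f|\le|g|$, then $f\in X$ and $\|f\|_X\le\|g\|_X$; 2) if $f_n\in X$, $\sup_n\|f_n\|_X<\infty$ and $0\le f_n\uparrow f$, then $f\in X$ and $\|f_n\|_X\to\|f\|_X$; 3) for every measurable $E$ with $\mu(E)<\infty$, $\chi_E\in X$ and there is $c_E>0$ with $\int_E|f|\,d\mu\le c_E\|f\|_X$. Functions in $X$ are regarded as finite-valued and defined at every point, not as equivalence classes. Steklov averages: $A_hf(x)=\frac1h\int_{x-h/2}^{x+h/2}f(t)\,dt$ and $\dot A_hf(x)=A_hf(x+\tfrac h2)$ for $h>0$; $I$ is the identity. Assumption A: $A_hf\in X$ for all $f\in X$, $h>0$, and $\sup_{h>0,\,\|f\|_X\le1}\|A_hf\|_X<\infty$. $\mathcal T_n$ is the set of trigonometric polynomials of degree at most $n$. $(\Phi_n)$ are linear subspaces of $X$ with $\Phi_m\subset\Phi_n$ for $m\le n$, $\Phi_0=\{0\}$, satisfying $\|\varphi^{(q)}\|_X\le(Bn)^q\|\varphi\|_X$ for all $q\in\mathbb N$, $\varphi\in\Phi_n$, with a constant $B=B_X>0$. (If $X$ is translation-invariant, spline spaces of smoothness $s$ are also admitted, with this inequality required only for $q\le s$.) Sampling operators: $G_nf(x)=\sum_{k=1}^{m_n}f(x_{k,n})\varphi_{k,n}(x)$,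 $n\in\mathbb N$, where $\varphi_{k,n}\in\Phi_n$ are $2\pi$-periodic and $x_k=x_{k,n}\in\mathbb T$ are nodes such that for some fixed $\gamma,\gamma'>0$, $\frac{\gamma}{n}\le x_{k+1,n}-x_{k,n}\le\frac{\gamma'}{n}$ for $k=1,\dots,m_n$, with $x_{m_n+1,n}=2\pi+x_{1,n}$. The constant $\gamma$ in the claim is this one. The discrete semi-norm is $\|f\|_{X_n}=\big\|\sum_{k=1}^{m_n}|f(x_k)|\chi_{[x_k,x_{k+1})}\big\|_X$. *)

(* Defs.v *)
From HB Require Import structures.
From mathcomp Require Import all_boot all_order all_algebra.
From mathcomp Require Import all_classical all_reals all_analysis.
From mathcomp Require Import measurable_realfun.

Set Implicit Arguments.
Unset Strict Implicit.
Unset Printing Implicit Defensive.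
Import Order.TTheory GRing.Theory Num.Theory.
Import numFieldNormedType.Exports.

Local Open Scope classical_set_scope.
Local Open Scope ring_scope.

(* Functions on the circle are 2pi-periodic functions R -> R, defined at every
   point; subsets of the circle are subsets of [-pi, pi[. *)

(* The library's default sigma-algebra on R is the Borel one; here measurable
   means Lebesgue measurable, i.e. measurable for its completion. *)
Definition lebesgue_sigma (R : realType) :=
  g_sigma_algebraType (completed_algebra_gen (@lebesgue_measure R)).

Definition lebesgue_measurable_set (R : realType) (E : set R) : Prop :=
  measurable (E : set (lebesgue_sigma R)).

Definition lebesgue_measurable_fun (R : realType) (f : R -> R) : Prop :=
  measurable_fun [set: lebesgue_sigma R] (f : lebesgue_sigma R -> R).

Definition measurable_on_circle (R : realType) (f : R -> R) : Prop :=
  periodic f (pi *+ 2) /\ lebesgue_measurable_fun f.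

Definition circle (R : realType) : set R := `[- pi, pi[.

Definition periodize (R : realType) (E : set R) : set R :=
  [set x | exists j : int, E (x + (pi *+ 2) *~ j)].

(* Integral with respect to the normalized measure mu = dx / (2 pi).  On
   Lebesgue measurable nonnegative functions the library integral, a supremum
   over Borel simple minorants, is the Lebesgue integral. *)
Definition circle_integral (R : realType) (E : set R) (f : R -> R) : \bar R :=
  (((pi *+ 2)^-1)%:E *
     \int[@lebesgue_measure R]_(x in E) (f x)%:E)%E.

(* The elements are functions, not classes, so the norm is a seminorm on
   functions whose kernel consists of functions vanishing a.e.  Inequalities
   and monotone limits between elements are pointwise; spaces whose axioms hold
   modulo null sets are a special case. *)
Record banach_lattice (R : realType) := BanachLattice {
  bl_set : set (R -> R) ;
  bl_norm : (R -> R) -> R ;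
  bl_measurable : forall f, bl_set f -> measurable_on_circle f ;
  bl_lin : forall (a : R) f g, bl_set f -> bl_set g ->
    bl_set (fun x => a * f x + g x) ;
  bl_norm_ge0 : forall f, bl_set f -> 0 <= bl_norm f ;
  bl_normZ : forall (a : R) f, bl_set f ->
    bl_norm (fun x => a * f x) = `|a| * bl_norm f ;
  bl_normD : forall f g, bl_set f -> bl_set g ->
    bl_norm (fun x => f x + g x) <= bl_norm f + bl_norm g ;
  bl_norm_eq0 : forall f, bl_set f -> bl_norm f = 0 ->
    {ae @lebesgue_measure R, forall x, f x = 0} ;
  bl_complete : forall u : nat -> R -> R, (forall n, bl_set (u n)) ->
    (forall e : R, 0 < e -> exists N : nat, forall m n : nat,
       (N <= m)%N -> (N <= n)%N -> bl_norm (fun x => u m x - u n x) < e) ->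
    exists2 f, bl_set f & bl_norm (fun x => u n x - f x) @[n --> \oo] --> 0 ;
  bl_ideal : forall f g, measurable_on_circle f -> bl_set g ->
    (forall x, `|f x| <= `|g x|) -> bl_set f /\ bl_norm f <= bl_norm g ;
  bl_fatou : forall (u : nat -> R -> R) (f : R -> R),
    (forall n, bl_set (u n)) ->
    (exists C : R, forall n, bl_norm (u n) <= C) ->
    (forall n x, 0 <= u n x) ->
    (forall x, nondecreasing_seq (fun n => u n x)) ->
    (forall x, u n x @[n --> \oo] --> f x) ->
    bl_set f /\ (bl_norm (u n) @[n --> \oo] --> bl_norm f) ;
  (* mu is a probability measure, so every E has finite measure *)
  bl_indic : forall E : set R, E `<=` @circle R -> lebesgue_measurable_set E ->
    bl_set (\1_(periodize E)) /\
    exists2 c : R, 0 < c & forall f, bl_set f ->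
      (circle_integral E (fun x => `|f x|%R) <= (c * bl_norm f)%:E)%E
}.

Definition steklov (R : realType) (h : R) (f : R -> R) : R -> R :=
  fun x => h^-1 *
    \int[@lebesgue_measure R]_(t in `[x - h / 2, x + h / 2]) f t.

Definition steklov_dot (R : realType) (h : R) (f : R -> R) : R -> R :=
  fun x => steklov h f (x + h / 2).

(* (I - A)^r f *)
Definition id_sub_iter (R : realType) (A : (R -> R) -> R -> R) (r : nat)
    (f : R -> R) : R -> R :=
  iter r (fun g x => g x - A g x) f.

Definition assumptionA (R : realType) (X : banach_lattice R) : Prop :=
  (forall (f : R -> R) (h : R), bl_set X f -> 0 < h -> bl_set X (steklov h f)) /\
  exists C : R, forall (h : R) (f : R -> R), 0 < h -> bl_set X f ->
    bl_norm X f <= 1 -> bl_norm X (steklov h f) <= C.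

Definition trig_poly (R : realType) (n : nat) : set (R -> R) :=
  [set T | exists a b : nat -> R, T = (fun x : R =>
     \sum_(k < n.+1) (a k * cos (k%:R * x) + b k * sin (k%:R * x)))].

Definition translation_invariant (R : realType) (X : banach_lattice R) : Prop :=
  forall (t : R) f, bl_set X f ->
    bl_set X (fun x => f (x + t)) /\ bl_norm X (fun x => f (x + t)) = bl_norm X f.

(* Periodic piecewise polynomials of class C^(s-1).  The derivative of order s
   exists off the knots; at a knot where the difference quotient diverges
   [derive1n] takes a default value. *)
Definition spline (R : realType) (s : nat) (f : R -> R) : Prop :=
  [/\ periodic f (pi *+ 2),
      forall j, (j.+1 < s)%N -> forall x : R, derivable (derive1n j f) x 1,
      continuous (derive1n s.-1 f) &
      exists (N : nat) (t : nat -> R) (p : nat -> {poly R}),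
        [/\ t N = t 0%N + pi *+ 2,
            forall i, (i < N)%N -> t i < t i.+1 &
            forall i, (i < N)%N -> forall x : R, t i < x < t i.+1 ->
              f x = (p i).[x]]].

Definition smooth (R : realType) (f : R -> R) : Prop :=
  forall (j : nat) (x : R), derivable (derive1n j f) x 1.

Definition bernstein (R : realType) (X : banach_lattice R) (B : R) (q n : nat)
    (f : R -> R) : Prop :=
  bl_set X (derive1n q f) /\
  bl_norm X (derive1n q f) <= (B * n%:R) ^+ q * bl_norm X f.

(* Either smooth functions with the Bernstein inequality of every order, or, in
   a translation-invariant X, splines of smoothness s with the inequality up
   to order s. *)
Definition approximating_spaces (R : realType) (X : banach_lattice R)
    (s : nat) (Phi : nat -> set (R -> R)) : Prop :=
  [/\ forall n, Phi n `<=` bl_set X,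
      forall n, Phi n (fun=> 0) /\ forall (a : R) f g, Phi n f -> Phi n g ->
        Phi n (fun x => a * f x + g x),
      forall m n, (m <= n)%N -> Phi m `<=` Phi n,
      Phi 0%N = [set (fun=> 0)] &
      exists2 B : R, 0 < B &
        (forall n f, Phi n f ->
           smooth f /\ forall q, bernstein X B q n f) \/
        (translation_invariant X /\
         forall n f, Phi n f ->
           spline s f /\ forall q, (q <= s)%N -> bernstein X B q n f)].

(* For n >= 1 the nodes are x n 1, ..., x n (m n); x n (m n).+1 is the first
   node shifted by one period. *)
Definition sampling_nodes (R : realType) (gamma gamma' : R) (m : nat -> nat)
    (x : nat -> nat -> R) : Prop :=
  forall n, (0 < n)%N ->
    [/\ forall k, (1 <= k <= m n)%N -> circle (x n k),
        x n (m n).+1 = pi *+ 2 + x n 1%N &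
        forall k, (1 <= k <= m n)%N ->
          gamma / n%:R <= x n k.+1 - x n k <= gamma' / n%:R].

Definition sampling_op (R : realType) (m : nat -> nat) (x : nat -> nat -> R)
    (phi : nat -> nat -> R -> R) (n : nat) (f : R -> R) : R -> R :=
  fun y => \sum_(1 <= k < (m n).+1) f (x n k) * phi n k y.

Definition discrete_norm (R : realType) (X : banach_lattice R) (m : nat -> nat)
    (x : nat -> nat -> R) (n : nat) (f : R -> R) : R :=
  bl_norm X (fun y => \sum_(1 <= k < (m n).+1)
    `|f (x n k)| * \1_(periodize `[x n k, x n k.+1[) y).

(* Main.v *)
Require Import Defs.
From HB Require Import structures.
From mathcomp Require Import all_boot all_order all_algebra.
From mathcomp Require Import all_classical all_reals all_analysis.
From mathcomp Require Import measurable_realfun ring lra zify.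

(** Write [A] and [D] for the centred and the one-sided average at the scale
    [gamma / n], [G] for the sampling operator of level [n], and [dn] for the
    discrete norm.  The bridge between the two conditions is a trigonometric
    polynomial [T] of degree [n] for which both [f - T] and [n ^ - s] times the
    [s]-th derivative of [T] have norms of order [n ^ - alpha].  Such [T] exist
    as soon as [(I - D) ^ s f] is of that order ([realization]).

    From the differences to the sampling error, write
    [f - G f = (f - T) + (T - G T) + G (T - f)].  The second term is bounded by
    the derivative of [T], the third by [dn (f - T)].  To bound [dn u] for
    [u = f - T], split off [(I - A) ^ r u].  The rest [u - (I - A) ^ r u] is a
    combination of averages, and averages can be sampled: their values at the
    nodes are controlled by the norm of [u] ([discrete_norm_smoothing]).  In
    [(I - A) ^ r u] the difference of [f] is small by assumption; that of [T] is
    bounded by [n ^ - s] times averages of the derivative, because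
    [(I - A) ^ r] annihilates polynomials of degree less than [2 r] and
    [s <= 2 r], so that only the remainder of Taylor's formula is left
    ([id_sub_iter_taylor], [discrete_norm_difference]).

    Conversely, if the sampling error is of order [n ^ - alpha], then Bernstein's
    inequality for the increments of [G f] between levels gives both differences
    of [G f] that order ([bernstein_rate]).  As [D] is bounded,
    [(I - D) ^ s f] has it too, so [T] exists.  The discrete norm of [f - G f]
    remains.  Since [G] is bounded below on samples, it is at most a constant
    times the norm of [G f - G (G f)], and that is bounded as above, with
    [G f] in place of [f].

    To construct [T], let [M = I - (I - D) ^ s].  It differs from the identity
    by the difference of order [s], and [M ^ (2 s)] has [s] derivatives, each of
    which costs a factor [n].  The derivative of [M ^ (2 s) f] would thus be of
    order [n ^ s] only.  Comparing it with its analogue at the level [n / q]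
    gives a recursive estimate that loses a constant at each step; for large [q]
    the gain [q ^ (s - alpha)] outweighs it ([growth_bound]), and the derivative
    is of order [n ^ (s - alpha)].  Then Jackson's theorem, for means with the
    square of the Fejer kernel, replaces [M ^ (2 s) f] by a polynomial without
    increasing the derivative by more than a constant ([jackson_theorem]).

    The lattice need not be invariant under translation, so Minkowski's
    inequality for convolutions is not available.  Every operator is instead
    dominated pointwise by averages of the modulus of the function, which are
    bounded on the lattice ([steklov_window], [norm_dyadic_le]). *)

Set Implicit Arguments.
Unset Strict Implicit.
Unset Printing Implicit Defensive.
Import Order.TTheory GRing.Theory Num.Theory.
Import numFieldNormedType.Exports.

Local Open Scope classical_set_scope.
Local Open Scope ring_scope.

#[local] Instance ae_lebesgue_filter (R : realType) :
  Filter (almost_everywhere (@lebesgue_measure R)).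
Proof. exact: ae_filter_ringOfSetsType. Qed.

(** * Integrals and null sets *)

Section integrals.
Import HBNNSimple.
Context {R : realType}.
Notation mu := (@lebesgue_measure R).
Implicit Types (f g u : R -> R) (a b c : R).

(** The integral is a supremum over Borel simple minorants whatever the integrand.
    Cutting a minorant of [f] off on the null set where [f <= g] may fail keeps
    its integral and makes it a minorant of [g], so [f] and [g] may be
    arbitrary functions. *)
Lemma ge0_ae_le_integral (f g : R -> \bar R) :
  (forall x, 0 <= f x)%E -> (forall x, 0 <= g x)%E ->
  {ae mu, forall x, (f x <= g x)%E} ->
  (\int[mu]_x f x <= \int[mu]_x g x)%E.
Proof.
move=> f0 g0 [N [mN N0 Nfg]].
rewrite ge0_integralTE// [leRHS]ge0_integralTE//.
apply: ge_ereal_sup => _ [h /= hf <-].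
have mN' : measurable (~` N) by exact: measurableC.
rewrite -integralT_nnsfun.
have -> : (\int[mu]_x (h x)%:E = \int[mu]_x (proj_nnsfun h mN' x)%:E)%E.
  apply: ae_eq_integral => //; first exact/measurable_EFinP.
    exact/measurable_EFinP.
  exists N; split => // x /= /not_implyP[_ hx].
  apply: contrapT => Nx; apply: hx.
  by rewrite /= mindicE mem_set// mulr1.
rewrite integralT_nnsfun; apply: ereal_sup_ubound; exists (proj_nnsfun h mN') => //= x.
rewrite mindicE; case: (boolP (x \in ~` N)) => [/set_mem Nx|_]; rewrite ?mulr1 ?mulr0//.
apply: (le_trans (hf x)); apply: contrapT => fgx; apply: Nx; exact: Nfg.
Qed.

Lemma ae_eq_integralT (f g : R -> \bar R) :
  {ae mu, forall x, f x = g x} -> (\int[mu]_x f x = \int[mu]_x g x)%E.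
Proof.
move=> fg; rewrite integralE [RHS]integralE; congr (_ - _)%E; apply/eqP.
  by rewrite eq_le; apply/andP; split; apply: ge0_ae_le_integral => //;
    apply: filterS fg => x fgx; rewrite !funeposE fgx.
by rewrite eq_le; apply/andP; split; apply: ge0_ae_le_integral => //;
  apply: filterS fg => x fgx; rewrite !funenegE fgx.
Qed.

Lemma ae_eq_integralD (D : set R) (f g : R -> \bar R) :
  {ae mu, forall x, f x = g x} ->
  (\int[mu]_(x in D) f x = \int[mu]_(x in D) g x)%E.
Proof.
move=> fg; rewrite integral_mkcond [RHS]integral_mkcond.
by apply: ae_eq_integralT; apply: filterS fg => x fgx; rewrite !patchE fgx.
Qed.

Lemma lebesgue_measure_shift c (A : set R) : measurable A ->
  mu A = pushforward mu (fun x : measurableTypeR R => (x + c : measurableTypeR R)) A.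
Proof.
have mc : measurable_fun [set: R] (fun x : R => x + c) by exact: measurable_funD.
move: A; apply: (@lebesgue_measure_unique _
  (pushforward mu (fun x : measurableTypeR R => (x + c : measurableTypeR R)))).
move=> _ [[a b] /= _ <-]; rewrite /pushforward.
have -> : (fun x : R => x + c) @^-1` `]a, b] = `](a - c), (b - c)]%classic.
  by apply/seteqP; split => x /=; rewrite !in_itv/= ltrBlDr lerBrDr.
rewrite !lebesgue_measure_itv/= !lte_fin ltrD2r.
by case: ifP => // _; congr (_%:E); ring.
Qed.

End integrals.

Section borel_representatives.
Context {R : realType}.
Notation mu := (@lebesgue_measure R).
Implicit Types (f g u : R -> R) (a b c : R).

(** The super-level sets of [f] at rational levels are Borel up to null sets.
    They are countably many, so a single null set [N] serves all of them and
    [f] becomes Borel once it is set to [0] on [N]. *)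
Lemma lebesgue_measurable_borel f : lebesgue_measurable_fun f ->
  exists N : set R, [/\ measurable N, mu N = 0 &
    measurable_fun setT (fun x => f x * \1_(~` N) x)].
Proof.
move=> mf; pose q n : R := ratr (odflt 0 (@unpickle rat n)).
have qP (x y : R) : x < y -> exists n, x < q n < y.
  move=> /rat_in_itvoo[p]; rewrite in_itv/= => pxy.
  by exists (pickle p); rewrite /q pickleK.
have F n : exists AN : set R * set R, [/\ measurable AN.1, measurable AN.2,
    mu AN.2 = 0 & forall x, ~ AN.2 x -> (q n < f x) <-> AN.1 x].
  have : (completed_algebra_gen mu) (f @^-1` `]q n, +oo[).
    rewrite -g_sigma_completed_algebra_genE -[X in _ X]setTI.
    by apply: mf => //; exact: measurable_itv.
  move=> [A mA [M [N [mN N0 MN]] AM]]; exists (A, N); split => //= x Nx.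
  have -> : (q n < f x) = (f @^-1` `]q n, +oo[) x :> Prop.
    by rewrite /= in_itv/= andbT.
  by rewrite -AM; split => [[//|/MN]|]; [exact|left].
have [AN ANP] := choice F; exists (\bigcup_n (AN n).2); split.
- by apply: bigcupT_measurable => n; have [] := ANP n.
- apply/eqP; rewrite -measure_le0; apply/eqP.
  have /negligibleP : mu.-negligible (\bigcup_n (AN n).2).
    apply: negligible_bigcup => n; have [_ mN N0 _] := ANP n.
    exact/negligibleP.
  move=> ->; rewrite ?lexx//.
  by apply: bigcupT_measurable => n; have [] := ANP n.
set N := \bigcup_n _.
have mN : measurable N by apply: bigcupT_measurable => n; have [] := ANP n.
apply: (measurability _ (RGenOInfty.measurableE R)) => //.
move=> /= _ [_ [y ->] <-]; rewrite setTI.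
have -> : (fun x => f x * \1_(~` N) x) @^-1` `]y, +oo[ =
    \bigcup_(n in [set n | y <= q n])
      (((AN n).1 `&` ~` N) `|` (if q n < 0 then N else set0)).
  apply/seteqP; split => x /=; rewrite ?in_itv/= ?andbT.
    move=> /qP[n /andP[yq qf]]; exists n; first exact: ltW.
    move: qf; rewrite indicE; case: (boolP (x \in ~` N)) => [/set_mem Nx|].
      rewrite mulr1 => qf; left; split => //.
      have [_ _ _ /(_ x)] := ANP n; move=> H; apply/H => //.
      by move=> ANx; apply: Nx; exists n.
    by rewrite notin_setE/= mulr0 => /contrapT Nx ->; right.
  move=> [n /= yq [[An Nx]|]].
    rewrite indicE mem_set// mulr1; apply: (le_lt_trans yq).
    by have [_ _ _ H] := ANP n; apply/H => // ANx; apply: Nx; exists n.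
  case: ifPn => // q0 Nx; rewrite indicE memNset ?mulr0; last exact.
  exact: le_lt_trans q0.
apply: bigcup_measurable => n _; apply: measurableU.
  by apply: measurableI; [have [] := ANP n|exact: measurableC].
by case: ifP.
Qed.

Lemma integral_shift c (D : set R) (f : R -> \bar R) : measurable D ->
  measurable_fun setT f ->
  (\int[mu]_(x in D) f x =
   \int[mu]_(x in (fun x : R => x + c)%R @^-1` D) f (x + c)%R)%E.
Proof.
move=> mD mf.
have mc : measurable_fun [set: measurableTypeR R]
    (fun x : measurableTypeR R => (x + c)%R : measurableTypeR R).
  exact: measurable_funD.
have ge0 (g : R -> \bar R) : measurable_fun setT g -> (forall x, 0 <= g x)%E ->
    (\int[mu]_(x in D) g x =
     \int[mu]_(x in (fun x : R => x + c)%R @^-1` D) g (x + c)%R)%E.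
  move=> mg g0; rewrite (@eq_measure_integral _ _ _ _ (pushforward mu
      (fun x : measurableTypeR R => (x + c)%R : measurableTypeR R))).
    by rewrite ge0_integral_pushforward//; exact: measurable_funTS.
  by move=> A mA _; exact: lebesgue_measure_shift.
rewrite integralE [RHS]integralE ge0; last 2 first.
- exact: measurable_funepos.
- exact: funepos_ge0.
rewrite (ge0 f^\-)%E; last 2 first.
- exact: measurable_funeneg.
- exact: funeneg_ge0.
congr (_ - _)%E; apply: eq_integral => x _.
  by rewrite !funeposE.
by rewrite !funenegE.
Qed.

End borel_representatives.

(** * Locally integrable functions *)

Section local_integrability.
Context {R : realType}.
Notation mu := (@lebesgue_measure R).
Implicit Types (f g u : R -> R) (a b c : R).

(** Elements of the lattice are Lebesgue measurable, whereas integrability refers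
    to the Borel sigma-algebra; hence the Borel representative [f0]. *)
Definition locint f := exists f0 : R -> R,
  [/\ {ae mu, forall x, f x = f0 x} &
      forall a b, mu.-integrable `[a, b] (EFin \o f0)].

Definition segint a b f : R := \int[mu]_(t in `[a, b]) f t.

Lemma segint_ae a b f g : {ae mu, forall x, f x = g x} -> segint a b f = segint a b g.
Proof.
move=> fg; congr fine; apply: ae_eq_integralD.
by apply: filterS fg => x ->.
Qed.

Lemma locint_continuous f : continuous f -> locint f.
Proof.
move=> cf; exists f; split; first exact: aeW.
move=> a b; apply: continuous_compact_integrable; first exact: segment_compact.
exact: continuous_subspaceT.
Qed.

Lemma locint_lin c f g : locint f -> locint g ->
  locint (fun x => c * f x + g x).
Proof.
move=> [f0 [ff0 If]] [g0 [gg0 Ig]]; exists (fun x => c * f0 x + g0 x); split.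
  by apply: filterS2 ff0 gg0 => x -> ->.
move=> a b.
rewrite (_ : EFin \o _ = (fun x => c%:E * (EFin \o f0) x) \+ (EFin \o g0))%E//.
by apply: integrableD => //; apply: integrableZl.
Qed.

Lemma locint_abs f : locint f -> locint (fun x => `|f x|).
Proof.
move=> [f0 [ff0 If]]; exists (fun x => `|f0 x|); split.
  by apply: filterS ff0 => x ->.
by move=> a b; apply: (@integrable_norm _ _ _ mu `[a, b]%classic f0).
Qed.

Lemma segint_lin a b c f g : locint f -> locint g ->
  segint a b (fun x => c * f x + g x) = c * segint a b f + segint a b g.
Proof.
move=> [f0 [ff0 If]] [g0 [gg0 Ig]].
rewrite (segint_ae a b ff0) (segint_ae a b gg0).
rewrite (@segint_ae a b _ (fun x => c * f0 x + g0 x)); last first.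
  by apply: filterS2 ff0 gg0 => x -> ->.
have Ic : mu.-integrable `[a, b] (fun x => c%:E * (EFin \o f0) x)%E.
  exact: integrableZl.
rewrite /segint RintegralD//.
by rewrite RintegralZl.
Qed.

Lemma segintZ a b c f : locint f -> segint a b (fun x => c * f x) = c * segint a b f.
Proof.
move=> lf; have /(segint_lin a b c lf) : locint (fun=> 0 : R).
  by apply: locint_continuous; exact: cst_continuous.
under eq_fun do rewrite addr0; move=> ->.
by rewrite /segint /Rintegral integral0 addr0.
Qed.

Lemma segintB a b f g : locint f -> locint g ->
  segint a b (fun x => f x - g x) = segint a b f - segint a b g.
Proof.
move=> lf lg; have := segint_lin a b (-1) lg lf.
under eq_fun do rewrite mulN1r addrC; move=> ->.
by rewrite mulN1r addrC.
Qed.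

Lemma segintD a b f g : locint f -> locint g ->
  segint a b (fun x => f x + g x) = segint a b f + segint a b g.
Proof.
by move=> lf lg; have := segint_lin a b 1 lf lg;
  under eq_fun do rewrite mul1r; move=> ->; rewrite mul1r.
Qed.

Lemma locintZ c f : locint f -> locint (fun x => c * f x).
Proof.
move=> lf; have : locint (fun=> 0 : R).
  by apply: locint_continuous; exact: cst_continuous.
by move=> /(locint_lin c lf); under eq_fun do rewrite addr0.
Qed.

Lemma locintD f g : locint f -> locint g -> locint (fun x => f x + g x).
Proof.
by move=> lf lg; have := locint_lin 1 lf lg; under eq_fun do rewrite mul1r.
Qed.

Lemma locintB f g : locint f -> locint g -> locint (fun x => f x - g x).
Proof.
move=> lf lg; have := locint_lin (-1) lg lf.
by under eq_fun do rewrite mulN1r addrC.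
Qed.

Lemma segint_ge0 a b f : (forall x, a <= x <= b -> 0 <= f x) -> 0 <= segint a b f.
Proof. by move=> f0; apply: Rintegral_ge0 => x /=; rewrite in_itv/= => /f0. Qed.

Lemma segint_le a b f g : locint f -> locint g ->
  (forall x, a <= x <= b -> f x <= g x) -> segint a b f <= segint a b g.
Proof.
move=> lf lg fg; rewrite -subr_ge0 -segintB//; apply: segint_ge0 => x /fg.
by rewrite subr_ge0.
Qed.

Lemma segint_cst a b c : a <= b -> segint a b (fun=> c) = c * (b - a).
Proof.
move=> ab; rewrite /segint Rintegral_cst//= lebesgue_measure_itv/= lte_fin.
by move: ab; rewrite le_eqVlt => /predU1P[->|->//]; rewrite ltxx subrr.
Qed.

Lemma ler_norm_segint a b f : locint f -> `|segint a b f| <= segint a b (fun x => `|f x|).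
Proof.
move=> lf; have la := locint_abs lf.
rewrite ler_norml -[X in - X]mul1r -mulNr -segintZ// !segint_le//.
- by move=> x _; exact: ler_norm.
- exact: locintZ.
- by move=> x _; rewrite mulN1r lerNl -normrN ler_norm.
Qed.

Lemma segint_eq_oo a b f g : (forall x, a < x < b -> f x = g x) ->
  segint a b f = segint a b g.
Proof.
move=> fg; rewrite /segint /Rintegral integral_mkcond [in RHS]integral_mkcond.
congr fine; apply: ae_eq_integralT.
have N0 (c : R) : {ae mu, forall x, x != c}.
  exists [set c]; split; rewrite ?lebesgue_measure_set1//.
  by move=> x /= /negP; rewrite negbK => /eqP.
apply: filterS2 (N0 a) (N0 b) => x xa xb; rewrite !patchE.
case: ifPn => // /set_mem/=; rewrite in_itv/= => /andP[ax xb'].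
by rewrite fg// !lt_neqAle eq_sym xa ax xb xb'.
Qed.

Lemma segint_cat b a c f : locint f -> a <= b -> b <= c ->
  segint a c f = segint a b f + segint b c f.
Proof.
move=> [f0 [ff0 If]] ab bc; rewrite !(segint_ae _ _ ff0) /segint.
have := @Rintegral_itvB R f0 (BLeft a) (BRight c) b (If a c).
rewrite !bnd_simp => /(_ ab bc)/esym; rewrite Rintegral_itv_obnd_cbnd.
  by move=> ->; rewrite addrC subrK.
apply: integrableS (If b c) => //; apply: subset_itvr.
by rewrite bnd_simp.
Qed.

Lemma segint_sub a b c d f : locint f -> c <= a -> a <= b -> b <= d ->
  segint a b (fun x => `|f x|) <= segint c d (fun x => `|f x|).
Proof.
move=> /locint_abs lf ca ab bd.
rewrite (segint_cat lf ca (le_trans ab bd)) (segint_cat lf ab bd).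
have p0 e e' : 0 <= segint e e' (fun x => `|f x|) by apply: segint_ge0.
by rewrite addrCA ler_wpDr// addr_ge0.
Qed.

Lemma segint_shift a b c f : continuous f ->
  segint (a + c) (b + c) f = segint a b (fun x => f (x + c)).
Proof.
move=> cf; congr fine; rewrite (@integral_shift _ c)//.
  congr (integral _ _ _); apply/seteqP; split => x /=; rewrite !in_itv/=;
    by rewrite !lerD2r.
by apply/measurable_EFinP; exact: continuous_measurable_fun.
Qed.

(** The integral over one period is finite and every segment is covered by
    finitely many translates of the period. *)
Lemma locint_circle f : measurable_on_circle f ->
  (\int[mu]_(x in @circle R) `|f x|%:E < +oo)%E -> locint f.
Proof.
move=> [perf mf] intf; have [N [mN N0 mf0]] := lebesgue_measurable_borel mf.
set f0 := (fun x => f x * _) in mf0; exists f0; split.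
  exists N; split => // x /=; apply: contra_notP => Nx.
  by rewrite /f0 indicE mem_set ?mulr1.
have f0f x : `|f0 x| <= `|f x|.
  by rewrite /f0 indicE normrM; case: (_ \in _);
    rewrite ?normr1 ?mulr1// normr0 mulr0.
have mf0' : measurable_fun setT (fun x => (`|f0 x|%:E)).
  by apply/measurable_EFinP; exact: measurableT_comp.
have cell c : (forall x, f (x + c) = f x) ->
    (\int[mu]_(x in `[(- pi + c)%R, (pi + c)%R[) `|f0 x|%:E < +oo)%E.
  move=> fc; rewrite (@integral_shift _ c)//.
  have -> : (fun x : R => x + c) @^-1` `[- pi + c, pi + c[ = @circle R.
    by apply/seteqP; split => x /=; rewrite !in_itv/= lerD2r ltrD2r.
  apply: le_lt_trans intf; rewrite integral_mkcond [leRHS]integral_mkcond.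
  apply: ge0_ae_le_integral => [x|x|]; rewrite ?patchE; try by case: ifP.
  apply: aeW => x; rewrite !patchE; case: ifP => // _.
  by rewrite lee_fin -(fc x).
pose J k := [set` `[- pi - (pi *+ 2) *+ k, pi + (pi *+ 2) *+ k[] : set R.
have pi0 := pi_gt0 R.
have step k : (\int[mu]_(x in J k) `|f0 x|%:E < +oo)%E.
  elim: k => [|k IH].
    rewrite /J !mulr0n subr0 addr0; have := cell 0; rewrite !addr0; apply.
    by move=> x; rewrite addr0.
  pose cl := `[- pi - (pi *+ 2) *+ k.+1, - pi - (pi *+ 2) *+ k[%classic : set R.
  pose cr := `[pi + (pi *+ 2) *+ k, pi + (pi *+ 2) *+ k.+1[%classic : set R.
  have k0 : 0 <= (pi *+ 2) *+ k :> R by rewrite mulrn_wge0// mulrn_wge0// ltW.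
  have JE : J k.+1 = (cl `|` J k) `|` cr.
    rewrite /J /cl /cr mulrS -!itv_bndbnd_setU ?bnd_simp//; clear intf IH N0; lra.
  have mono j : (forall x, f (x + (pi *+ 2) *+ j) = f x) by exact: periodicn.
  have percl : forall x, f (x - (pi *+ 2) *+ k.+1) = f x.
    by move=> x; rewrite -[in RHS](subrK ((pi *+ 2) *+ k.+1) x) mono.
  have disj (A B : set R) : (forall x : R, A x -> B x -> False) ->
      [disjoint A & B].
    by move=> AB; apply/disj_setPS => x [Ax Bx]; exact: AB Bx.
  rewrite JE ge0_integral_setU//; last 3 first.
  - exact: measurable_itv.
  - exact: measurable_funTS.
  - apply: disj => x [|]; rewrite /cl /J /cr /= !in_itv/=;
      move=> /andP[? ?] /andP[? ?]; clear intf IH N0; lra.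
  rewrite ge0_integral_setU//; last 3 first.
  - exact: measurable_itv.
  - exact: measurable_funTS.
  - apply: disj => x; rewrite /cl /J /= !in_itv/=;
      move=> /andP[? ?] /andP[? ?]; clear intf IH N0; lra.
  apply: lte_add_pinfty; first apply: lte_add_pinfty => //.
    rewrite /cl (_ : - pi - (pi *+ 2) *+ k = pi - (pi *+ 2) *+ k.+1).
      exact: cell percl.
    by rewrite mulrSr; ring.
  rewrite /cr (_ : pi + (pi *+ 2) *+ k = - pi + (pi *+ 2) *+ k.+1).
    exact: cell (mono k.+1).
  by rewrite mulrSr; ring.
  exact: measurable_itv.
  by apply: measurableU; exact: measurable_itv.
move=> a b; pose k := Num.truncn (`|a| + `|b|); have Jab : `[a, b] `<=` J k.+1.
  move=> x; rewrite /J /= !in_itv/= => /andP[ax xb].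
  have : `|a| + `|b| < k.+1%:R by rewrite truncnS_gt.
  have : k.+1%:R <= (pi *+ 2) *+ k.+1 :> R.
    by rewrite -[leRHS]mulr_natr ler_peMl//; have := pi_ge2 R; lra.
  have := ler_norm b; have := ler_norm (- a); rewrite normrN.
  have := normr_ge0 a; have := normr_ge0 b.
  by move=> *; clear intf N0; apply/andP; split; lra.
suff : mu.-integrable (J k.+1) (EFin \o f0).
  by apply: integrableS => //; exact: measurable_itv.
apply/integrableP; split; last exact: step.
by apply/measurable_EFinP; exact: measurable_funTS.
Qed.

Lemma locint_bl (X : banach_lattice R) f : bl_set X f -> locint f.
Proof.
move=> Xf; apply: locint_circle; first exact: bl_measurable Xf.
have mC : lebesgue_measurable_set (@circle R).
  apply: sub_sigma_algebra; exists (@circle R); first exact: measurable_itv.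
  by exists set0; [exact: negligible_set0|rewrite setU0].
have [_ [c c0 /(_ f Xf)]] := bl_indic X (@subset_refl _ (@circle R)) mC.
rewrite /circle_integral => h.
have p0 : 0 < (pi *+ 2)^-1 :> R by rewrite invr_gt0 mulrn_wgt0// pi_gt0.
rewrite ltey; apply/eqP => E; move: h; rewrite E gt0_muley ?lte_fin//.
Qed.

End local_integrability.

(** * Steklov averages *)

Section steklov_averages.
Context {R : realType}.
Notation mu := (@lebesgue_measure R).
Implicit Types (f g u w : R -> R) (h x y : R).

Lemma steklovE h f x : steklov h f x = h^-1 * segint (x - h / 2) (x + h / 2) f.
Proof. by []. Qed.

Lemma steklov_dotE h f x : steklov_dot h f x = h^-1 * segint x (x + h) f.
Proof.
rewrite /steklov_dot steklovE addrK; congr (_ * segint _ _ _).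
by rewrite -addrA -splitr.
Qed.

Lemma steklov_lin h c f g x : locint f -> locint g ->
  steklov h (fun y => c * f y + g y) x = c * steklov h f x + steklov h g x.
Proof. by move=> lf lg; rewrite !steklovE segint_lin//; ring. Qed.

Lemma steklovZ h c f x : locint f ->
  steklov h (fun y => c * f y) x = c * steklov h f x.
Proof. by move=> lf; rewrite !steklovE segintZ//; ring. Qed.

Lemma steklovB h f g x : locint f -> locint g ->
  steklov h (fun y => f y - g y) x = steklov h f x - steklov h g x.
Proof. by move=> lf lg; rewrite !steklovE segintB//; ring. Qed.

Lemma steklov_ge0 h w x : 0 < h -> (forall y, 0 <= w y) -> 0 <= steklov h w x.
Proof.
by move=> h0 w0; rewrite steklovE mulr_ge0 ?invr_ge0 ?(ltW h0)// segint_ge0.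
Qed.

Lemma ler_norm_steklov h f x : 0 < h -> locint f ->
  `|steklov h f x| <= steklov h (fun y => `|f y|) x.
Proof.
move=> h0 lf; rewrite !steklovE normrM gtr0_norm ?invr_gt0//.
by rewrite ler_pM2l ?invr_gt0// ler_norm_segint.
Qed.

(** All comparisons between averages at different centres and scales come from
    here: for nonnegative integrands, enlarging the window only costs the ratio
    of the lengths. *)
Lemma segint_le_steklov h f a b y : 0 < h -> locint f ->
  y - h / 2 <= a -> a <= b -> b <= y + h / 2 ->
  segint a b (fun x => `|f x|) <= h * steklov h (fun x => `|f x|) y.
Proof.
move=> h0 lf ya ab yb; rewrite steklovE mulrA mulfV ?gt_eqF// mul1r.
exact: segint_sub.
Qed.

Lemma steklov_window h h' f x y : 0 < h -> 0 < h' -> locint f ->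
  `|x - y| + h / 2 <= h' / 2 ->
  steklov h (fun z => `|f z|) x <= h' / h * steklov h' (fun z => `|f z|) y.
Proof.
move=> h0 h'0 lf xy; have := ler_norm (x - y); have := ler_norm (- (x - y)); rewrite normrN => ? ?.
rewrite steklovE (_ : h' / h * _ = h^-1 * (h' * steklov h' (fun z => `|f z|) y)).
  by rewrite ler_pM2l ?invr_gt0//; apply: segint_le_steklov => //; lra.
by ring.
Qed.

Lemma continuous_segint f a x : locint f -> a < x ->
  {for x, continuous (fun z => segint a z f)}.
Proof.
move=> [f0 [ff0 If]] ax.
have -> : (fun z => segint a z f) = (fun z => segint a z f0).
  by apply/funext => z; exact: segint_ae.
have xx1 : x < x + 1 by rewrite ltrDl.
have ax1 : a < x + 1 by exact: lt_trans xx1.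
apply: (@within_continuous_continuous _ _ _ a (x + 1)) => //.
  exact: (parameterized_integral_continuous (ltW ax1) (If a (x + 1))).
by rewrite in_itv/= ax xx1.
Qed.

Lemma continuous_steklov h f : 0 < h -> locint f -> continuous (steklov h f).
Proof.
move=> h0 lf x; pose a := x - h - 1.
pose F z := h^-1 * (segint a (z + h / 2) f - segint a (z - h / 2) f).
have E : {near x, F =1 steklov h f}.
  near=> z; have zx : x - h / 2 - 1 < z by near: z; apply: lt_nbhsr; lra.
  rewrite /F steklovE (@segint_cat _ (z - h / 2) a)//.
  - by rewrite addrC addKr.
  - by rewrite /a; lra.
  - lra.
have Fx : F x = steklov h f x by exact: nbhs_singleton E.
have cF : {for x, continuous F}.
  have cs (c : R) : a < x + c -> {for x, continuous (fun z => segint a (z + c) f)}.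
    move=> axc; apply: (@continuous_comp _ _ _ (fun z => z + c) (fun z => segint a z f)).
      by apply: cvgD; [exact: cvg_id|exact: cvg_cst].
    exact: continuous_segint.
  apply: cvgM; first exact: cvg_cst.
  by apply: cvgB; apply: cs; rewrite /a; lra.
rewrite /continuous_at -Fx; apply: cvg_trans cF; exact: near_eq_cvg.
Unshelve. all: by end_near. Qed.

Lemma locint_steklov h f : 0 < h -> locint f -> locint (steklov h f).
Proof. by move=> h0 lf; apply/locint_continuous/continuous_steklov. Qed.

Lemma continuous_shift (f : R -> R) c : continuous f -> continuous (fun x => f (x + c)).
Proof.
move=> cf x; apply: (@continuous_comp _ _ _ (fun z => z + c) f).
  by apply: cvgD; [exact: cvg_id|exact: cvg_cst].
exact: cf.
Qed.

Lemma continuous_steklov_dot h f : 0 < h -> locint f ->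
  continuous (steklov_dot h f).
Proof. by move=> h0 lf; apply/continuous_shift/continuous_steklov. Qed.

Lemma locint_steklov_dot h f : 0 < h -> locint f -> locint (steklov_dot h f).
Proof. by move=> h0 lf; apply/locint_continuous/continuous_steklov_dot. Qed.

Lemma steklov_dot_window h h' f x y : 0 < h -> 0 < h' -> locint f ->
  `|x - y| + h <= h' / 2 ->
  `|steklov_dot h f x| <= h' / h * steklov h' (fun z => `|f z|) y.
Proof.
move=> h0 h'0 lf xy; apply: le_trans (ler_norm_steklov _ _ _) _ => //.
apply: steklov_window => //.
have := ler_normD (x - y) (h / 2); rewrite [`|h / 2|]gtr0_norm ?divr_gt0//.
rewrite addrAC; lra.
Qed.

Lemma segint_deriv (F f : R -> R) a b : a <= b -> continuous f ->
  (forall x, is_derive x 1 F (f x)) -> segint a b f = F b - F a.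
Proof.
rewrite le_eqVlt => /predU1P[<- _ _|ab cf dF].
  by rewrite /segint set_itv1 Rintegral_set1 subrr.
have cF : continuous F.
  move=> x; apply: differentiable_continuous; apply/derivable1_diffP.
  by have [] := dF x.
rewrite /segint /Rintegral (@continuous_FTC2 _ f F)//.
- exact: continuous_subspaceT.
- split => [x _||]; first by have [] := dF x.
    by apply: cvg_at_right_filter; exact: cF.
  by apply: cvg_at_left_filter; exact: cF.
- by move=> x _; rewrite derive1E; have [_] := dF x.
Qed.

Lemma is_derive_segint f a x : continuous f -> a < x ->
  is_derive x 1 (fun z => segint a z f) (f x).
Proof.
move=> cf ax; have xx1 : x < x + 1 by rewrite ltrDl.
have ci : mu.-integrable `[a, x + 1] (EFin \o f).
  apply: continuous_compact_integrable; first exact: segment_compact.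
  exact: continuous_subspaceT.
have [d1 d2] := continuous_FTC1_closed xx1 ci ax (cf x).
by apply: DeriveDef => //; rewrite -derive1E.
Qed.

Lemma is_derive_linc (c : R) (f g : R -> R) x a b :
  is_derive x 1 f a -> is_derive x 1 g b ->
  is_derive x 1 (fun y => c * f y + g y) (c * a + b).
Proof. by move=> df dg; apply: is_deriveD; apply: is_deriveZ. Qed.

Lemma is_derive_cmul (c : R) (f : R -> R) x a :
  is_derive x 1 f a -> is_derive x 1 (fun y => c * f y) (c * a).
Proof. by move=> df; apply: is_deriveZ. Qed.

Lemma is_derive_translate (c : R) (f : R -> R) x a :
  is_derive (x + c) 1 f a -> is_derive x 1 (fun y => f (y + c)) a.
Proof.
move=> df; rewrite -[a]mulr1.
have dg : is_derive x 1 (fun y : R => y + c) 1 := @is_derive_shift R x 1 c.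
exact: (@is_derive1_comp R f (fun y => y + c) x a 1 df dg).
Qed.

Lemma is_derive_steklov_dot h f x : 0 < h -> continuous f ->
  is_derive x 1 (steklov_dot h f) (h^-1 * (f (x + h) - f x)).
Proof.
move=> h0 cf; have lf := locint_continuous cf; pose a := x - 1.
pose F z := h^-1 * (segint a (z + h) f - segint a z f).
have E : {near x, F =1 steklov_dot h f}.
  near=> z; have zx : x - 1 < z by near: z; apply: lt_nbhsr; lra.
  rewrite /F steklov_dotE (@segint_cat _ z a)//.
  - by rewrite addrC addKr.
  - by rewrite /a; lra.
  - lra.
apply: near_eq_is_derive E _.
have -> : F = (fun z => h^-1 * ((-1) * segint a z f + segint a (z + h) f)).
  by apply/funext => z; rewrite mulN1r addrC.
have -> : f (x + h) - f x = (-1) * f x + f (x + h) by rewrite mulN1r addrC.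
have d1 : is_derive x 1 (fun z => segint a z f) (f x).
  by apply: is_derive_segint; rewrite // /a; lra.
have d2 : is_derive (x + h) 1 (fun z => segint a z f) (f (x + h)).
  by apply: is_derive_segint; rewrite // /a; lra.
exact: (is_derive_cmul h^-1 (is_derive_linc (-1) d1 (is_derive_translate d2))).
Unshelve. all: by end_near. Qed.

(** The difference quotient of [f] over [[x, x + h]] is the average of its
    derivative there. *)
Lemma is_derive_steklov_dot_comm h f g x : 0 < h -> continuous g ->
  (forall y, is_derive y 1 f (g y)) ->
  is_derive x 1 (steklov_dot h f) (steklov_dot h g x).
Proof.
move=> h0 cg df; have cf : continuous f.
  move=> z; apply: differentiable_continuous; apply/derivable1_diffP.
  by have [] := df z.
rewrite [X in is_derive _ _ _ X]steklov_dotE (@segint_deriv f g) ?lerDl ?(ltW h0)//.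
exact: is_derive_steklov_dot.
Qed.

End steklov_averages.

(** * Bounded operators on the lattice *)

Section lattice.
Context {R : realType} (X : banach_lattice R).
Implicit Types (f g u w : R -> R) (h x y c : R).
Notation nrm := (bl_norm X).

Lemma bl_set0 : bl_set X (fun=> 0).
Proof.
have m0 : lebesgue_measurable_set (set0 : set R) by exact: measurable0.
have [X0 _] := bl_indic X (@sub0set _ (@circle R)) m0.
have := bl_lin (-1) X0 X0; congr (bl_set X); apply/funext => x.
by rewrite mulN1r addNr.
Qed.

Lemma bl_setZ c f : bl_set X f -> bl_set X (fun x => c * f x).
Proof.
by move=> Xf; have := bl_lin c Xf bl_set0; under eq_fun do rewrite addr0.
Qed.

Lemma bl_setD f g : bl_set X f -> bl_set X g -> bl_set X (fun x => f x + g x).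
Proof.
by move=> Xf Xg; have := bl_lin 1 Xf Xg; under eq_fun do rewrite mul1r.
Qed.

Lemma bl_setN f : bl_set X f -> bl_set X (fun x => - f x).
Proof. by move=> /(bl_setZ (-1)); under eq_fun do rewrite mulN1r. Qed.

Lemma bl_setB f g : bl_set X f -> bl_set X g -> bl_set X (fun x => f x - g x).
Proof. by move=> Xf /bl_setN; exact: bl_setD. Qed.

Lemma bl_norm0 : nrm (fun=> 0) = 0.
Proof.
by have := bl_normZ 0 bl_set0; rewrite normr0 !mul0r.
Qed.

Lemma bl_normN f : bl_set X f -> nrm (fun x => - f x) = nrm f.
Proof.
move=> Xf; have := bl_normZ (-1) Xf; rewrite normrN1 mul1r => <-.
by congr nrm; apply/funext => x; rewrite mulN1r.
Qed.

Lemma bl_normB f g : bl_set X f -> bl_set X g ->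
  nrm (fun x => f x - g x) <= nrm f + nrm g.
Proof.
by move=> Xf Xg; rewrite -(bl_normN Xg); apply: bl_normD; last exact: bl_setN.
Qed.

Lemma bl_normBC f g : bl_set X f -> bl_set X g ->
  nrm (fun x => f x - g x) = nrm (fun x => g x - f x).
Proof.
move=> Xf Xg; rewrite -[RHS]bl_normN; last exact: bl_setB.
by under [in RHS]eq_fun do rewrite opprB.
Qed.

Lemma bl_norm_triangle f g w : bl_set X f -> bl_set X g -> bl_set X w ->
  nrm (fun x => f x - w x) <= nrm (fun x => f x - g x) + nrm (fun x => g x - w x).
Proof.
move=> Xf Xg Xw; have := bl_normD (bl_setB Xf Xg) (bl_setB Xg Xw).
by under [in X in X <= _ -> _]eq_fun do rewrite addrA subrK.
Qed.

Lemma bl_dom c f g : 0 <= c -> measurable_on_circle f -> bl_set X g ->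
  (forall x, `|f x| <= c * `|g x|) -> bl_set X f /\ nrm f <= c * nrm g.
Proof.
move=> c0 mf Xg fg; rewrite -(ger0_norm c0) -bl_normZ//.
apply: bl_ideal => //; first exact: bl_setZ.
by move=> x; rewrite normrM ger0_norm.
Qed.

Lemma measurable_on_circle_abs f : measurable_on_circle f ->
  measurable_on_circle (fun x => `|f x|).
Proof.
move=> [pf mf]; split; first by move=> x; rewrite pf.
by apply: (measurableT_comp _ mf); exact: normr_measurable.
Qed.

Lemma bl_abs f : bl_set X f ->
  bl_set X (fun x => `|f x|) /\ nrm (fun x => `|f x|) = nrm f.
Proof.
move=> Xf; have mf := bl_measurable Xf; have ma := measurable_on_circle_abs mf.
have [Xa n1] : bl_set X (fun x => `|f x|) /\ nrm (fun x => `|f x|) <= nrm f.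
  by apply: (bl_ideal ma Xf) => x; rewrite normr_id.
split=> //; apply/eqP; rewrite eq_le n1/=.
by have [] := @bl_ideal _ X f (fun x => `|f x|) mf Xa _ => // x; rewrite normr_id.
Qed.

Lemma bl_abs_set f : bl_set X f -> bl_set X (fun x => `|f x|).
Proof. by case/bl_abs. Qed.

Lemma bl_abs_norm f : bl_set X f -> nrm (fun x => `|f x|) = nrm f.
Proof. by case/bl_abs. Qed.

Lemma borel_lebesgue_measurable (A : set R) :
  measurable A -> lebesgue_measurable_set A.
Proof.
move=> mA; apply: sub_sigma_algebra; exists A => //.
by exists set0; [exact: negligible_set0|rewrite setU0].
Qed.

Lemma borel_lebesgue_measurable_fun f :
  measurable_fun setT f -> lebesgue_measurable_fun f.
Proof.
by move=> mf _ Y mY; rewrite setTI; apply: borel_lebesgue_measurable;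
  rewrite -[X in measurable X]setTI; exact: mf.
Qed.

Lemma continuous_on_circle f : continuous f -> periodic f (pi *+ 2) ->
  measurable_on_circle f.
Proof.
by move=> cf pf; split => //; apply: borel_lebesgue_measurable_fun;
  exact: continuous_measurable_fun.
Qed.

Lemma periodic_int f : periodic f (pi *+ 2) ->
  forall (j : int) x, f (x + (pi *+ 2) *~ j) = f x.
Proof.
move=> pf [n|n] x; first by rewrite -pmulrn (periodicn pf).
rewrite NegzE mulrNz -pmulrn.
by rewrite -[in RHS](subrK ((pi *+ 2) *+ n.+1) x) (periodicn pf).
Qed.

Lemma circle_repr x : exists j : int, @circle R (x + (pi *+ 2) *~ j).
Proof.
have p0 : 0 < pi *+ 2 :> R by rewrite mulrn_wgt0// pi_gt0.
pose q := (x + pi) / (pi *+ 2); exists (- Num.floor q).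
have qE : q * (pi *+ 2) = x + pi by rewrite mulfVK// gt_eqF.
have := floor_le q; have := floorD1_gt q; rewrite intrD => h1 h2.
rewrite /circle /= in_itv/= mulrNz -mulrzl.
have := ler_wpM2r (ltW p0) h2; rewrite qE => h3.
have : q * (pi *+ 2) < ((Num.floor q)%:~R + 1) * (pi *+ 2).
  by rewrite ltr_pM2r.
rewrite qE mulrDl mul1r => h4; apply/andP; split; lra.
Qed.

Lemma bl_cst : bl_set X (fun=> 1).
Proof.
have mc : lebesgue_measurable_set (@circle R).
  by apply: borel_lebesgue_measurable; exact: measurable_itv.
have [+ _] := bl_indic X (@subset_refl _ (@circle R)) mc.
congr (bl_set X); apply/funext => x; rewrite indicE mem_set//=.
by have [j cj] := circle_repr x; exists j.
Qed.

Lemma bl_bounded f (M : R) : measurable_on_circle f -> (forall x, `|f x| <= M) ->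
  bl_set X f.
Proof.
move=> mf fM; have M0 : 0 <= M by rewrite (le_trans _ (fM 0)).
have [] // := @bl_dom M f (fun=> 1) M0 mf bl_cst.
by move=> x; rewrite normr1 mulr1.
Qed.

Lemma continuous_periodic_bounded f : continuous f -> periodic f (pi *+ 2) ->
  exists M : R, forall x, `|f x| <= M.
Proof.
move=> cf pf; have ca : {within `[- pi, pi], continuous (fun x => `|f x|)}.
  apply: continuous_subspaceT => x.
  by apply: (@continuous_comp _ _ _ f Num.norm); [exact: cf|exact: norm_continuous].
have pp : - pi <= pi :> R by rewrite (@le_trans _ _ 0)// ?oppr_le0 pi_ge0.
have [c _ fc] := EVT_max pp ca; exists `|f c| => x.
have [j cj] := circle_repr x; rewrite -(periodic_int pf j).
by apply: fc; move: cj; rewrite /circle/= !in_itv/= => /andP[-> /ltW].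
Qed.

Lemma bl_continuous f : continuous f -> periodic f (pi *+ 2) -> bl_set X f.
Proof.
move=> cf pf; have [M fM] := continuous_periodic_bounded cf pf.
by apply: bl_bounded fM; exact: continuous_on_circle.
Qed.

Lemma bl_sum n (F : nat -> R -> R) : (forall j, bl_set X (F j)) ->
  bl_set X (fun x => \sum_(j < n) F j x) /\
  nrm (fun x => \sum_(j < n) F j x) <= \sum_(j < n) nrm (F j).
Proof.
move=> XF; elim: n => [|n [X1 IH]].
  have -> : (fun x => \sum_(j < 0) F j x) = fun=> 0.
    by apply/funext => x; rewrite big_ord0.
  by rewrite big_ord0 bl_norm0; split => //; exact: bl_set0.
under eq_fun do rewrite big_ord_recr/=; rewrite [leRHS]big_ord_recr/=.
split; first exact: bl_setD.
by apply: le_trans (bl_normD X1 (XF n)) _; rewrite lerD2r.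
Qed.

(** Elements of the lattice are functions defined at every point, hence the
    pointwise form of linearity. *)
Definition bounded_op (A : (R -> R) -> R -> R) (K : R) : Prop :=
  [/\ 0 <= K,
      forall f, bl_set X f -> bl_set X (A f) /\ nrm (A f) <= K * nrm f &
      forall c f g, bl_set X f -> bl_set X g ->
        A (fun x => c * f x + g x) = (fun x => c * A f x + A g x)].

Lemma bounded_opB A K f g : bounded_op A K -> bl_set X f -> bl_set X g ->
  A (fun x => f x - g x) = (fun x => A f x - A g x).
Proof.
move=> [_ _ lA] Xf Xg; have := lA (-1) g f Xg Xf.
by under eq_fun do rewrite mulN1r addrC; move=> ->; apply/funext => x;
  rewrite mulN1r addrC.
Qed.

Lemma bounded_op_id : bounded_op id 1.
Proof. by split => // f Xf; rewrite mul1r. Qed.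

Lemma bounded_op_comp A B K L : bounded_op A K -> bounded_op B L ->
  bounded_op (A \o B) (K * L).
Proof.
move=> [K0 bA lA] [L0 bB lB]; split; first exact: mulr_ge0.
  move=> f Xf; have [XB nB] := bB f Xf; have [XA nA] := bA _ XB.
  by split => //=; apply: (le_trans nA); rewrite -mulrA ler_wpM2l.
by move=> c f g Xf Xg; rewrite /= lB// lA//; [case: (bB f)|case: (bB g)].
Qed.

Lemma bounded_op_sub A B K L : bounded_op A K -> bounded_op B L ->
  bounded_op (fun f x => A f x - B f x) (K + L).
Proof.
move=> [K0 bA lA] [L0 bB lB]; split; first exact: addr_ge0.
  move=> f Xf; have [XB nB] := bB f Xf; have [XA nA] := bA f Xf.
  split; first exact: bl_setB.
  by apply: (le_trans (bl_normB XA XB)); rewrite mulrDl lerD.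
by move=> c f g Xf Xg; apply/funext => x; rewrite lA// lB//; ring.
Qed.

Lemma bounded_op_iter A K n : bounded_op A K -> bounded_op (iter n A) (K ^+ n).
Proof.
move=> bA; elim: n => [|n IH]; first exact: bounded_op_id.
by rewrite exprS; exact: bounded_op_comp bA IH.
Qed.

Lemma bounded_op_id_sub_iter A K r : bounded_op A K ->
  bounded_op (id_sub_iter A r) ((1 + K) ^+ r).
Proof.
move=> bA; apply: bounded_op_iter.
exact: (bounded_op_sub bounded_op_id bA).
Qed.

(** By homogeneity.  For functions of norm [0], all multiples stay in the unit
    ball, so their averages would have unbounded norms unless these vanish. *)
Lemma assumptionA_bounded : assumptionA X -> exists2 C : R, 0 < C &
  forall h, 0 < h -> bounded_op (steklov h) C.
Proof.
move=> [XA [C0 bC]]; pose C := `|C0| + 1.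
have C1 : C0 <= C by rewrite /C (le_trans (ler_norm _))// lerDl.
have C0' : 0 < C by rewrite /C ltr_pwDr.
exists C => // h h0; split; first exact: ltW.
  move=> f Xf; split; first exact: XA.
  have nf := bl_norm_ge0 Xf; have nA := bl_norm_ge0 (XA f h Xf h0).
  have scale l : 0 <= l -> l * nrm f <= 1 -> l * nrm (steklov h f) <= C.
    move=> l0 lf; have := bC h (fun x => l * f x) h0 (bl_setZ l Xf).
    rewrite bl_normZ// ger0_norm// => /(_ lf) H; apply: le_trans C1.
    apply: le_trans H; rewrite -{1}(ger0_norm l0) -bl_normZ//; last exact: XA.
    rewrite le_eqVlt; apply/orP; left; apply/eqP; congr nrm.
    by apply/funext => x; rewrite steklovZ//; exact: locint_bl Xf.
  have [f0|fn0] := eqVneq (nrm f) 0.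
    rewrite f0 mulr0 leNgt; apply/negP => A0.
    have := scale ((C + 1) / nrm (steklov h f)) _ _.
    rewrite f0 mulr0 mulfVK ?gt_eqF//.
    rewrite divr_ge0//; last by rewrite addr_ge0// ltW.
    by move=> /(_ isT ler01); rewrite leNgt ltrDl ltr01.
  have fgt : 0 < nrm f by rewrite lt_neqAle eq_sym fn0.
  have := scale (nrm f)^-1; rewrite invr_ge0 mulVf// => /(_ nf (lexx _)).
  by rewrite mulrC ler_pdivrMr.
move=> c f g Xf Xg; apply/funext => x; rewrite steklov_lin//.
  exact: locint_bl Xf.
exact: locint_bl Xg.
Qed.

(** The lattice need not be invariant under translation, so this is no
    consequence of the bound for the centred average of [f]; but the window
    [[x, x + h]] lies in the centred window of length [2 * h]. *)
Lemma bounded_op_steklov_dot C : (forall h : R, 0 < h -> bounded_op (steklov h) C) ->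
  forall h, 0 < h -> bounded_op (steklov_dot h) (2 * C).
Proof.
move=> bA h h0; have h20 : 0 < 2 * h by rewrite mulr_gt0.
have [C0 bh lh] := bA h h0; have [_ b2 _] := bA _ h20.
split; first by rewrite mulr_ge0.
  move=> f Xf; have lf := locint_bl Xf.
  have [XA nA] := b2 _ (bl_abs_set Xf).
  have [XAh _] := bh f Xf.
  have mD : measurable_on_circle (steklov_dot h f).
    apply: continuous_on_circle; first exact: continuous_steklov_dot.
    move=> x; rewrite /steklov_dot addrAC.
    by have [-> _] := bl_measurable XAh.
  have [//||XD nD] := @bl_dom 2 _ _ _ mD XA.
    move=> x; rewrite [X in _ <= _ * X]ger0_norm; last first.
      exact: steklov_ge0.
    have := @steklov_dot_window _ h (2 * h) f x x h0 h20 lf.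
    rewrite subrr normr0 mulfK ?gt_eqF//; apply; lra.
  split => //; apply: (le_trans nD); rewrite -mulrA ler_wpM2l//.
  by rewrite -(bl_abs_norm Xf).
move=> c f g Xf Xg; apply/funext => x; rewrite /steklov_dot steklov_lin//.
  exact: locint_bl Xf.
exact: locint_bl Xg.
Qed.

End lattice.

(** * Taylor expansion and differences of averages *)

Section taylor.
Context {R : realType}.
Implicit Types (f g u w : R -> R) (h x y c M rho : R) (p : {poly R}).

Lemma poly_antideriv p : exists2 q : {poly R}, q^`() = p & (size q <= (size p).+1)%N.
Proof.
exists (\poly_(i < (size p).+1) (p`_i.-1 / i%:R)); last exact: size_poly.
apply/polyP => i; rewrite coef_deriv coef_poly ltnS.
case: ltnP => [ip|/leq_sizeP/(_ i) -> //]; last by rewrite mul0rn.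
by rewrite -[LHS]mulr_natr mulfVK// pnatr_eq0.
Qed.

Lemma is_derive_horner p x : is_derive x 1 (horner p) p^`().[x].
Proof.
apply: DeriveDef; first exact: derivable_horner.
by rewrite -derive1E -[RHS]/(horner p^`() x) derivE.
Qed.

Lemma ler_norm_mvt (F d : R -> R) x rho M : 
  (forall z, `|z - x| <= rho -> is_derive z 1 F (d z) /\ `|d z| <= M) ->
  forall y, `|y - x| <= rho -> `|F y - F x| <= M * rho.
Proof.
move=> H; have key a b : a <= b -> (forall z, a <= z <= b -> `|z - x| <= rho) ->
    `|F b - F a| <= M * (b - a).
  move=> ab inb; have dF z : a <= z <= b -> is_derive z 1 F (d z).
    by move=> /inb /H[].
  have [||z zab ->] := @MVT_segment R F d a b ab.
  - by move=> z; rewrite in_itv/= => /andP[az zb]; apply: dF; rewrite !ltW.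
  - apply: derivable_within_continuous => z; rewrite in_itv/= => /dF[].
    by [].
  - rewrite normrM [`|b - a|]ger0_norm ?subr_ge0// ler_wpM2r ?subr_ge0//.
    by move: zab; rewrite in_itv/= => /inb /H[].
move=> y yx; have M0 : 0 <= M.
  have [|_ dx] := H x; first by rewrite subrr normr0 (le_trans _ yx).
  exact: le_trans dx.
apply: (@le_trans _ _ (M * `|y - x|)); last by rewrite ler_wpM2l.
have := yx; rewrite ler_norml => /andP[yx1 yx2].
have [xy|yx'] := leP x y.
  rewrite [in leRHS]ger0_norm ?subr_ge0//; apply: key => // z /andP[xz zy].
  by rewrite ler_norml; apply/andP; split; lra.
rewrite distrC [in leRHS]distrC [in leRHS]ger0_norm ?subr_ge0 ?(ltW yx')//.
apply: key; first exact: ltW.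
by move=> z /andP[xz zy]; rewrite ler_norml; apply/andP; split; lra.
Qed.

(** [s] derivatives, the last one only almost everywhere: the derivative of
    order [s - 1] is controlled by the integral of the next one.  This is what
    smooth functions and splines have in common. *)
Definition integral_derivative (s : nat) g : Prop :=
  [/\ forall j, (j.+1 < s)%N -> forall x, derivable (derive1n j g) x 1,
      locint (derive1n s g) &
      forall a b, a <= b -> `|derive1n s.-1 g b - derive1n s.-1 g a| <=
        segint a b (fun t => `|derive1n s g t|)].

(** By integration of the claim for the derivative; at the bottom, the increment
    of the function is at most the integral of the next derivative. *)
Lemma taylor_poly s g x rho : 0 <= rho -> integral_derivative s.+1 g ->
  exists2 p : {poly R}, (size p <= s.+1)%N & forall y, `|y - x| <= rho ->
   `|g y - p.[y]| <=
     segint (x - rho) (x + rho) (fun t => `|derive1n s.+1 g t|) * rho ^+ s.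
Proof.
move=> rho0; elim: s g => [|s IH] g [dg lg ig].
  exists (g x)%:P; first by rewrite size_polyC leq_b1.
  move=> y; rewrite ler_norml => /andP[yx1 yx2]; rewrite hornerC expr0 mulr1.
  have [xy|yx] := leP x y.
    by apply: (le_trans (ig x y xy)); apply: segint_sub => //; lra.
  by rewrite distrC; apply: (le_trans (ig y x (ltW yx)));
    apply: segint_sub => //; lra.
have [|p sp hp] := IH (derive1 g).
  split => [j js z|//|a b ab].
  - by have := dg j.+1 js z; rewrite derive1Sn.
  - by rewrite -derive1Sn.
  - by have := ig a b ab; rewrite [s.+2.-1]/= [s.+1.-1]/= !derive1Sn.
have [q dq sq] := poly_antideriv p.
exists (q + (g x - q.[x])%:P).
  rewrite (leq_trans (size_polyD _ _))// geq_max (leq_trans sq)//=.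
  by rewrite (leq_trans (size_polyC_leq1 _)).
move=> y yx; rewrite hornerD hornerC.
have := @ler_norm_mvt (fun z => g z - q.[z]) (fun z => derive1 g z - p.[z]) x rho
  (segint (x - rho) (x + rho) (fun t => `|derive1n s.+2 g t|) * rho ^+ s) _ y yx.
rewrite -mulrA -exprSr => H.
rewrite [X in `|X|](_ : _ = g y - q.[y] - (g x - q.[x])); last by ring.
apply: H => z zx; split; last by rewrite derive1Sn; exact: hp.
have dgz : is_derive z 1 g (derive1 g z).
  by apply: DeriveDef; [exact: (dg 0%N)|rewrite derive1E].
rewrite -dq; exact: (is_deriveB dgz (is_derive_horner q z)).
Qed.

(** What the two averages have in common: [h] bounds the distance to the points
    that they look at, and polynomials of size [e] are reproduced. *)
Definition averaging (h : R) (e : nat) (A : (R -> R) -> R -> R) : Prop :=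
  [/\ forall f, locint f -> locint (A f),
      forall f g x, locint f -> locint g ->
        A (fun y => f y - g y) x = A f x - A g x,
      forall f M x, locint f -> (forall y, `|y - x| <= h -> `|f y| <= M) ->
        `|A f x| <= M,
      forall f g x, continuous g -> (forall y, is_derive y 1 f (g y)) ->
        is_derive x 1 (A f) (A g x) &
      forall p x, (size p <= e)%N -> A (horner p) x = p.[x]].

Lemma locint_horner p : locint (horner p).
Proof. by apply: locint_continuous; exact: continuous_horner. Qed.

(** The derivative of [f - A f] is [f' - A f'], so the claim for [f'] integrates
    to the claim for [f]; it starts from the polynomials that [A] reproduces. *)
Lemma averaging_poly h e A n p : averaging h e A -> (size p <= n + e)%N ->
  exists2 q : {poly R}, (size q <= n)%N &
    (fun x => p.[x] - A (horner p) x) = horner q.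
Proof.
move=> [lA AB bA dA pA]; elim: n p => [|n IH] p sp.
  exists 0; first by rewrite size_poly0.
  by apply/funext => x; rewrite pA// subrr horner0.
have [|q sq qE] := IH p^`().
  have [->|p0] := eqVneq p 0; first by rewrite deriv0 size_poly0.
  by have := leq_trans (lt_size_deriv p0) sp.
have [Q dQ sQ] := poly_antideriv q.
pose F x := p.[x] - A (horner p) x - Q.[x].
have dF x : is_derive x 1 F 0.
  have d1 := is_derive_horner p x.
  have d2 := dA (horner p) (horner p^`()) x (continuous_horner (p := _))
    (is_derive_horner p).
  have d3 := is_deriveB (is_deriveB d1 d2) (is_derive_horner Q x).
  apply: is_derive_eq d3 _; rewrite dQ -[q.[x]]/(horner q x) -qE subrr//.
exists (Q + (F 0)%:P).
  rewrite (leq_trans (size_polyD _ _))// geq_max (leq_trans sQ)//=.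
  by rewrite (leq_trans (size_polyC_leq1 _)).
apply/funext => x; rewrite hornerD hornerC -(@is_derive_0_is_cst R F x 0 dF).
by rewrite /F; ring.
Qed.

Lemma id_sub_iterS A r f :
  id_sub_iter A r.+1 f = (fun x => id_sub_iter A r f x - A (id_sub_iter A r f) x).
Proof. by []. Qed.

Lemma id_sub_iterSr A r f :
  id_sub_iter A r.+1 f = id_sub_iter A r (fun x => f x - A f x).
Proof. by rewrite /id_sub_iter iterSr. Qed.

Lemma averaging_iter_poly h e A r p : averaging h e A -> (size p <= r * e)%N ->
  id_sub_iter A r (horner p) = fun=> 0.
Proof.
move=> avA; elim: r p => [|r IH] p.
  rewrite mul0n leqn0 size_poly_eq0 => /eqP ->.
  by apply/funext => x; rewrite /= horner0.
rewrite mulSnr => /(averaging_poly avA)[q sq qE].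
by rewrite id_sub_iterSr qE; exact: IH.
Qed.

Lemma locint_id_sub_iter h e A r f : averaging h e A -> locint f ->
  locint (id_sub_iter A r f).
Proof.
by move=> [lA _ _ _ _] lf; elim: r => //= r IH; apply: locintB => //; exact: lA.
Qed.

Lemma id_sub_iterB h e A r f g : averaging h e A -> locint f -> locint g ->
  id_sub_iter A r (fun x => f x - g x) =
  (fun x => id_sub_iter A r f x - id_sub_iter A r g x).
Proof.
move=> avA lf lg; elim: r => //= r IH; apply/funext => x.
have [_ AB _ _ _] := avA; rewrite -!/(id_sub_iter _ _ _) IH AB.
- by ring.
- exact: locint_id_sub_iter avA lf.
- exact: locint_id_sub_iter avA lg.
Qed.

Lemma id_sub_iter_local h e A r f M x rho : averaging h e A -> 0 <= h ->
  locint f -> r%:R * h <= rho ->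
  (forall y, `|y - x| <= rho -> `|f y| <= M) ->
  `|id_sub_iter A r f x| <= 2 ^+ r * M.
Proof.
move=> avA h0 lf rh fM; have [lA AB bA _ _] := avA.
suff H i : (i <= r)%N -> forall y, `|y - x| <= rho - i%:R * h ->
    `|id_sub_iter A i f y| <= 2 ^+ i * M.
  by apply: (H r) => //; rewrite subrr normr0 subr_ge0.
elim: i => [_ y|i IH ir y yx].
  by rewrite mul0r subr0 expr0 mul1r; exact: fM.
move: yx; rewrite -natr1 mulrDl mul1r => yx.
have b1 z : `|z - y| <= h -> `|id_sub_iter A i f z| <= 2 ^+ i * M.
  move=> zy; apply: (IH (ltnW ir)).
  have := ler_normD (z - y) (y - x); rewrite addrA subrK; lra.
have b2 := b1 y; rewrite subrr normr0 in b2.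
have b3 := bA _ _ y (locint_id_sub_iter i avA lf) b1.
rewrite id_sub_iterS; apply: (le_trans (ler_normB _ _)).
by rewrite exprS -mulrA mulr_natl mulr2n lerD// b2.
Qed.

(** The Taylor polynomial is annihilated, so only the remainder is left. *)
Lemma id_sub_iter_taylor h e A r s g x : averaging h e A -> 0 <= h ->
  (0 < s)%N -> (s <= r * e)%N -> integral_derivative s g -> locint g ->
  `|id_sub_iter A r g x| <= 2 ^+ r * (r%:R * h) ^+ s.-1 *
    segint (x - r%:R * h) (x + r%:R * h) (fun t => `|derive1n s g t|).
Proof.
case: s => // s avA h0 _ sr ig lg.
have rh0 : 0 <= r%:R * h by rewrite mulr_ge0.
have [p sp hp] := taylor_poly x rh0 ig.
have lp := locint_horner p.
have -> : id_sub_iter A r g x = id_sub_iter A r (fun z => g z - p.[z]) x.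
  rewrite (id_sub_iterB r avA lg lp) (averaging_iter_poly avA) ?subr0//.
  exact: leq_trans sp sr.
rewrite -mulrA [X in _ * X]mulrC.
exact: (id_sub_iter_local avA h0 (locintB lg lp) (lexx _) hp).
Qed.

Lemma averaging_steklov_dot h : 0 < h -> averaging h 1 (steklov_dot h).
Proof.
move=> h0; split.
- by move=> f; exact: locint_steklov_dot.
- by move=> f g x lf lg; rewrite /steklov_dot steklovB.
- move=> f M x lf fM; rewrite steklov_dotE normrM gtr0_norm ?invr_gt0//.
  rewrite ler_pdivrMl//; apply: (le_trans (ler_norm_segint _ _ lf)).
  rewrite [leRHS](_ : _ = segint x (x + h) (fun=> M)); last first.
    by rewrite segint_cst ?lerDl ?(ltW h0)//; ring.
  apply: segint_le; first exact: locint_abs.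
    by apply: locint_continuous; exact: cst_continuous.
  move=> y /andP[xy yx]; apply: fM; rewrite ger0_norm ?subr_ge0//; lra.
- by move=> f g x cg df; exact: is_derive_steklov_dot_comm.
- move=> p x /size1_polyC ->; rewrite hornerC steklov_dotE.
  rewrite (@segint_eq_oo _ _ _ _ (fun=> p`_0)); last by move=> *; rewrite hornerC.
  by rewrite segint_cst ?lerDl ?(ltW h0)// addrAC subrr add0r mulrCA mulVf ?mulr1// gt_eqF.
Qed.

Lemma steklov_dot_center h f x : steklov h f x = steklov_dot h f (x - h / 2).
Proof. by rewrite /steklov_dot subrK. Qed.

(** Polynomials of degree one are reproduced as well, because the window is
    symmetric.  This is why half as many differences suffice for the centred
    average. *)
Lemma averaging_steklov h : 0 < h -> averaging h 2 (steklov h).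
Proof.
move=> h0; have [_ _ bD dD _] := averaging_steklov_dot h0; split.
- by move=> f; exact: locint_steklov.
- by move=> f g x lf lg; rewrite steklovB.
- move=> f M x lf fM; rewrite steklovE normrM gtr0_norm ?invr_gt0//.
  rewrite ler_pdivrMl//; apply: (le_trans (ler_norm_segint _ _ lf)).
  rewrite [leRHS](_ : _ = segint (x - h / 2) (x + h / 2) (fun=> M)); last first.
    rewrite segint_cst; last by lra.
    by field.
  apply: segint_le; first exact: locint_abs.
    by apply: locint_continuous; exact: cst_continuous.
  move=> y /andP[xy yx]; apply: fM; rewrite ler_norml; apply/andP; split; lra.
- move=> f g x cg df; rewrite steklov_dot_center.
  have -> : steklov h f = fun z => steklov_dot h f (z + - (h / 2)).
    by apply/funext => z; rewrite steklov_dot_center.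
  exact: (is_derive_translate (dD f g (x + - (h / 2)) cg df)).
- move=> p x sp; rewrite steklovE.
  have [q dq sq] := poly_antideriv p.
  have qE (y : R) : q.[y] = q`_0 + q`_1 * y + q`_2 * y ^+ 2.
    rewrite (horner_coef_wide _ (leq_trans sq _ : (size q <= 3)%N))//.
    by rewrite !big_ord_recl big_ord0 /= expr0 expr1; ring.
  have dq' y : is_derive y 1 (horner q) (horner p y).
    by rewrite -dq; exact: is_derive_horner.
  rewrite (segint_deriv _ _ dq').
  + rewrite -dq (horner_coef_wide _ (_ : (size q^`() <= 2)%N)) ?dq//.
    rewrite -dq !big_ord_recl big_ord0 /= !coef_deriv expr0 expr1 !qE.
    by rewrite (_ : bump 0 0 = 1%N)// mulr1n; field; rewrite gt_eqF.
  + lra.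
  + exact: continuous_horner.
Qed.

End taylor.

(** * Functions with an integral derivative *)

Section regularity.
Context {R : realType}.
Implicit Types (f g u w : R -> R) (h x y a b c M : R) (p : {poly R}).

Lemma derivable_continuous f : (forall x, derivable f x 1) -> continuous f.
Proof.
by move=> df x; apply: differentiable_continuous; apply/derivable1_diffP.
Qed.

Lemma derive1_is_derive f x : derivable f x 1 -> is_derive x 1 f (derive1 f x).
Proof. by move=> df; apply: DeriveDef => //; rewrite derive1E. Qed.

Lemma smooth_integral_derivative s f : (0 < s)%N -> smooth f ->
  integral_derivative s f.
Proof.
case: s => // s _ df; have cf j : continuous (derive1n j f).
  by apply: derivable_continuous; exact: df.
split; first by move=> j _ x; exact: df.
  exact: locint_continuous.
move=> a b ab; have dfx x : is_derive x 1 (derive1n s f) (derive1n s.+1 f x).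
  by rewrite derive1nS; apply: derive1_is_derive; exact: df.
rewrite -(segint_deriv ab (cf s.+1) dfx).
by apply: ler_norm_segint; exact: locint_continuous.
Qed.

Lemma derive1n_poly_piece f p a b : (forall x, a < x < b -> f x = p.[x]) ->
  forall j x, a < x < b -> derive1n j f x = p^`(j)%R.[x].
Proof.
move=> fp; elim=> [|j IH] x xab; first exact: fp.
have E : \forall z \near x, derive1n j f z = horner p^`(j)%R z.
  have /andP[ax xb] := xab; near=> z; apply: IH.
  by apply/andP; split; near: z; [exact: lt_nbhsr|exact: lt_nbhsl].
rewrite derive1nS derive1E (near_eq_derive _ E)// derivnS.
by have [_] := is_derive_horner p^`(j)%R x.
Unshelve. all: by end_near. Qed.

Definition ftc_le (u v : R -> R) a b : Prop :=
  `|u b - u a| <= segint a b (fun t => `|v t|).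

Lemma ftc_le_piece s f p c d : continuous (derive1n s f) ->
  locint (derive1n s.+1 f) ->
  (forall x, c < x < d -> f x = p.[x]) -> forall a b, c <= a -> a <= b -> b <= d ->
  ftc_le (derive1n s f) (derive1n s.+1 f) a b.
Proof.
move=> cu lv fp a b ca; rewrite le_eqVlt => /predU1P[<-|ab] bd.
  by rewrite /ftc_le subrr normr0 segint_ge0.
have E z : a < z < b -> derive1n s.+1 f z = p^`(s.+1)%R.[z].
  move=> /andP[az zb]; apply: (derive1n_poly_piece fp).
  by rewrite (le_lt_trans ca az) (lt_le_trans zb bd).
suff H : segint a b (derive1n s.+1 f) = derive1n s f b - derive1n s f a.
  by rewrite /ftc_le -H; exact: ler_norm_segint.
rewrite (segint_eq_oo E) /segint /Rintegral (@continuous_FTC2 _ _ (derive1n s f))//.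
- by apply: continuous_subspaceT; exact: continuous_horner.
- split; last 2 first.
  + by apply: cvg_at_right_filter; exact: cu.
  + by apply: cvg_at_left_filter; exact: cu.
  move=> z; rewrite in_itv/= => /andP[az zb].
  have E' : \forall t \near z, horner p^`(s)%R t = derive1n s f t.
    near=> t; rewrite (derive1n_poly_piece fp)//.
    apply/andP; split; near: t; [apply: lt_nbhsr|apply: lt_nbhsl].
      exact: le_lt_trans az.
    exact: lt_le_trans bd.
  exact: near_eq_derivable E' (@derivable_horner R _ z).
Unshelve. all: by end_near. Qed.

Lemma ftc_le_trans u v b a c : locint v -> a <= b -> b <= c ->
  ftc_le u v a b -> ftc_le u v b c -> ftc_le u v a c.
Proof.
move=> lv ab bc h1 h2; rewrite /ftc_le (segint_cat (locint_abs lv) ab bc).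
rewrite -(subrK (u b) (u c)) -addrA (le_trans (ler_normD _ _))// [leLHS]addrC.
exact: lerD h1 h2.
Qed.

Lemma ftc_le_knots u v (t : nat -> R) N : locint v ->
  (forall i, (i < N)%N -> t i <= t i.+1) ->
  (forall i a b, (i < N)%N -> t i <= a -> a <= b -> b <= t i.+1 -> ftc_le u v a b) ->
  forall a b, t 0%N <= a -> a <= b -> b <= t N -> ftc_le u v a b.
Proof.
move=> lv; elim: N => [|N IH] tS piece a b ta ab bt.
  have -> : a = b by apply/eqP; rewrite eq_le ab (le_trans bt ta).
  by rewrite /ftc_le subrr normr0 segint_ge0.
have {}IH := IH (fun i iN => tS i (ltnW iN)) (fun i a b iN => piece i a b (ltnW iN)).
have [bN|/ltW Nb] := leP b (t N); first exact: IH.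
have [Na|/ltW aN] := leP (t N) a; first exact: (piece N).
apply: (ftc_le_trans lv aN Nb); first exact: IH.
exact: (piece N).
Qed.

(** On each piece the function is a polynomial and the fundamental theorem of
    calculus holds.  Continuity of the derivative of order [s - 1] lets the
    pieces be chained, over the knots of one period and over periods. *)
Lemma spline_integral_derivative s f : (0 < s)%N -> spline s f ->
  locint (derive1n s f) -> integral_derivative s f.
Proof.
case: s => // s _ [pf df cu [N [t [p [tN tS fp]]]]] lv; split => // a b ab.
have L0 : 0 < pi *+ 2 :> R by rewrite mulrn_wgt0// pi_gt0.
have mE (z : int) : (pi *+ 2) *~ z = (pi *+ 2) * z%:~R :> R by rewrite mulrzr.
have period (j : int) a' b' : t 0%N + (pi *+ 2) *~ j <= a' -> a' <= b' ->
    b' <= t 0%N + (pi *+ 2) *~ j + pi *+ 2 ->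
    ftc_le (derive1n s f) (derive1n s.+1 f) a' b'.
  move=> h1 h2 h3; apply: (@ftc_le_knots _ _ (fun i => t i + (pi *+ 2) *~ j) N lv) => //.
  - by move=> i iN; rewrite lerD2r ltW// tS.
  - move=> i a'' b'' iN; apply: (@ftc_le_piece _ _ (p i \Po ('X - ((pi *+ 2) *~ j)%:P))) => //.
    move=> x /andP[x1 x2]; rewrite horner_comp hornerXsubC.
    have -> : f x = f (x - (pi *+ 2) *~ j).
      by rewrite -mulrNz periodic_int.
    by apply: (fp i iN); rewrite ltrBrDr x1 ltrBlDr x2.
  - by rewrite tN addrAC.
pose J := (Num.truncn ((`|a| + `|b| + `|t 0%N|) / (pi *+ 2))).+1.
have JP : `|a| + `|b| + `|t 0%N| < (pi *+ 2) * J%:R.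
  by rewrite mulrC -ltr_pdivrMr// truncnS_gt.
apply: (@ftc_le_knots _ _ (fun i => t 0%N + (pi *+ 2) *~ (i%:Z - J%:Z)) (J + J)%N) => //.
- move=> i _; rewrite lerD2l !mE ler_pM2l// ler_int; lia.
- move=> i a' b' _ h1 h2 h3; apply: period h1 h2 _.
  apply: (le_trans h3); rewrite -addrA lerD2l !mE -[X in _ <= _ + X]mulr1 -mulrDr.
  by rewrite ler_pM2l// -[X in _ <= _ + X]/(1%:~R) -intrD ler_int; lia.
- have := ler_norm (- a); have := ler_norm (t 0%N); rewrite normrN.
  have := normr_ge0 b.
  rewrite sub0r mulrNz -pmulrn -mulr_natr; lra.
- have := ler_norm b; have := ler_norm (- t 0%N); rewrite normrN.
  have := normr_ge0 a.
  rewrite PoszD addrK -pmulrn -mulr_natr; lra.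
Qed.

End regularity.

(** * Sampling at the nodes *)

Section discretization.
Context {R : realType} (X : banach_lattice R).
Notation nrm := (bl_norm X).
Context (C : R) (C0 : 0 < C).
Context (bA : forall h : R, 0 < h -> bounded_op X (steklov h) C).
Context (gamma gamma' : R) (gamma0 : 0 < gamma) (gamma'0 : 0 < gamma').
Context (m : nat -> nat) (x : nat -> nat -> R).
Context (hx : sampling_nodes gamma gamma' m x).
Implicit Types (f g u v w : R -> R) (h y c : R) (n k : nat).

Notation dn := (discrete_norm X m x).

Lemma measurable_periodize (E : set R) : measurable E -> measurable (periodize E).
Proof.
move=> mE; have mshift c : measurable ((fun y : R => y + c) @^-1` E).
  rewrite -[X in measurable X]setTI.
  by apply: (measurable_funD (f := id) (g := cst c)).
have -> : periodize E =
    (\bigcup_n ((fun y : R => y + (pi *+ 2) *~ n%:Z) @^-1` E)) `|`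
    (\bigcup_n ((fun y : R => y + (pi *+ 2) *~ (- n%:Z)) @^-1` E)).
  apply/seteqP; split => [y [[j|j] Ej]|y [[j _ Ej]|[j _ Ej]]].
  - by left; exists j.
  - by right; exists j.+1; rewrite // -NegzE.
  - by exists j%:Z.
  - by exists (- j%:Z).
by apply: measurableU; apply: bigcupT_measurable => n.
Qed.

Lemma periodic_periodize (E : set R) : periodic (\1_(periodize E) : R -> R) (pi *+ 2).
Proof.
move=> y; rewrite !indicE; congr (_%:R); congr nat_of_bool.
apply/idP/idP => /set_mem[j Ej]; apply/mem_set.
  by exists (1 + j); rewrite mulrzDr mulr1z addrA.
by exists (j - 1); rewrite mulrzBr mulr1z -addrA [_ + (_ - _)]addrC subrK.
Qed.

Definition step_fun n u : R -> R := fun y => \sum_(1 <= k < (m n).+1)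
  `|u (x n k)| * \1_(periodize `[x n k, x n k.+1[) y.

Lemma step_fun_ge0 n u y : 0 <= step_fun n u y.
Proof. by apply: sumr_ge0 => k _; rewrite mulr_ge0// indicE. Qed.

Lemma bl_step_fun n u : bl_set X (step_fun n u).
Proof.
apply: (@bl_bounded _ X _ (\sum_(1 <= k < (m n).+1) `|u (x n k)|)).
  split.
    by move=> y; apply: eq_bigr => k _; rewrite periodic_periodize.
  apply: borel_lebesgue_measurable_fun; apply: measurable_sum => k.
  apply: measurable_funM; first exact: measurable_cst.
  by apply: measurable_indic; apply: measurable_periodize; exact: measurable_itv.
move=> y; rewrite ger0_norm ?step_fun_ge0//; apply: ler_sum => k _.
by rewrite ler_piMr// indicE lern1; case: (_ \in _).
Qed.

Lemma discrete_norm_ge0 n u : 0 <= dn n u.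
Proof. by apply: bl_norm_ge0; exact: bl_step_fun. Qed.

Lemma discrete_norm_triangle n u v w : (forall y, `|u y| <= `|v y| + `|w y|) ->
  dn n u <= dn n v + dn n w.
Proof.
move=> uvw; have Xv := bl_step_fun n v; have Xw := bl_step_fun n w.
apply: le_trans (bl_normD Xv Xw).
apply: (bl_ideal (bl_measurable (bl_step_fun n u)) (bl_setD Xv Xw) _).2 => y.
rewrite !ger0_norm ?addr_ge0 ?step_fun_ge0//.
rewrite /step_fun -big_split; apply: ler_sum => k _ /=.
by rewrite -mulrDl ler_wpM2r// indicE.
Qed.

Lemma nodes_mono n k l : (0 < n)%N -> (1 <= k)%N -> (k <= l)%N -> (l <= (m n).+1)%N ->
  x n k <= x n l.
Proof.
move=> n0 k1; elim: l => [|l IH]; first by rewrite leqn0 => /eqP ->.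
rewrite leq_eqVlt => /predU1P[-> _//|]; rewrite ltnS => kl lm.
apply: (le_trans (IH kl (ltnW lm))).
have [_ _ /(_ l)] := hx n0; rewrite (leq_trans k1 kl) => /(_ lm)/andP[xl _].
by rewrite -subr_ge0 (le_trans _ xl)// divr_ge0// ltW.
Qed.

(** The node intervals tile one period, so their periodizations are disjoint. *)
Lemma step_fun_cover n y : (0 < n)%N ->
  \sum_(1 <= k < (m n).+1) (\1_(periodize `[x n k, x n k.+1[) y : R) <= 1.
Proof.
move=> n0; pose I k : R := \1_(periodize `[x n k, x n k.+1[) y.
have L0 : 0 < pi *+ 2 :> R by rewrite mulrn_wgt0// pi_gt0.
have I01 k : I k = 0 \/ I k = 1 /\ periodize `[x n k, x n k.+1[ y.
  rewrite /I indicE; case: (boolP (y \in _)) => [/set_mem|]; last by left.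
  by right.
have mE (z : int) : (pi *+ 2) *~ z = (pi *+ 2) * z%:~R :> R by rewrite mulrzr.
have [_ xm _] := hx n0.
have disj k l : (1 <= k)%N -> (k < l)%N -> (l <= m n)%N -> I k = 1 -> I l = 0.
  move=> k1 kl lm Ik; have [//|[_ [j]]] := I01 l.
  have [|[_ [i]]] := I01 k; first by rewrite Ik => /eqP; rewrite oner_eq0.
  rewrite /= !in_itv/= => /andP[i1 i2] /andP[j1 j2].
  have a1 := nodes_mono n0 (leqnn 1) k1 (leq_trans (ltnW kl) (leqW lm)).
  have a2 : x n k.+1 <= x n l by apply: nodes_mono => //; exact: leqW.
  have a3 : x n l.+1 <= x n (m n).+1.
    by apply: nodes_mono.
  rewrite xm in a3.
  have ij : i = j.
    apply/eqP; rewrite eq_le -ltzD1 -[(j <= i)%R]ltzD1.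
    rewrite -(ltr_int R) -[(j < _)%R](ltr_int R) !intrD.
    rewrite -(ltr_pM2l L0) -[_ < (i%:~R + 1)](ltr_pM2l L0) !mulrDr !mulr1 -!mE.
    apply/andP; split; lra.
  by move: i2 j1; rewrite ij => i2 j1; lra.
have [allz|/existsNP[k /not_implyP[k1 /not_implyP[km Ik]]]] :=
    pselect (forall k, (1 <= k)%N -> (k <= m n)%N -> I k = 0).
  rewrite big_nat_cond big1 ?ler01// => k /andP[/andP[k1 km] _].
  exact: allz.
have {}Ik : I k = 1 by case: (I01 k) => [//|[]].
rewrite (bigD1_seq k) ?iota_uniq ?mem_index_iota ?k1//=.
rewrite [X in X + _]Ik big_nat_cond big1 ?addr0// => l /andP[/andP[l1 lm] lk].
have [kl|lk'|E] := ltngtP k l.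
- exact: disj Ik.
- case: (I01 l) => [//|[Il _]].
  by have := disj _ _ l1 lk' km Il; rewrite Ik => /eqP; rewrite oner_eq0.
- by move: lk; rewrite E eqxx.
Qed.

(** An average centred at a node is at most a constant times an average over a
    longer window centred at any point of the interval that starts there.  So
    the step function of [u] is dominated pointwise by averages of [w]. *)
Lemma discrete_norm_dom kappa n u w c : 0 < kappa -> (0 < n)%N -> 0 <= c ->
  bl_set X w ->
  (forall k, (1 <= k <= m n)%N ->
     `|u (x n k)| <= c * steklov (kappa / n%:R) (fun t => `|w t|) (x n k)) ->
  dn n u <= c * ((kappa + 2 * gamma') / kappa * C) * nrm w.
Proof.
move=> k0 n0 c0 Xw uw; have n0' : 0 < n%:R :> R by rewrite ltr0n.
have lw := locint_bl Xw; have Xa := bl_abs_set Xw.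
pose rho := kappa / n%:R; pose rho' := (kappa + 2 * gamma') / n%:R.
have r0 : 0 < rho by rewrite divr_gt0.
have r'0 : 0 < rho' by rewrite divr_gt0// addr_gt0// mulr_gt0.
have [_ bA' _] := bA r'0; have [XA nA] := bA' _ Xa.
have [pA _] := bl_measurable XA.
have rr : rho' / rho = (kappa + 2 * gamma') / kappa.
  by rewrite /rho' /rho; field; rewrite !gt_eqF.
have rr0 : 0 <= rho' / rho by rewrite ltW// divr_gt0.
have [||_ H] := @bl_dom _ X (c * (rho' / rho)) (step_fun n u) _ _
  (bl_measurable (bl_step_fun n u)) XA.
- by rewrite mulr_ge0.
- move=> y; rewrite ger0_norm ?step_fun_ge0//.
  rewrite [in leRHS]ger0_norm; last by apply: steklov_ge0.
  set A := steklov _ _ y; have A0 : 0 <= A by apply: steklov_ge0.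
  apply: (@le_trans _ _ (\sum_(1 <= k < (m n).+1)
      (c * (rho' / rho) * A) * \1_(periodize `[x n k, x n k.+1[) y)); last first.
    rewrite -mulr_sumr ler_piMr//; first by rewrite mulr_ge0// mulr_ge0.
    exact: step_fun_cover.
  rewrite /step_fun big_nat_cond [leRHS]big_nat_cond.
  apply: ler_sum => k; rewrite andbT ltnS => km; rewrite indicE.
  case: (boolP (y \in _)) => [/set_mem[j]|]; last by rewrite !mulr0.
  rewrite /= in_itv/= !mulr1 => /andP[y1 y2].
  apply: (le_trans (uw k km)); rewrite -mulrA ler_wpM2l//.
  rewrite /A -(periodic_int pA j); apply: steklov_window => //.
  have [_ _ /(_ k km)/andP[_ xk]] := hx n0.
  rewrite distrC ger0_norm ?subr_ge0// /rho /rho'.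
  rewrite (_ : (kappa + 2 * gamma') / n%:R / 2 = gamma' / n%:R + kappa / n%:R / 2).
    by rewrite lerD2r; lra.
  by field; rewrite gt_eqF.
rewrite -rr; apply: (le_trans H); rewrite -(bl_abs_norm Xw).
rewrite [leRHS](_ : _ = c * (rho' / rho) * (C * nrm (fun t => `|w t|))).
  by apply: ler_wpM2l; [exact: mulr_ge0|exact: nA].
by ring.
Qed.

Lemma discrete_norm_steklov : exists2 K : R, 0 <= K & forall n v, (0 < n)%N ->
  bl_set X v -> dn n (steklov (gamma / n%:R) v) <= K * nrm v.
Proof.
exists ((gamma + 2 * gamma') / gamma * C).
  by rewrite mulr_ge0 ?divr_ge0 ?addr_ge0 ?mulr_ge0// ltW.
move=> n v n0 Xv; have n0' : 0 < n%:R :> R by rewrite ltr0n.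
rewrite -[leRHS]mul1r mulrA; apply: discrete_norm_dom => // k _; rewrite mul1r.
by apply: ler_norm_steklov; [rewrite divr_gt0|exact: locint_bl Xv].
Qed.

(** The difference telescopes into averages of the iterates, and averages can
    be sampled. *)
Lemma discrete_norm_smoothing r : exists2 K : R, 0 <= K & forall n v, (0 < n)%N ->
  bl_set X v ->
  dn n (fun y => v y - id_sub_iter (steklov (gamma / n%:R)) r v y) <= K * nrm v.
Proof.
have [K K0 KP] := discrete_norm_steklov.
elim: r => [|r [L L0 LP]].
  exists 0 => // n v n0 Xv; rewrite mul0r.
  rewrite (_ : dn _ _ = 0)// /discrete_norm.
  have -> : (fun y => \sum_(1 <= k < (m n).+1) `|v (x n k) -
     id_sub_iter (steklov (gamma / n%:R)) 0 v (x n k)| *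
     \1_(periodize `[x n k, x n k.+1[) y) = fun=> 0 :> R.
    by apply/funext => y; rewrite big1// => k _; rewrite /= subrr normr0 mul0r.
  exact: bl_norm0.
exists (L + K * (1 + C) ^+ r).
  by rewrite addr_ge0// mulr_ge0// exprn_ge0// addr_ge0// ltW.
move=> n v n0 Xv; have h0 : 0 < gamma / n%:R by rewrite divr_gt0// ltr0n.
have [_ bN _] := bounded_op_id_sub_iter r (bA h0).
have [XN nN] := bN v Xv.
apply: (le_trans (discrete_norm_triangle n
  (v := fun y => v y - id_sub_iter (steklov (gamma / n%:R)) r v y)
  (w := steklov (gamma / n%:R) (id_sub_iter (steklov (gamma / n%:R)) r v)) _)).
  by move=> y; rewrite id_sub_iterS opprB addrCA addrC; exact: ler_normD.
rewrite mulrDl lerD ?LP//; apply: (le_trans (KP n _ n0 XN)).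
by rewrite -mulrA ler_wpM2l.
Qed.

(** The Taylor remainder is an integral over [[y - k h, y + k h]], that is, a
    multiple of an average centred at [y]. *)
Lemma taylor_average h e A k s g y : averaging h e A -> 0 < h ->
  (0 < s)%N -> (s <= k * e)%N -> (0 < k)%N -> integral_derivative s g -> locint g ->
  `|id_sub_iter A k g y| <= 2 ^+ k.+1 * k%:R ^+ s * h ^+ s *
    steklov (2 * (k%:R * h)) (fun t => `|derive1n s g t|) y.
Proof.
move=> avA h0 s0 sk k0 ig lg; have := id_sub_iter_taylor y avA (ltW h0) s0 sk ig lg.
move=> /le_trans; apply; rewrite steklovE [2 * _ / 2]mulrAC mulfV ?mul1r//.
rewrite le_eqVlt; apply/orP; left; apply/eqP.
case: s s0 {sk ig} => // s _; rewrite [RHS]mulrA [s.+1.-1]/=; congr (_ * _).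
have k0' : k%:R != 0 :> R by rewrite pnatr_eq0 -lt0n.
rewrite exprMn !exprS; field.
by rewrite k0' gt_eqF.
Qed.

Lemma norm_dot_difference s : (0 < s)%N -> exists2 K : R, 0 <= K &
  forall h g, 0 < h -> bl_set X g -> integral_derivative s g ->
    bl_set X (derive1n s g) ->
    nrm (id_sub_iter (steklov_dot h) s g) <= K * (h ^+ s * nrm (derive1n s g)).
Proof.
move=> s0; exists (2 ^+ s.+1 * s%:R ^+ s * C).
  by rewrite !mulr_ge0// ?exprn_ge0// ltW.
move=> h g h0 Xg ig XG.
have [_ bN _] := bounded_op_id_sub_iter s (bounded_op_steklov_dot bA h0).
have [XN _] := bN g Xg.
have sh0 : 0 < 2 * (s%:R * h) by rewrite !mulr_gt0// ltr0n.
have [_ bA' _] := bA sh0; have [XA nA] := bA' _ (bl_abs_set XG).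
have c0 : 0 <= 2 ^+ s.+1 * s%:R ^+ s * h ^+ s.
  by rewrite !mulr_ge0// ?exprn_ge0// ltW.
have [|_ H] := @bl_dom _ X (2 ^+ s.+1 * s%:R ^+ s * h ^+ s) _ _ c0 (bl_measurable XN) XA.
  move=> y; rewrite [in leRHS]ger0_norm; last exact: steklov_ge0.
  apply: (taylor_average _ (averaging_steklov_dot h0) h0 s0 _ s0 ig (locint_bl Xg)).
  by rewrite muln1.
apply: (le_trans H); rewrite -(bl_abs_norm XG).
rewrite (_ : _ * (h ^+ s * _) = 2 ^+ s.+1 * s%:R ^+ s * h ^+ s *
  (C * nrm (fun t => `|derive1n s g t|))); last by ring.
exact: ler_wpM2l.
Qed.

Lemma discrete_norm_difference r s : (0 < r)%N -> (0 < s)%N -> (s <= 2 * r)%N ->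
  exists2 K : R, 0 <= K & forall n g, (0 < n)%N -> bl_set X g ->
    integral_derivative s g -> bl_set X (derive1n s g) ->
    dn n (id_sub_iter (steklov (gamma / n%:R)) r g) <=
      K * ((gamma / n%:R) ^+ s * nrm (derive1n s g)).
Proof.
move=> r0 s0 sr; pose kappa := 2 * (r%:R * gamma).
have r0' : 0 < r%:R :> R by rewrite ltr0n.
have ka0 : 0 < kappa by rewrite !mulr_gt0.
pose D := (kappa + 2 * gamma') / kappa * C.
have D0 : 0 <= D by rewrite mulr_ge0 ?divr_ge0 ?addr_ge0 ?mulr_ge0// ltW.
exists (2 ^+ r.+1 * r%:R ^+ s * D).
  by apply: mulr_ge0 => //; apply: mulr_ge0; exact: exprn_ge0.
move=> n g n0 Xg ig XG; have n0' : 0 < n%:R :> R by rewrite ltr0n.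
have h0 : 0 < gamma / n%:R by rewrite divr_gt0.
have c0 : 0 <= 2 ^+ r.+1 * r%:R ^+ s * (gamma / n%:R) ^+ s.
  by rewrite !mulr_ge0// ?exprn_ge0// ltW.
have H := @discrete_norm_dom kappa n (id_sub_iter (steklov (gamma / n%:R)) r g)
  (derive1n s g) _ ka0 n0 c0 XG.
rewrite (_ : _ * (_ * nrm _) = 2 ^+ r.+1 * r%:R ^+ s * (gamma / n%:R) ^+ s *
  ((kappa + 2 * gamma') / kappa * C) * nrm (derive1n s g)); last first.
  by rewrite -/D; ring.
apply: H => k _; rewrite (_ : kappa / n%:R = 2 * (r%:R * (gamma / n%:R))); last first.
  by rewrite /kappa; ring.
apply: (taylor_average _ (averaging_steklov h0) h0 s0 _ r0 ig (locint_bl Xg)).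
by rewrite mulnC.
Qed.

End discretization.

(** * Trigonometric polynomials *)

Section trigonometric_polynomials.
Context {R : realType}.
Implicit Types (f g u w : R -> R) (h x y c : R) (n k : nat).

Lemma trig_poly_lin n c f g : trig_poly n f -> trig_poly n g ->
  trig_poly n (fun x => c * f x + g x).
Proof.
move=> [a [b ->]] [a' [b' ->]].
exists (fun k => c * a k + a' k), (fun k => c * b k + b' k).
apply/funext => x; rewrite mulr_sumr -big_split; apply: eq_bigr => k _ /=; ring.
Qed.

Lemma trig_poly_cos k n : (k <= n)%N -> @trig_poly R n (fun x => cos (k%:R * x)).
Proof.
move=> kn; exists (fun i => (i == k)%:R), (fun=> 0); apply/funext => x.
rewrite -ltnS in kn; rewrite (bigD1 (Ordinal kn))//= eqxx mul1r mul0r addr0.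
rewrite big1 ?addr0// => i ik; rewrite (_ : (i == k :> nat) = false).
  by rewrite !mul0r addr0.
by apply: contraNF ik => /eqP ik; apply/eqP/val_inj.
Qed.

Lemma trig_poly_sin k n : (k <= n)%N -> @trig_poly R n (fun x => sin (k%:R * x)).
Proof.
move=> kn; exists (fun=> 0), (fun i => (i == k)%:R); apply/funext => x.
rewrite -ltnS in kn; rewrite (bigD1 (Ordinal kn))//= eqxx mul1r mul0r add0r.
rewrite big1 ?addr0// => i ik; rewrite (_ : (i == k :> nat) = false).
  by rewrite !mul0r addr0.
by apply: contraNF ik => /eqP ik; apply/eqP/val_inj.
Qed.

Lemma trig_poly0 n : @trig_poly R n (fun=> 0).
Proof.
exists (fun=> 0), (fun=> 0); apply/funext => x.
by rewrite big1// => i _; rewrite !mul0r addr0.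
Qed.

Lemma trig_polyZ n c f : trig_poly n f -> trig_poly n (fun x => c * f x).
Proof.
by move=> Tf; have := trig_poly_lin c Tf (trig_poly0 n); under eq_fun do rewrite addr0.
Qed.

Lemma trig_polyD n f g : trig_poly n f -> trig_poly n g ->
  trig_poly n (fun x => f x + g x).
Proof.
by move=> Tf Tg; have := trig_poly_lin 1 Tf Tg; under eq_fun do rewrite mul1r.
Qed.

Lemma trig_polyB n f g : trig_poly n f -> trig_poly n g ->
  trig_poly n (fun x => f x - g x).
Proof.
move=> Tf Tg; have := trig_poly_lin (-1) Tg Tf.
by under eq_fun do rewrite mulN1r addrC.
Qed.

Lemma trig_poly_sum n N (F : nat -> R -> R) :
  (forall k, (k < N)%N -> trig_poly n (F k)) ->
  trig_poly n (fun x => \sum_(k < N) F k x).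
Proof.
elim: N => [|N IH] TF.
  by under eq_fun do rewrite big_ord0; exact: trig_poly0.
under eq_fun do rewrite big_ord_recr/=.
by apply: trig_polyD; [apply: IH => k kN; apply: TF; exact: ltnW|exact: TF].
Qed.

Lemma trig_polyW n n' f : (n <= n')%N -> trig_poly n f -> trig_poly n' f.
Proof.
move=> nn [a [b ->]].
apply: (@trig_poly_sum n' n.+1
  (fun k x => a k * cos (k%:R * x) + b k * sin (k%:R * x))) => k kn.
apply: trig_poly_lin; first by apply: trig_poly_cos; exact: leq_trans nn.
by apply: trig_polyZ; apply: trig_poly_sin; exact: leq_trans nn.
Qed.

Lemma trig_poly_cosB k l n : (k <= n)%N -> (l <= n)%N ->
  @trig_poly R n (fun x => cos (k%:R * x - l%:R * x)) /\
  @trig_poly R n (fun x => sin (k%:R * x - l%:R * x)).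
Proof.
move=> kn ln; have [kl|/ltnW lk] := leqP k l; split.
- rewrite (_ : (fun x => _) = fun x => cos ((l - k)%:R * x)).
    by apply: trig_poly_cos; exact: leq_trans (leq_subr _ _) ln.
  by apply/funext => x; rewrite natrB// -cosN; congr cos; ring.
- rewrite (_ : (fun x => _) = fun x => (-1) * sin ((l - k)%:R * x)).
    by apply/trig_polyZ/trig_poly_sin; exact: leq_trans (leq_subr _ _) ln.
  by apply/funext => x; rewrite natrB// mulN1r -sinN; congr sin; ring.
- rewrite (_ : (fun x => _) = fun x => cos ((k - l)%:R * x)).
    by apply: trig_poly_cos; exact: leq_trans (leq_subr _ _) kn.
  by apply/funext => x; rewrite natrB//; congr cos; ring.
- rewrite (_ : (fun x => _) = fun x => sin ((k - l)%:R * x)).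
    by apply: trig_poly_sin; exact: leq_trans (leq_subr _ _) kn.
  by apply/funext => x; rewrite natrB//; congr sin; ring.
Qed.

(** Products of sines and cosines are sums of sines and cosines of the sum and
    of the difference of the arguments. *)
Lemma trig_polyM n l f g : trig_poly n f -> trig_poly l g ->
  trig_poly (n + l) (fun x => f x * g x).
Proof.
have cc k j : (k <= n)%N -> (j <= l)%N ->
    [/\ trig_poly (n + l) (fun x : R => cos (k%:R * x) * cos (j%:R * x)),
        trig_poly (n + l) (fun x : R => cos (k%:R * x) * sin (j%:R * x)),
        trig_poly (n + l) (fun x : R => sin (k%:R * x) * cos (j%:R * x)) &
        trig_poly (n + l) (fun x : R => sin (k%:R * x) * sin (j%:R * x))].
  move=> kn jl; have kjnl : (k + j <= n + l)%N by exact: leq_add.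
  have [d1 d2] := trig_poly_cosB (leq_trans kn (leq_addr l n)) (leq_trans jl (leq_addl n l)).
  have s1 := trig_poly_cos kjnl; have s2 := trig_poly_sin kjnl.
  split.
  - have := trig_polyZ (2^-1) (trig_polyD s1 d1).
    by congr (trig_poly _ _); apply/funext => x; rewrite natrD mulrDl cosD cosB; field.
  - have := trig_polyZ (2^-1) (trig_polyB s2 d2).
    by congr (trig_poly _ _); apply/funext => x; rewrite natrD mulrDl sinD sinB; field.
  - have := trig_polyZ (2^-1) (trig_polyD s2 d2).
    by congr (trig_poly _ _); apply/funext => x; rewrite natrD mulrDl sinD sinB; field.
  - have := trig_polyZ (2^-1) (trig_polyB d1 s1).
    by congr (trig_poly _ _); apply/funext => x; rewrite cosB natrD mulrDl cosD; field.
move=> [a [b ->]] [a' [b' ->]].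
pose G k j x := a k * a' j * (cos (k%:R * x) * cos (j%:R * x)) +
   (a k * b' j * (cos (k%:R * x) * sin (j%:R * x)) +
   (b k * a' j * (sin (k%:R * x) * cos (j%:R * x)) +
    b k * b' j * (sin (k%:R * x) * sin (j%:R * x)))).
rewrite (_ : (fun x => _) = fun x => \sum_(k < n.+1) \sum_(j < l.+1) G k j x); last first.
  apply/funext => x; rewrite mulr_suml; apply: eq_bigr => k _.
  by rewrite mulr_sumr; apply: eq_bigr => j _; rewrite /G; ring.
apply: (trig_poly_sum (F := fun k x => \sum_(j < l.+1) G k j x)) => k kn.
apply: (trig_poly_sum (F := G k)) => j jl.
have [c1 c2 c3 c4] := cc k j kn jl.
apply: trig_poly_lin => //; apply: trig_poly_lin => //; apply: trig_poly_lin => //.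
exact: trig_polyZ.
Qed.

Lemma is_derive_trig k (a b : R) x :
  is_derive x 1 (fun y => a * cos (k%:R * y) + b * sin (k%:R * y))
    (k%:R * b * cos (k%:R * x) + (- (k%:R * a)) * sin (k%:R * x)).
Proof.
have dk : is_derive x 1 (fun y : R => k%:R * y) (k%:R * 1).
  exact: is_derive_cmul.
have dc := @is_derive1_comp R cos (fun y => k%:R * y) x _ _ (is_derive_cos _) dk.
have ds := @is_derive1_comp R sin (fun y => k%:R * y) x _ _ (is_derive_sin _) dk.
apply: is_derive_eq (is_derive_linc a dc (is_derive_cmul b ds)) _.
by rewrite /=; ring.
Qed.

Lemma is_derive_trig_sum N (a b : nat -> R) x :
  is_derive x 1 (fun y => \sum_(k < N) (a k * cos (k%:R * y) + b k * sin (k%:R * y)))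
    (\sum_(k < N) (k%:R * b k * cos (k%:R * x) + (- (k%:R * a k)) * sin (k%:R * x))).
Proof.
elim: N => [|N IH].
  under eq_fun do rewrite big_ord0; rewrite big_ord0; exact: is_derive_cst.
under eq_fun do rewrite big_ord_recr; rewrite big_ord_recr.
exact: (is_deriveD IH (is_derive_trig N (a N) (b N) x)).
Qed.

Lemma trig_poly_derive n f : trig_poly n f ->
  (forall x, derivable f x 1) /\ trig_poly n (derive1 f).
Proof.
move=> [a [b fE]]; have df x := is_derive_trig_sum n.+1 a b x; rewrite fE; split.
  by move=> x; have [] := df x.
exists (fun k => k%:R * b k), (fun k => - (k%:R * a k)); apply/funext => x.
by rewrite derive1E; have [_] := df x.
Qed.

Lemma trig_poly_smooth n f : trig_poly n f -> smooth f.
Proof.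
move=> Tf j; suff : trig_poly n (derive1n j f) by move=> /trig_poly_derive[].
by elim: j => //= j IH; have [] := trig_poly_derive IH.
Qed.

Lemma trig_poly_continuous n f : trig_poly n f -> continuous f.
Proof. by move=> /trig_poly_smooth /(_ 0%N) /derivable_continuous. Qed.

Lemma trig_poly_derive1n n j f : trig_poly n f -> trig_poly n (derive1n j f).
Proof. by move=> Tf; elim: j => //= j IH; have [] := trig_poly_derive IH. Qed.

Lemma trig_poly_periodic n f : trig_poly n f -> periodic f (pi *+ 2).
Proof.
move=> [a [b ->]] x; apply: eq_bigr => k _.
have E : k%:R * (x + pi *+ 2) = k%:R * x + (pi *+ 2) *+ k :> R.
  by rewrite mulrDr [k%:R * (pi *+ 2)]mulr_natl.
by rewrite E (periodicn (@cosD2pi R)) (periodicn (@sinD2pi R)).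
Qed.

Lemma bl_trig_poly (X : banach_lattice R) n f : trig_poly n f -> bl_set X f.
Proof.
by move=> Tf; apply: bl_continuous; [exact: trig_poly_continuous Tf|
  exact: trig_poly_periodic Tf].
Qed.

Lemma segint_sum a b N (F : nat -> R -> R) : (forall k, locint (F k)) ->
  locint (fun x => \sum_(k < N) F k x) /\
  segint a b (fun x => \sum_(k < N) F k x) = \sum_(k < N) segint a b (F k).
Proof.
move=> lF; elim: N => [|N [l1 IH]].
  under eq_fun do rewrite big_ord0; rewrite big_ord0; split.
    by apply: locint_continuous; exact: cst_continuous.
  by rewrite /segint /Rintegral integral0.
have -> : (fun x => \sum_(k < N.+1) F k x) = (fun x => \sum_(k < N) F k x + F N x).
  by apply/funext => x; rewrite big_ord_recr.
by split; [exact: locintD|rewrite segintD ?big_ord_recr/= ?IH].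
Qed.

(** The addition formulas separate [x] from [t]. *)
Lemma trig_poly_convolution n (K g : R -> R) : trig_poly n K -> continuous g ->
  trig_poly n (fun x => segint (- pi) pi (fun t => K (t - x) * g t)).
Proof.
move=> [a [b ->]] cg.
have ck (c d : R) k : continuous (fun t : R => (c * cos (k%:R * t) + d * sin (k%:R * t)) * g t).
  have dT t := is_derive_trig k c d t.
  have cT : continuous (fun t : R => c * cos (k%:R * t) + d * sin (k%:R * t)).
    by apply: derivable_continuous => t; have [] := dT t.
  by move=> t; apply: cvgM; [exact: cT|exact: cg].
exists (fun k => segint (- pi) pi (fun t => (a k * cos (k%:R * t) + b k * sin (k%:R * t)) * g t)),
  (fun k => segint (- pi) pi (fun t => ((- b k) * cos (k%:R * t) + a k * sin (k%:R * t)) * g t)).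
apply/funext => x.
pose F k t := cos (k%:R * x) * ((a k * cos (k%:R * t) + b k * sin (k%:R * t)) * g t) +
  sin (k%:R * x) * (((- b k) * cos (k%:R * t) + a k * sin (k%:R * t)) * g t).
have cZ (c : R) (f : R -> R) : continuous f -> continuous (fun t : R => c * f t).
  by move=> cf t; apply: cvgM; [exact: cvg_cst|exact: cf].
have cF k : continuous (F k).
  by move=> t; apply: cvgD; exact: (cZ _ _ (ck _ _ k) t).
have -> : (fun t => (\sum_(k < n.+1) (a k * cos (k%:R * (t - x)) +
    b k * sin (k%:R * (t - x)))) * g t) = (fun t => \sum_(k < n.+1) F k t).
  apply/funext => t; rewrite mulr_suml; apply: eq_bigr => k _.
  by rewrite /F mulrBr cosB sinB; ring.
have [_ ->] := segint_sum (- pi) pi n.+1 (fun k => locint_continuous (cF k)).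
apply: eq_bigr => k _; rewrite /F segintD; last 2 first.
- by apply: locint_continuous; exact: cZ.
- by apply: locint_continuous; exact: cZ.
by rewrite !segintZ; [ring|exact: locint_continuous..].
Qed.

End trigonometric_polynomials.

(** * The Jackson kernel *)

Section jackson_kernel.
Context {R : realType}.
Implicit Types (f g u w : R -> R) (h x y c t : R) (n m k : nat).

Lemma sqr_normr (x : R) : `|x| ^+ 2 = x ^+ 2.
Proof. by rewrite real_normK ?num_real. Qed.

Lemma ler_norm_sin (x : R) : `|sin x| <= `|x|.
Proof.
have := @ler_norm_mvt R sin cos 0 `|x| 1 _ x.
rewrite !subr0 sin0 subr0 mul1r; apply => // z _.
by split; [exact: is_derive_sin|exact: cos_max].
Qed.

Lemma cos_half_le (x : R) : `|x| <= 1 -> 2^-1 <= cos x.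
Proof.
move=> x1; have s := ler_norm_sin (x / 2).
have : sin (x / 2) ^+ 2 <= (x / 2) ^+ 2 by rewrite -[sin _ ^+ 2]sqr_normr -[(x / 2) ^+ 2]sqr_normr lerXn2r.
have x2 : x ^+ 2 <= 1 by rewrite -sqr_normr expr_le1.
have -> : cos x = 1 - 2 * sin (x / 2) ^+ 2.
  rewrite -[in LHS](_ : (x / 2) *+ 2 = x); last by rewrite -mulr_natr mulfVK.
  by rewrite cos_mulr2n cos2sin2 -mulr_natr; ring.
by rewrite expr_div_n; lra.
Qed.

Lemma sin_mvt (a b : R) : a <= b ->
  exists2 z, a <= z <= b & sin b - sin a = cos z * (b - a).
Proof.
move=> ab; have [|z zab ->] := @MVT_segment R sin cos a b ab (fun z _ => is_derive_sin z).
  by apply: continuous_subspaceT; exact: continuous_sin.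
by exists z.
Qed.

(** Up to [1] by the mean value theorem, since [cos] is at least [1 / 2] there;
    beyond [1] the sine keeps increasing while [x / 4] is at most [1 / 2]. *)
Lemma sin_ge_quarter (x : R) : 0 <= x <= pi / 2 -> x / 4 <= sin x.
Proof.
move=> /andP[x0 xp]; have p2 := pihalf_lt2 R.
have small y : 0 <= y -> y <= 1 -> y / 2 <= sin y.
  move=> y0 y1; have [z /andP[z0 zy]] := sin_mvt y0.
  rewrite sin0 !subr0 => ->; rewrite mulrC ler_wpM2r//; apply: cos_half_le.
  by rewrite ger0_norm// (le_trans zy).
have [x1|x1] := leP x 1; first by apply: le_trans (small x x0 x1); lra.
have [z /andP[z1 zx]] := sin_mvt (ltW x1).
have cz : 0 <= cos z by apply: cos_ge0_pihalf; apply/andP; split; lra.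
have := small 1 ler01 (lexx _); have : 0 <= cos z * (x - 1).
  by rewrite mulr_ge0// subr_ge0 ltW.
by move=> h1 h2 h3; lra.
Qed.

Lemma cos_le_square t : `|t| <= pi -> t ^+ 2 / 16 <= 2 - 2 * cos t.
Proof.
move=> tp; pose y := `|t| / 2.
have y1 : 0 <= y <= pi / 2 by rewrite /y divr_ge0//= ler_pM2r.
have := sin_ge_quarter y1 => s.
have : (y / 4) ^+ 2 <= sin y ^+ 2.
  by rewrite lerXn2r ?nnegrE ?(le_trans _ s)// divr_ge0// divr_ge0.
have -> : cos t = 1 - 2 * sin y ^+ 2.
  rewrite -cos_norm -[in LHS](_ : y *+ 2 = `|t|); last first.
    by rewrite -mulr_natr mulfVK.
  by rewrite cos_mulr2n cos2sin2 -mulr_natr; ring.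
have -> : t ^+ 2 = (2 * y) ^+ 2 by rewrite /y mulrC mulfVK// sqr_normr.
by move=> H; lra.
Qed.

Definition cos_sum m t : R := \sum_(k < m) cos (k%:R * t).
Definition sin_sum m t : R := \sum_(k < m) sin (k%:R * t).

(** The square of the modulus of the sum of [exp (i k t)] for [k < m]: the
    Fejer kernel, up to a factor. *)
Definition fejer m t : R := cos_sum m t ^+ 2 + sin_sum m t ^+ 2.

(** The geometric series multiplied by [1 - exp (i t)], in real and imaginary
    parts; [2 - 2 * cos t] is the square of the modulus of that factor. *)
Lemma fejer_closed_form m t : fejer m t * (2 - 2 * cos t) = 2 - 2 * cos (m%:R * t).
Proof.
have cs : cos_sum m t - (cos_sum m t * cos t - sin_sum m t * sin t) = 1 - cos (m%:R * t)
   /\ sin_sum m t - (sin_sum m t * cos t + cos_sum m t * sin t) = - sin (m%:R * t).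
  rewrite /cos_sum /sin_sum; elim: m => [|m [IH1 IH2]].
    by rewrite !big_ord0 !mul0r cos0 sin0; split; ring.
  have mE : m.+1%:R * t = m%:R * t + t by rewrite -natr1 mulrDl mul1r.
  rewrite !big_ord_recr/= mE cosD sinD.
  move: IH1 IH2; set a := \sum_(_ < _) _; set b := \sum_(_ < _) _.
  set u := cos (m%:R * t); set v := sin (m%:R * t) => IH1 IH2; split.
    rewrite (_ : _ - _ = (a - (a * cos t - b * sin t)) +
      (u - (u * cos t - v * sin t))); last by ring.
    by rewrite IH1; ring.
  rewrite (_ : _ - _ = (b - (b * cos t + a * sin t)) +
    (v - (v * cos t + u * sin t))); last by ring.
  by rewrite IH2; ring.
have [c s] := cs; have e1 := cos2Dsin2 t; have e2 := cos2Dsin2 (m%:R * t).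
have <- : (1 - cos (m%:R * t)) ^+ 2 + (- sin (m%:R * t)) ^+ 2 = 2 - 2 * cos (m%:R * t).
  by rewrite sqrrN -[X in _ + X](addKr (cos (m%:R * t) ^+ 2)) e2; ring.
rewrite -c -s /fejer.
have -> : 2 - 2 * cos t = (1 - cos t) ^+ 2 + sin t ^+ 2.
  by rewrite -[X in _ = _ + X](addKr (cos t ^+ 2)) e1; ring.
by ring.
Qed.

Lemma fejer_ge0 m t : 0 <= fejer m t.
Proof. by rewrite addr_ge0// sqr_ge0. Qed.

Lemma fejer_le m t : fejer m t <= 2 * m%:R ^+ 2.
Proof.
have b (F : nat -> R) : (forall k, `|F k| <= 1) -> (\sum_(k < m) F k) ^+ 2 <= m%:R ^+ 2.
  move=> F1; rewrite -sqr_normr lerXn2r ?nnegrE//.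
  apply: (le_trans (ler_norm_sum _ _ _)).
  apply: (@le_trans _ _ (\sum_(k < m) 1)); first by apply: ler_sum.
  by rewrite sumr_const card_ord.
rewrite mulr_natl mulr2n; apply: lerD.
  by apply: (b (fun k => cos (k%:R * t))) => k; exact: cos_max.
by apply: (b (fun k => sin (k%:R * t))) => k; exact: sin_max.
Qed.

Lemma fejer_decay m t : `|t| <= pi -> fejer m t * t ^+ 2 <= 64.
Proof.
move=> tp; have := cos_le_square tp; have := fejer_closed_form m t.
have := cos_geN1 (m%:R * t); have F0 := fejer_ge0 m t => c e s.
have : fejer m t * (t ^+ 2 / 16) <= fejer m t * (2 - 2 * cos t) by rewrite ler_wpM2l.
by rewrite e mulrA; lra.
Qed.

(** On [|t| <= 1 / m] every cosine in the sum is at least [1 / 2]. *)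
Lemma fejer_ge m t : (0 < m)%N -> `|t| <= m%:R^-1 -> m%:R ^+ 2 / 4 <= fejer m t.
Proof.
move=> m0 tm; have m0' : 0 < m%:R :> R by rewrite ltr0n.
have c : m%:R / 2 <= cos_sum m t.
  rewrite (_ : m%:R / 2 = \sum_(k < m) 2^-1); last first.
    by rewrite sumr_const card_ord mulr_natl.
  apply: ler_sum => k _; apply: cos_half_le; rewrite normrM ger0_norm//.
  apply: (@le_trans _ _ (m%:R * m%:R^-1)); last by rewrite mulfV// gt_eqF.
  by apply: ler_pM => //; rewrite ler_nat ltnW.
have : (m%:R / 2) ^+ 2 <= cos_sum m t ^+ 2.
  by rewrite lerXn2r ?nnegrE ?(le_trans _ c)// divr_ge0.
by rewrite /fejer; have := sqr_ge0 (sin_sum m t); rewrite expr_div_n; lra.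
Qed.

Lemma trig_poly_fejer m : (0 < m)%N -> @trig_poly R (m.-1 + m.-1)%N (fejer m).
Proof.
case: m => // m _; rewrite /fejer.
have Tc : trig_poly m (cos_sum m.+1).
  by apply: (@trig_poly_sum R m m.+1 (fun k t => cos (k%:R * t))) => k km; apply: trig_poly_cos.
have Ts : trig_poly m (sin_sum m.+1).
  by apply: (@trig_poly_sum R m m.+1 (fun k t => sin (k%:R * t))) => k km; apply: trig_poly_sin.
have := trig_polyD (trig_polyM Tc Tc) (trig_polyM Ts Ts).
by congr (trig_poly _ _); apply/funext => t; rewrite !expr2.
Qed.

(** The Fejer kernel decays like [1 / t ^ 2], which would leave a logarithm in the
    first moment; its square decays like [1 / t ^ 4]. *)
Definition jackson_mass m : R := segint (- pi) pi (fun t => fejer m t ^+ 2).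
Definition jackson m t : R := fejer m t ^+ 2 / jackson_mass m.

Lemma trig_poly_fejer2 m : (0 < m)%N ->
  @trig_poly R (4 * m.-1)%N (fun t => fejer m t ^+ 2).
Proof.
move=> m0; under eq_fun do rewrite expr2.
by rewrite (_ : 4 * m.-1 = (m.-1 + m.-1) + (m.-1 + m.-1))%N;
  [apply: trig_polyM; exact: trig_poly_fejer|lia].
Qed.

Lemma trig_poly_jackson m : (0 < m)%N -> @trig_poly R (4 * m.-1)%N (jackson m).
Proof.
move=> m0; have := trig_polyZ (jackson_mass m)^-1 (trig_poly_fejer2 m0).
by congr (trig_poly _ _); apply/funext => t; rewrite mulrC.
Qed.

Lemma jackson_mass_ge m : (0 < m)%N -> m%:R ^+ 3 / 8 <= jackson_mass m.
Proof.
move=> m0; have m0' : 0 < m%:R :> R by rewrite ltr0n.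
have cF : continuous (fun t => fejer m t ^+ 2) by exact: trig_poly_continuous (trig_poly_fejer2 m0).
have mp : m%:R^-1 <= pi :> R.
  have := pi_ge2 R; have : m%:R^-1 <= 1 :> R by rewrite invf_le1// ler1n.
  lra.
have mm : - m%:R^-1 <= m%:R^-1 :> R.
  by rewrite (@le_trans _ _ 0) ?oppr_le0 ?invr_ge0.
have lF := locint_continuous cF.
apply: (@le_trans _ _ (segint (- m%:R^-1) m%:R^-1 (fun t => `|fejer m t ^+ 2|))).
  rewrite [leLHS](_ : _ = segint (- m%:R^-1) m%:R^-1 (fun=> (m%:R ^+ 2 / 4) ^+ 2)).
    apply: segint_le; [|exact: locint_abs|].
      by apply: locint_continuous; exact: cst_continuous.
    move=> t tm; rewrite ger0_norm ?sqr_ge0//.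
    have := fejer_ge m0 (_ : `|t| <= m%:R^-1); rewrite ler_norml => /(_ tm) h.
    by rewrite lerXn2r ?nnegrE ?fejer_ge0// divr_ge0// sqr_ge0.
  by rewrite segint_cst//; field; rewrite gt_eqF.
rewrite /jackson_mass.
rewrite (_ : (fun t => fejer m t ^+ 2) = (fun t => `|fejer m t ^+ 2|)) in lF *; last first.
  by apply/funext => t; rewrite ger0_norm ?sqr_ge0.
under [X in segint _ _ X <= _]eq_fun do rewrite -normr_id.
under [X in _ <= segint _ _ X]eq_fun do rewrite -normr_id.
by apply: segint_sub => //; rewrite lerN2.
Qed.

Lemma jackson_mass_gt0 m : (0 < m)%N -> 0 < jackson_mass m.
Proof.
move=> m0; apply: lt_le_trans (jackson_mass_ge m0).
by rewrite divr_gt0// exprn_gt0// ltr0n.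
Qed.

Lemma jackson_ge0 m t : (0 < m)%N -> 0 <= jackson m t.
Proof. by move=> m0; rewrite divr_ge0 ?sqr_ge0// ltW// jackson_mass_gt0. Qed.

Lemma segint_jackson m : (0 < m)%N -> segint (- pi) pi (jackson m) = 1.
Proof.
move=> m0; rewrite /jackson.
under eq_fun do rewrite mulrC.
rewrite segintZ; first by rewrite mulVf// gt_eqF// jackson_mass_gt0.
exact: locint_continuous (trig_poly_continuous (trig_poly_fejer2 m0)).
Qed.

(** The index [j] is the first for which [m * |t| <= 2 ^ j].  For [j > 0] then
    [|t|] is at least [2 ^ j / (2 * m)] and the decay [64 / t ^ 2] of the Fejer
    kernel applies, for [j = 0] its maximum does; dividing by a mass of at least
    [m ^ 3 / 8] leaves [m / 16 ^ j]. *)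
Lemma jackson_dyadic m t L : (0 < m)%N -> `|t| <= pi -> m%:R * pi <= 2 ^+ L :> R ->
  exists j, [/\ (j < L.+1)%N, m%:R * `|t| <= 2 ^+ j &
    jackson m t <= 2 ^+ 19 * m%:R * 16^-1 ^+ j].
Proof.
move=> m0 tp mL; have m0' : 0 < m%:R :> R by rewrite ltr0n.
have mt0 : 0 <= m%:R * `|t| by rewrite mulr_ge0.
have ex : exists j, m%:R * `|t| <= 2 ^+ j.
  by exists L; rewrite (le_trans _ mL)// ler_pM2l.
have [j jP jmin] := ex_minnP ex; exists j; split => //.
  by rewrite ltnS; apply: jmin; rewrite (le_trans _ mL)// ler_pM2l.
rewrite /jackson ler_pdivrMr ?jackson_mass_gt0//.
suff H : fejer m t ^+ 2 <= 2 ^+ 16 * m%:R ^+ 4 * 16^-1 ^+ j.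
  apply: (le_trans H).
  rewrite [leLHS](_ : _ = 2 ^+ 19 * m%:R * 16^-1 ^+ j * (m%:R ^+ 3 / 8)); last by field.
  by rewrite ler_wpM2l ?jackson_mass_ge// !mulr_ge0// exprn_ge0// invr_ge0.
case: j jP jmin => [|j] jP jmin.
  rewrite expr0 mulr1; have := fejer_le m t => F.
  apply: (@le_trans _ _ ((2 * m%:R ^+ 2) ^+ 2)).
    by rewrite lerXn2r ?nnegrE ?fejer_ge0// mulr_ge0// sqr_ge0.
  rewrite exprMn -exprM ler_wpM2r ?exprn_ge0//; lra.
have jt : 2 ^+ j < m%:R * `|t|.
  by rewrite ltNge; apply/negP => /jmin; rewrite ltnn.
have t0 : 0 < `|t|.
  have : 0 < m%:R * `|t| by apply: le_lt_trans jt; exact: exprn_ge0.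
  by rewrite pmulr_rgt0.
have t4 : 0 < t ^+ 4 by rewrite -[4%N]/(2 * 2)%N exprM -[t ^+ 2]sqr_normr !exprn_gt0.
rewrite -(ler_pM2r t4).
have d := fejer_decay m tp.
apply: (@le_trans _ _ (64 ^+ 2)).
  rewrite -[4%N]/(2 * 2)%N exprM -exprMn lerXn2r ?nnegrE//.
  by rewrite mulr_ge0 ?fejer_ge0 ?sqr_ge0.
have -> : t ^+ 4 = `|t| ^+ 4 by rewrite -[4%N]/(2 * 2)%N !exprM sqr_normr.
rewrite (_ : _ * `|t| ^+ 4 = 2 ^+ 16 * 16^-1 ^+ j.+1 * (m%:R * `|t|) ^+ 4); last first.
  by rewrite exprMn; ring.
apply: (@le_trans _ _ (2 ^+ 16 * 16^-1 ^+ j.+1 * (2 ^+ j) ^+ 4)); last first.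
  rewrite ler_wpM2l ?mulr_ge0 ?exprn_ge0 ?invr_ge0//.
  by rewrite lerXn2r ?nnegrE ?exprn_ge0// ltW.
have E : 16^-1 ^+ j * (2 ^+ j) ^+ 4 = 1 :> R.
  by rewrite -exprM mulnC exprM -exprMn (_ : 16^-1 * 2 ^+ 4 = 1) ?expr1n//; field.
rewrite [16^-1 ^+ _]exprS.
rewrite [leRHS](_ : _ = 2 ^+ 16 * 16^-1 * (16^-1 ^+ j * (2 ^+ j) ^+ 4));
  last by rewrite !mulrA.
rewrite E; lra.
Qed.

End jackson_kernel.

(** * Convolution with the Jackson kernel *)

Section jackson_operator.
Context {R : realType}.
Notation mu := (@lebesgue_measure R).
Implicit Types (f g u v w : R -> R) (h x y c t : R) (n m k : nat).

Definition cont_periodic u : Prop := continuous u /\ periodic u (pi *+ 2).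

Lemma cont_periodic_lin c u v : cont_periodic u -> cont_periodic v -> cont_periodic (fun x => c * u x + v x).
Proof.
move=> [cu pu] [cv pv]; split; last by move=> x; rewrite pu pv.
by move=> x; apply: cvgD; [apply: cvgM; [exact: cvg_cst|exact: cu]|exact: cv].
Qed.

Lemma cont_periodicB u v : cont_periodic u -> cont_periodic v -> cont_periodic (fun x => u x - v x).
Proof.
move=> [cu pu] [cv pv]; split; last by move=> x; rewrite pu pv.
by move=> x; apply: cvgB; [exact: cu|exact: cv].
Qed.

Lemma bl_cont_periodic (X : banach_lattice R) u : cont_periodic u -> bl_set X u.
Proof. by move=> [cu pu]; exact: bl_continuous. Qed.

Lemma cont_periodic_trig n T : trig_poly n T -> @cont_periodic T.
Proof.
by move=> hT; split; [exact: trig_poly_continuous hT|exact: trig_poly_periodic hT].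
Qed.

(** The derivative in [x] is [u (x + pi) - u (x - pi) = 0]. *)
Lemma segint_period u x : cont_periodic u -> segint (- pi + x) (pi + x) u = segint (- pi) pi u.
Proof.
move=> [cu pu]; have p0 : 0 < pi *+ 2 :> R by rewrite mulrn_wgt0// pi_gt0.
have d0 y : is_derive y 1 (steklov_dot (pi *+ 2) u) 0.
  by have := is_derive_steklov_dot y p0 cu; rewrite pu subrr mulr0.
have := @is_derive_0_is_cst R (steklov_dot (pi *+ 2) u) (- pi + x) (- pi) d0.
rewrite !steklov_dotE; have -> : - pi + x + pi *+ 2 = pi + x :> R by ring.
have -> : - pi + pi *+ 2 = pi :> R by ring.
by move=> /mulfI; apply; rewrite invr_eq0 gt_eqF.
Qed.

Lemma continuous_mul u v : continuous u -> continuous v ->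
  continuous (fun t => u t * v t).
Proof. by move=> cu cv t; apply: cvgM; [exact: cu|exact: cv]. Qed.

Lemma continuous_shiftl u x : continuous u -> continuous (fun t => u (x + t)).
Proof. by move=> cu; under eq_fun do rewrite addrC; exact: continuous_shift. Qed.

Definition jackson_op m u x : R :=
  segint (- pi) pi (fun t => jackson m t * u (x + t)).

Section fixed_m.
Context (m : nat) (m0 : (0 < m)%N).

Lemma continuous_jackson : continuous (@jackson R m).
Proof. exact: trig_poly_continuous (trig_poly_jackson m0). Qed.

Lemma trig_poly_jackson_op u : cont_periodic u -> trig_poly (4 * m.-1) (jackson_op m u).
Proof.
move=> cpu; have [cu pu] := cpu.
have := trig_poly_convolution (trig_poly_jackson m0) cu.
congr (trig_poly _ _); apply/funext => x.
rewrite -(@segint_period _ x); last first.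
  split.
    by apply: continuous_mul => //; exact: continuous_shift continuous_jackson.
  move=> t; rewrite pu -addrA [pi *+ 2 - x]addrC addrA.
  by rewrite (trig_poly_periodic (trig_poly_jackson m0)).
rewrite segint_shift; last first.
  by apply: continuous_mul => //; exact: continuous_shift continuous_jackson.
by congr (segint _ _ _); apply/funext => t; rewrite addrK addrC.
Qed.

Lemma cont_periodic_jackson_op u : cont_periodic u -> cont_periodic (jackson_op m u).
Proof. by move=> /trig_poly_jackson_op; exact: cont_periodic_trig. Qed.

Lemma continuous_jackson_integrand u x : cont_periodic u ->
  continuous (fun t => jackson m t * u (x + t)).
Proof.
by move=> [cu _]; apply: continuous_mul continuous_jackson _; exact: continuous_shiftl.
Qed.

(** Differentiation under the integral sign; the derivatives of the integrand are
    bounded by a constant. *)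
Lemma is_derive_jackson_op u w x : cont_periodic u -> cont_periodic w ->
  (forall y, is_derive y 1 u (w y)) -> is_derive x 1 (jackson_op m u) (jackson_op m w x).
Proof.
move=> cu cw dw; have [M wM] := continuous_periodic_bounded cw.1 cw.2.
have [cJ pJ] := cont_periodic_trig (trig_poly_jackson m0).
have [K JK] := continuous_periodic_bounded cJ pJ.
have df y t : is_derive y 1 (fun z => jackson m t * u (z + t)) (jackson m t * w (y + t)).
  exact: (is_derive_cmul (jackson m t) (is_derive_translate (dw (y + t)))).
pose F (z t : R) := jackson m t * u (z + t).
have m1 : measurable (`[- pi, pi]%classic : set (measurableTypeR R)).
  exact: measurable_itv.
have xI : (`](x - 1), (x + 1)[%classic : set R) x.
  by rewrite /= in_itv/= ltrBlDr !ltrDl !ltr01.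
have int y : (`](x - 1), (x + 1)[%classic : set R) y -> mu.-integrable `[- pi, pi] (EFin \o F y).
  move=> _; apply: continuous_compact_integrable; first exact: segment_compact.
  by apply: continuous_subspaceT; exact: continuous_jackson_integrand.
have dF y t : (`](x - 1), (x + 1)[%classic : set R) y -> (`[- pi, pi]%classic : set R) t ->
    derivable (F ^~ t) y 1.
  by move=> _ _; have [] := df y t.
have K0 : 0 <= K * M.
  by rewrite mulr_ge0// ?(le_trans _ (JK 0))// (le_trans _ (wM 0)).
have intG : mu.-integrable `[- pi, pi] (EFin \o (fun=> K * M)).
  apply: continuous_compact_integrable; first exact: segment_compact.
  by apply: continuous_subspaceT; exact: cst_continuous.
have Gub y t : (`](x - 1), (x + 1)[%classic : set R) y -> (`[- pi, pi]%classic : set R) t ->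
    `|partial1of2 F y t| <= K * M.
  move=> _ _; rewrite partial1of2E; have [_ ->] := df y t.
  by rewrite normrM ler_pM.
have D := @derivable_under_integral R _ (measurableTypeR R) mu F _ m1 x _ _ xI int dF _
  (fun=> K0) intG Gub.
apply: DeriveDef; first exact: D.
rewrite -derive1E.
rewrite (@differentiation_under_integral R _ (measurableTypeR R) mu F _ m1 x _ _ xI int dF _
  (fun=> K0) intG Gub).
apply: eq_Rintegral => t _ /=; rewrite partial1of2E.
by have [_ ->] := df x t.
Qed.

Lemma locint_indic_mul u (rho : R) : continuous u ->
  locint (fun t => u t * \1_(`[- rho, rho]) t).
Proof.
move=> cu; exists (fun t => u t * \1_(`[- rho, rho]) t); split; first exact: aeW.
move=> a b; apply: (@le_integrable _ _ _ mu _ _ _ (EFin \o u)) => //.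
- apply/measurable_EFinP; apply: measurable_funTS; apply: measurable_funM.
    exact: continuous_measurable_fun.
  by apply: measurable_indic; exact: measurable_itv.
- move=> t _ /=; rewrite lee_fin normrM ler_piMr//.
  by rewrite indicE; case: (_ \in _); rewrite ?normr1// normr0.
- apply: continuous_compact_integrable; first exact: segment_compact.
  exact: continuous_subspaceT.
Qed.

Lemma segint_indic_mul u (rho : R) : continuous u -> (forall t, 0 <= u t) -> 0 < rho ->
  segint (- pi) pi (fun t => u t * \1_(`[- rho, rho]) t) <= segint (- rho) rho u.
Proof.
move=> cu u0 r0; have li := locint_indic_mul rho cu.
have uE : u = (fun t => `|u t|) by apply/funext => t; rewrite ger0_norm.
have p0 := pi_gt0 R.
have [rp|pr] := leP rho pi.
  rewrite (@segint_cat _ (- rho)) ?lerN2//; last lra.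
  rewrite (@segint_cat _ rho (- rho)) //; last lra.
  rewrite (@segint_eq_oo _ (- pi) (- rho) _ (fun=> 0)); last first.
    move=> t /andP[t1 t2]; rewrite indicE memNset ?mulr0//= in_itv/= => /andP[? ?]; lra.
  rewrite (@segint_eq_oo _ rho pi _ (fun=> 0)); last first.
    move=> t /andP[t1 t2]; rewrite indicE memNset ?mulr0//= in_itv/= => /andP[? ?]; lra.
  rewrite (@segint_eq_oo _ (- rho) rho _ u); last first.
    move=> t /andP[t1 t2]; rewrite indicE mem_set ?mulr1//= in_itv/= !ltW//.
  by rewrite !segint_cst ?lerN2// !mul0r add0r addr0.
rewrite (@segint_eq_oo _ (- pi) pi _ u); last first.
  move=> t /andP[t1 t2]; rewrite indicE mem_set ?mulr1//= in_itv/=.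
  apply/andP; split; lra.
rewrite uE; apply: segint_sub; first exact: locint_continuous.
all: lra.
Qed.

(** The kernel is dominated by a sum of multiples of indicators of dyadic
    segments, so that everything reduces to averages over segments. *)
Lemma segint_jackson_le u L : m%:R * pi <= 2 ^+ L :> R -> continuous u ->
  (forall t, 0 <= u t) ->
  segint (- pi) pi (fun t => jackson m t * u t) <=
  2 ^+ 19 * m%:R * \sum_(j < L.+1) 16^-1 ^+ j *
     segint (- (2 ^+ j / m%:R)) (2 ^+ j / m%:R) u.
Proof.
move=> mL cu u0; have m0' : 0 < m%:R :> R by rewrite ltr0n.
pose F j t : R := 16^-1 ^+ j * (u t * \1_(`[- (2 ^+ j / m%:R), 2 ^+ j / m%:R]) t).
have lF j : locint (F j) by apply: locintZ; exact: locint_indic_mul.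
have [lS SE] := segint_sum (- pi) pi L.+1 lF.
apply: (@le_trans _ _ (segint (- pi) pi (fun t => 2 ^+ 19 * m%:R * \sum_(j < L.+1) F j t))).
  apply: segint_le.
  - by apply: locint_continuous; exact: continuous_mul continuous_jackson cu.
  - exact: locintZ.
  move=> t tp; have := jackson_dyadic m0 (_ : `|t| <= pi) mL.
  rewrite ler_norml => /(_ tp)[j [jL mj Jj]].
  apply: (@le_trans _ _ (2 ^+ 19 * m%:R * F j t)).
    rewrite /F indicE mem_set ?mulr1; last first.
      by rewrite /= in_itv/= -ler_norml ler_pdivlMr// mulrC.
    by rewrite mulrA ler_wpM2r.
  rewrite ler_wpM2l ?mulr_ge0//; rewrite (bigD1 (Ordinal jL))//= lerDl.
  apply: sumr_ge0 => i _; apply: mulr_ge0; first by rewrite exprn_ge0.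
  by rewrite mulr_ge0// indicE.
rewrite segintZ// SE ler_wpM2l ?mulr_ge0//; apply: ler_sum => j _.
rewrite segintZ; last exact: locint_indic_mul.
rewrite ler_wpM2l ?exprn_ge0 ?invr_ge0//; apply: segint_indic_mul => //.
by rewrite divr_gt0// exprn_gt0.
Qed.

End fixed_m.
End jackson_operator.

(** * A growth lemma *)

Section growth.
Context {R : realType}.

Lemma powR_inv (x a : R) : 0 <= x -> x^-1 `^ a = (x `^ a)^-1.
Proof. by move=> x0; rewrite -powR_inv1// -powRrM mulN1r powRN. Qed.

Definition rate (s : nat) (alpha : R) (n : nat) : R := n%:R ^+ s * n%:R `^ (- alpha).

Lemma rateE s alpha n : (0 < n)%N -> rate s alpha n = n%:R `^ (s%:R - alpha).
Proof.
move=> n0; have n0' : n%:R != 0 :> R by rewrite pnatr_eq0 -lt0n.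
by rewrite /rate -powR_mulrn// -powRD// n0' implybT.
Qed.

Lemma rate_ge0 s alpha n : 0 <= rate s alpha n.
Proof. by rewrite mulr_ge0 ?exprn_ge0// powR_ge0. Qed.

(** Step from [n] down to [n / q] with [q] so large that the gain
    [q ^ (s - alpha)] outweighs the constant [L] that is lost at each step. *)
Lemma growth_bound (s : nat) (alpha L : R) : 0 < alpha < s%:R -> 0 <= L ->
  exists2 K : R, 0 <= K & forall a : nat -> R,
    (forall n, (0 < n)%N -> a n <= L * n%:R ^+ s) ->
    (forall M n, (0 < M)%N -> (M <= n)%N ->
       a n <= L * (n%:R ^+ s * M%:R `^ (- alpha) + a M)) ->
    forall n, (0 < n)%N -> a n <= K * rate s alpha n.
Proof.
move=> /andP[al0 als] L0; pose be := s%:R - alpha.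
have be0 : 0 < be by rewrite subr_gt0.
(* [q ^ (s - alpha) >= 2 * L] makes the contribution of [a M] at most half of
   the bound to be proved; [q >= 2] makes the recursion descend *)
pose q := (Num.truncn ((2 * L) `^ be^-1)).+2.
have q0 : (0 < q)%N by [].
have q0' : 0 < q%:R :> R by rewrite ltr0n.
have qL : 2 * L <= q%:R `^ be.
  have -> : 2 * L = ((2 * L) `^ be^-1) `^ be.
    by rewrite -powRrM mulVf ?gt_eqF// powRr1// mulr_ge0.
  apply: ge0_ler_powR; rewrite ?nnegrE ?powR_ge0 ?ltW//.
  by rewrite (lt_trans (truncnS_gt _))// ltr_nat.
have q2a0 : 0 <= (2 * q%:R) `^ alpha :> R by exact: powR_ge0.
pose K := L * q%:R ^+ s + 2 * L * (2 * q%:R) `^ alpha.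
have K0 : 0 <= K by rewrite addr_ge0 ?mulr_ge0// exprn_ge0.
exists K => // a a1 a2; elim/ltn_ind => n IH n0.
have n0' : 0 < n%:R :> R by rewrite ltr0n.
have rate1 : 1 <= rate s alpha n.
  rewrite rateE// -[leLHS](powRr0 n%:R); apply: ler_powR; last exact: ltW.
  by rewrite ler1n.
have [nq|qn] := ltnP n q.
  apply: (le_trans (a1 n n0)).
  apply: (@le_trans _ _ (K * 1)); last by rewrite ler_wpM2l.
  rewrite mulr1 /K; apply: ler_wpDr; first by rewrite mulr_ge0// mulr_ge0.
  by rewrite ler_wpM2l// lerXn2r ?nnegrE// ler_nat ltnW.
pose M := (n %/ q)%N.
have M0 : (0 < M)%N by rewrite divn_gt0.
have Mn : (M < n)%N by rewrite ltn_Pdiv.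
have M0' : 0 < M%:R :> R by rewrite ltr0n.
have Mq : M%:R <= n%:R / q%:R :> R.
  by rewrite ler_pdivlMr// -natrM ler_nat leq_trunc_div.
have nM : n%:R / (2 * q%:R) <= M%:R :> R.
  rewrite ler_pdivrMr ?mulr_gt0// -!natrM ler_nat.
  have := ltn_ceil n q0; rewrite -/M mulSn => /ltnW/leq_trans; apply.
  rewrite mulnCA mul2n -addnn; apply: leq_add => //.
  by rewrite leq_pmull.
apply: (le_trans (a2 M n M0 (ltnW Mn))); rewrite mulrDr.
have b1 : M%:R `^ (- alpha) <= (2 * q%:R) `^ alpha * n%:R `^ (- alpha).
  rewrite !powRN; have -> : (2 * q%:R) `^ alpha * (n%:R `^ alpha)^-1 =
      ((n%:R / (2 * q%:R)) `^ alpha)^-1.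
    by rewrite [(n%:R / _) `^ _]powRM ?invr_ge0 ?mulr_ge0// powR_inv ?mulr_ge0// invfM invrK mulrC.
  rewrite lef_pV2 ?posrE ?powR_gt0 ?divr_gt0 ?mulr_gt0//.
  apply: ge0_ler_powR; rewrite ?nnegrE ?(ltW al0)// ?divr_ge0 ?mulr_ge0//.
have b2 : L * rate s alpha M <= 2^-1 * rate s alpha n.
  rewrite !rateE//; apply: (@le_trans _ _ (L * (n%:R / q%:R) `^ be)).
    rewrite ler_wpM2l//; apply: ge0_ler_powR; first exact: ltW.
    - by rewrite nnegrE.
    - by rewrite nnegrE divr_ge0.
    - exact: Mq.
  rewrite powRM ?invr_ge0// powR_inv// mulrCA mulrC.
  rewrite ler_wpM2r ?powR_ge0// ler_pdivrMr ?powR_gt0//.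
  by rewrite mulrC ler_pdivlMr// mulrC.
have b3 := IH M Mn M0.
apply: (@le_trans _ _ (L * (2 * q%:R) `^ alpha * rate s alpha n +
   K * (2^-1 * rate s alpha n))).
  apply: lerD.
    rewrite /rate [leRHS](_ : _ = L * (n%:R ^+ s *
      ((2 * q%:R) `^ alpha * n%:R `^ (- alpha)))); last by ring.
    by rewrite ler_wpM2l// ler_wpM2l// exprn_ge0.
  apply: (@le_trans _ _ (L * (K * rate s alpha M))); first by rewrite ler_wpM2l.
  by rewrite mulrCA ler_wpM2l.
have -> : L * (2 * q%:R) `^ alpha * rate s alpha n + K * (2^-1 * rate s alpha n) =
  (L * (2 * q%:R) `^ alpha + K / 2) * rate s alpha n by ring.
rewrite ler_wpM2r ?rate_ge0//.
have : 0 <= L * q%:R ^+ s by rewrite mulr_ge0// exprn_ge0.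
by rewrite /K; lra.
Qed.

End growth.

(** * Chains of derivatives *)

Section derivative_chains.
Context {R : realType}.
Implicit Types (u v w : R -> R) (A : (R -> R) -> R -> R) (k : nat).

(** A relation rather than a class of functions, so that the [k]-th derivative
    has a name and can be carried through operators. *)
Fixpoint has_derivn k u v : Prop :=
  match k with
  | 0 => cont_periodic u /\ u = v
  | k.+1 => cont_periodic u /\
      exists2 w : R -> R, (forall x : R, is_derive x 1 u (w x)) & has_derivn k w v
  end.

Lemma has_derivn_cont_periodic k u v : has_derivn k u v -> cont_periodic u /\ cont_periodic v.
Proof.
elim: k u => [|k IH] u /=; first by move=> [cu <-].
by move=> [cu [w _ /IH[_ cv]]].
Qed.

Lemma has_derivnE k u v : has_derivn k u v -> derive1n k u = v.
Proof.
elim: k u => [|k IH] u /=; first by move=> [_ ->].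
move=> [_ [w dw /IH <-]]; rewrite -derive1nS derive1Sn; congr (derive1n _ _).
by apply/funext => x; rewrite derive1E; have [_] := dw x.
Qed.

Lemma has_derivn_snoc k u v w : has_derivn k u v -> cont_periodic w ->
  (forall x : R, is_derive x 1 v (w x)) -> has_derivn k.+1 u w.
Proof.
elim: k u => [|k IH] u /=.
  by move=> [cu uv] cw dw; rewrite uv in cu *; split => //; exists w.
by move=> [cu [z dz hz]] cw dw; split => //; exists z => //; exact: IH.
Qed.

Lemma has_derivnB k u v u' v' : has_derivn k u v -> has_derivn k u' v' ->
  has_derivn k (fun x => u x - u' x) (fun x => v x - v' x).
Proof.
elim: k u u' => [|k IH] u u'.
  by move=> [cu uv] [cu' uv']; rewrite -uv -uv'; split => //; exact: cont_periodicB.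
move=> [cu [w dw hw]] [cu' [w' dw' hw']]; split; first exact: cont_periodicB.
exists (fun x => w x - w' x); last exact: IH.
by move=> x; exact: (is_deriveB (dw x) (dw' x)).
Qed.

Lemma has_derivnD k u v u' v' : has_derivn k u v -> has_derivn k u' v' ->
  has_derivn k (fun x => u x + u' x) (fun x => v x + v' x).
Proof.
move=> h1 h2; have [c1 _] := has_derivn_cont_periodic h2.
have h0 : has_derivn k (fun x => u' x - u' x) (fun x => v' x - v' x).
  exact: has_derivnB.
have := has_derivnB h1 (has_derivnB h0 h2).
by congr has_derivn; apply/funext => x; rewrite subrr sub0r opprK.
Qed.

Definition derive_comm A : Prop :=
  (forall u, cont_periodic u -> cont_periodic (A u)) /\
  (forall u w, cont_periodic u -> cont_periodic w -> (forall x : R, is_derive x 1 u (w x)) ->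
     forall x : R, is_derive x 1 (A u) (A w x)).

Lemma has_derivn_op A k u v : derive_comm A -> has_derivn k u v ->
  has_derivn k (A u) (A v).
Proof.
move=> [cA dA]; elim: k u => [|k IH] u /=.
  by move=> [cu <-]; split => //; exact: cA.
move=> [cu [w dw hw]]; split; first exact: cA.
exists (A w); last exact: IH.
by apply: dA => //; have [] := has_derivn_cont_periodic hw.
Qed.

Lemma derive_comm_id : derive_comm id. Proof. by []. Qed.

Lemma derive_comm_comp A B : derive_comm A -> derive_comm B -> derive_comm (A \o B).
Proof.
move=> [cA dA] [cB dB]; split => [u cu|u w cu cw dw]; first exact/cA/cB.
by apply: dA; [exact: cB|exact: cB|exact: dB].
Qed.

Lemma derive_commB A B : derive_comm A -> derive_comm B ->
  derive_comm (fun u x => A u x - B u x).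
Proof.
move=> [cA dA] [cB dB]; split => [u cu|u w cu cw dw x].
  by apply: cont_periodicB; [exact: cA|exact: cB].
exact: (is_deriveB (dA u w cu cw dw x) (dB u w cu cw dw x)).
Qed.

Lemma derive_comm_iter A k : derive_comm A -> derive_comm (iter k A).
Proof.
by move=> sA; elim: k => [|k IH]; [exact: derive_comm_id|exact: derive_comm_comp].
Qed.

Lemma derive_comm_id_sub_iter A k : derive_comm A -> derive_comm (id_sub_iter A k).
Proof.
by move=> sA; apply: derive_comm_iter; exact: (derive_commB derive_comm_id sA).
Qed.

Lemma derive_comm_jackson m : (0 < m)%N -> derive_comm (@jackson_op R m).
Proof.
move=> m0; split; first by move=> u; exact: cont_periodic_jackson_op.
by move=> u w cu cw dw x; exact: is_derive_jackson_op.
Qed.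

End derivative_chains.

(** * Jackson's theorem *)

Section jackson_theorem.
Context {R : realType} (X : banach_lattice R).
Notation nrm := (bl_norm X).
Context (C : R) (C0 : 0 < C).
Context (bA : forall h : R, 0 < h -> bounded_op X (steklov h) C).
Implicit Types (f g u v w : R -> R) (h x y c t : R) (n m k : nat).

Lemma geometric_half_le N : \sum_(j < N) 2^-1 ^+ j <= 2 :> R.
Proof.
suff -> : \sum_(j < N) 2^-1 ^+ j = 2 - 2 * 2^-1 ^+ N :> R.
  by rewrite gerBl mulr_ge0// exprn_ge0// invr_ge0.
elim: N => [|N IH]; first by rewrite big_ord0 expr0; ring.
by rewrite big_ord_recr/= IH exprS; field.
Qed.

(** A geometric sum of averages at any scales is bounded: this replaces
    Minkowski's inequality for convolutions, since translations may be
    unbounded on the lattice. *)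
Lemma norm_dyadic_le D N (h : nat -> R) u g : 0 <= D -> bl_set X u -> bl_set X g ->
  (forall j, 0 < h j) ->
  (forall x, `|u x| <= D * \sum_(j < N) 2^-1 ^+ j * steklov (h j) (fun t => `|g t|) x) ->
  nrm u <= D * (2 * C) * nrm g.
Proof.
move=> D0 Xu Xg h0 ug; have Xa := bl_abs_set Xg.
pose F j x := 2^-1 ^+ j * steklov (h j) (fun t => `|g t|) x.
have XF j : bl_set X (F j).
  by apply: bl_setZ; have [_ b _] := bA (h0 j); have [] := b _ Xa.
have nF j : nrm (F j) <= 2^-1 ^+ j * (C * nrm g).
  have [_ b _] := bA (h0 j); have [XS nS] := b _ Xa.
  rewrite bl_normZ// ger0_norm ?exprn_ge0 ?invr_ge0//.
  by rewrite ler_wpM2l ?exprn_ge0 ?invr_ge0// -(bl_abs_norm Xg).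
have [XS nS] := bl_sum N XF.
have [|_ H] := bl_dom D0 (bl_measurable Xu) XS.
  move=> x; apply: (le_trans (ug x)); rewrite ler_wpM2l//.
  exact: ler_norm.
apply: (le_trans H); rewrite -mulrA ler_wpM2l//; apply: (le_trans nS).
apply: (@le_trans _ _ (\sum_(j < N) 2^-1 ^+ j * (C * nrm g))).
  by apply: ler_sum => j _; exact: nF.
rewrite -mulr_suml -mulrA ler_wpM2r ?geometric_half_le//.
by rewrite mulr_ge0 ?(ltW C0)// bl_norm_ge0.
Qed.

Lemma pow2_ge (z : R) : exists L, z <= 2 ^+ L.
Proof.
exists (Num.truncn z).+1; apply: le_trans (ltW (truncnS_gt z)) _.
by rewrite -natrX ler_nat ltnW// ltn_expl.
Qed.

(** The average at the scale [2 ^ j / m] occurs with the weight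
    [m / 16 ^ j * 2 ^ j / m = 8 ^ - j], which is summable. *)
Lemma norm_jackson_op m u : (0 < m)%N -> cont_periodic u ->
  nrm (jackson_op m u) <= 2 ^+ 20 * (2 * C) * nrm u.
Proof.
move=> m0 cu; have m0' : 0 < m%:R :> R by rewrite ltr0n.
have [L mL] := pow2_ge (m%:R * pi).
have Xu := bl_cont_periodic X cu; have lu := locint_bl Xu.
have XJ : bl_set X (jackson_op m u) by apply: bl_cont_periodic; exact: cont_periodic_jackson_op.
pose rho j : R := 2 ^+ j / m%:R.
have rho0 j : 0 < rho j by rewrite divr_gt0// exprn_gt0.
apply: (@norm_dyadic_le _ L.+1 (fun j => 2 * rho j)) => //.
- by move=> j; rewrite mulr_gt0.
move=> x; have [cu' _] := cu.
have cau : continuous (fun t => `|u (x + t)|).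
  move=> t; apply: (@continuous_comp _ _ _ (fun t => u (x + t)) Num.norm).
    exact: continuous_shiftl.
  exact: norm_continuous.
have cJ := (@continuous_jackson_integrand R m m0 u x cu).
apply: (le_trans (ler_norm_segint _ _ (locint_continuous cJ))).
under eq_fun do rewrite normrM (ger0_norm (jackson_ge0 _ m0)).
apply: (le_trans (segint_jackson_le m0 mL cau _)); first by move=> t.
rewrite -mulrA; rewrite [X in _ <= X * _]exprSr -[leRHS]mulrA.
apply: ler_wpM2l; first exact: exprn_ge0.
rewrite !mulr_sumr; apply: ler_sum => j _; rewrite -/(rho j).
have -> : segint (- rho j) (rho j) (fun t => `|u (x + t)|) =
    2 * rho j * steklov (2 * rho j) (fun t => `|u t|) x.
  rewrite steklovE mulrA mulfV ?mul1r; last by rewrite gt_eqF// mulr_gt0.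
  rewrite [2 * rho j / 2]mulrAC mulfV// mul1r.
  have -> : x - rho j = - rho j + x by rewrite addrC.
  rewrite [x + rho j]addrC segint_shift; last first.
    by move=> t; apply: (@continuous_comp _ _ _ u Num.norm);
      [exact: cu'|exact: norm_continuous].
  by congr (segint _ _ _); apply/funext => t; rewrite addrC.
set S := steklov _ _ _; have S0 : 0 <= S by apply: steklov_ge0 => //; rewrite mulr_gt0.
clearbody S.
rewrite /rho !mulrA; apply: ler_wpM2r => //. have -> : m%:R * 16^-1 ^+ j * 2 * 2 ^+ j / m%:R =
    2 * (16^-1 * 2) ^+ j :> R.
  by rewrite exprMn; field; rewrite gt_eqF.
apply: ler_wpM2l => //; apply: lerXn2r; rewrite ?nnegrE ?invr_ge0//; lra.
Qed.

(** On the segment of radius [2 ^ j / m] the increments of [u] are integrals of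
    [w]; this costs a further factor [2 ^ j / m].  The gain is [1 / m], and the
    weights [16 ^ - j * 4 ^ j] are still summable. *)
Lemma norm_jackson_op_sub m u w : (0 < m)%N -> cont_periodic u -> cont_periodic w ->
  (forall x : R, is_derive x 1 u (w x)) ->
  nrm (fun x => u x - jackson_op m u x) <= 2 ^+ 21 / m%:R * (2 * C) * nrm w.
Proof.
move=> m0 cu cw dw; have m0' : 0 < m%:R :> R by rewrite ltr0n.
have [L mL] := pow2_ge (m%:R * pi).
have Xw := bl_cont_periodic X cw; have lw := locint_bl Xw.
have XJ : bl_set X (fun x => u x - jackson_op m u x).
  by apply: bl_cont_periodic; apply: cont_periodicB => //; exact: cont_periodic_jackson_op.
pose rho j : R := 2 ^+ j / m%:R.
have rho0 j : 0 < rho j by rewrite divr_gt0// exprn_gt0.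
apply: (@norm_dyadic_le _ L.+1 (fun j => 2 * rho j)) => //.
- by move=> j; rewrite mulr_gt0.
move=> x; have [cu' _] := cu; have [cw' _] := cw.
pose phi t := u x - u (x + t).
have cphi : continuous phi.
  by move=> t; apply: cvgB; [exact: cvg_cst|exact: continuous_shiftl].
have caphi : continuous (fun t => `|phi t|).
  move=> t; apply: (@continuous_comp _ _ _ phi Num.norm); first exact: cphi.
  exact: norm_continuous.
have lJ := locint_continuous (continuous_jackson (R := R) m0).
have lJu := locint_continuous (@continuous_jackson_integrand R m m0 u x cu).
have -> : u x - jackson_op m u x = segint (- pi) pi (fun t => jackson m t * phi t).
  rewrite /phi; under eq_fun do rewrite mulrBr mulrC.
  by rewrite segintB//; [rewrite segintZ// segint_jackson// mulr1|exact: locintZ].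
have lJp : locint (fun t => jackson m t * phi t).
  by apply: locint_continuous; apply: continuous_mul => //; exact: continuous_jackson.
apply: (le_trans (ler_norm_segint _ _ lJp)).
under eq_fun do rewrite normrM (ger0_norm (jackson_ge0 _ m0)).
apply: (le_trans (segint_jackson_le m0 mL caphi _)); first by move=> t.
rewrite [leRHS](_ : _ = 2 ^+ 19 * m%:R * (4 / m%:R ^+ 2 * \sum_(j < L.+1)
   2^-1 ^+ j * steklov (2 * rho j) (fun t => `|w t|) x)); last first.
  by field; rewrite gt_eqF.
apply: ler_wpM2l; first by rewrite mulr_ge0// exprn_ge0.
rewrite !mulr_sumr; apply: ler_sum => j _; rewrite -/(rho j).
set S := steklov _ _ _.
have S0 : 0 <= S by apply: steklov_ge0 => //; rewrite mulr_gt0.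
have rhoj := rho0 j.
have bphi t : - rho j <= t <= rho j -> `|phi t| <= 2 * rho j * S.
  move=> /andP[t1 t2].
  have H a b : a <= b -> x - rho j <= a -> b <= x + rho j ->
      `|u b - u a| <= 2 * rho j * S.
    move=> ab xa bx; rewrite -(segint_deriv ab cw' dw).
    apply: (le_trans (ler_norm_segint _ _ lw)); apply: segint_le_steklov => //.
    - by rewrite mulr_gt0.
    - by rewrite mulrAC mulfV ?mul1r.
    - by rewrite mulrAC mulfV ?mul1r.
  have [t0|/ltW t0] := leP 0 t.
    by rewrite /phi distrC; apply: H; lra.
  by rewrite /phi; apply: H; lra.
have phiS : segint (- rho j) (rho j) (fun t => `|phi t|) <= 2 * rho j * (2 * rho j * S).
  rewrite [leRHS](_ : _ = segint (- rho j) (rho j) (fun=> 2 * rho j * S)); last first.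
    by rewrite segint_cst; [ring|lra].
  apply: segint_le => //; first exact: locint_continuous.
  by apply: locint_continuous; exact: cst_continuous.
apply: (@le_trans _ _ (16^-1 ^+ j * (2 * rho j * (2 * rho j * S)))).
  by rewrite ler_wpM2l ?exprn_ge0 ?invr_ge0.
rewrite /rho.
have -> : 16^-1 ^+ j * (2 * (2 ^+ j / m%:R) * (2 * (2 ^+ j / m%:R) * S)) =
    4 / m%:R ^+ 2 * ((16^-1 * 2 * 2) ^+ j * S) :> R.
  by rewrite !exprMn; field; rewrite gt_eqF.
apply: ler_wpM2l; first by rewrite divr_ge0// exprn_ge0.
apply: ler_wpM2r => //; apply: lerXn2r; rewrite ?nnegrE ?invr_ge0//; lra.
Qed.

End jackson_theorem.

Section jackson_iteration.
Context {R : realType} (X : banach_lattice R).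
Notation nrm := (bl_norm X).
Context (C : R) (C0 : 0 < C).
Context (bA : forall h : R, 0 < h -> bounded_op X (steklov h) C).
Implicit Types (f g u v w : R -> R) (h x y c t : R) (n m k : nat).

Lemma norm_jackson_iter_le m u k : (0 < m)%N -> cont_periodic u ->
  nrm (id_sub_iter (jackson_op m) k u) <= (1 + 2 ^+ 20 * (2 * C)) ^+ k * nrm u.
Proof.
move=> m0 cu; elim: k => [|k IH]; first by rewrite expr0 mul1r.
have [cIk _] := derive_comm_id_sub_iter k (derive_comm_jackson (R := R) m0).
have cz := cIk u cu; have cJz := cont_periodic_jackson_op m0 cz.
rewrite id_sub_iterS; apply: (le_trans (bl_normB (bl_cont_periodic X cz) (bl_cont_periodic X cJz))).
apply: (@le_trans _ _ ((1 + 2 ^+ 20 * (2 * C)) * nrm (id_sub_iter (jackson_op m) k u))).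
  by rewrite mulrDl mul1r lerD2l; exact: norm_jackson_op.
rewrite [_ ^+ k.+1]exprS -[leRHS]mulrA ler_wpM2l// addr_ge0// mulr_ge0 ?exprn_ge0// mulr_ge0// ltW//.
Qed.

Lemma norm_jackson_iter_derivn m k u v : (0 < m)%N -> has_derivn k u v ->
  nrm (id_sub_iter (jackson_op m) k u) <= (2 ^+ 21 / m%:R * (2 * C)) ^+ k * nrm v.
Proof.
move=> m0; elim: k u => [|k IH] u; first by move=> [_ ->]; rewrite expr0 mul1r.
move=> [cu [w dw hw]]; have [cw _] := has_derivn_cont_periodic hw.
have [cI dI] := derive_comm_id_sub_iter k (derive_comm_jackson (R := R) m0).
rewrite id_sub_iterS.
apply: (le_trans (norm_jackson_op_sub C0 bA m0 (cI u cu) (cI w cw) (dI u w cu cw dw))).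
rewrite [_ ^+ k.+1]exprS -[leRHS]mulrA ler_wpM2l ?IH// mulr_ge0 ?divr_ge0 ?exprn_ge0// mulr_ge0// ltW//.
Qed.

Lemma trig_poly_jackson_iter m k u : (0 < m)%N -> cont_periodic u ->
  trig_poly (4 * m.-1) (fun x => u x - id_sub_iter (jackson_op m) k u x).
Proof.
move=> m0 cu; elim: k => [|k IH].
  have -> : (fun x => u x - id_sub_iter (jackson_op m) 0 u x) = fun=> 0.
    by apply/funext => x; rewrite subrr.
  exact: trig_poly0.
have [cI _] := derive_comm_id_sub_iter k (derive_comm_jackson (R := R) m0).
have := trig_polyD IH (trig_poly_jackson_op m0 (cI u cu)).
by congr (trig_poly _ _); apply/funext => x; rewrite id_sub_iterS; ring.
Qed.

(** [I - (I - J) ^ s], with [J] the Jackson operator of degree about [n], yields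
    polynomials.  Each factor [I - J] gains [1 / n] at the cost of one
    derivative, and it commutes with differentiation, so that the derivatives
    of the polynomial stay bounded as well. *)
Lemma jackson_theorem s : exists2 K : R, 0 <= K & forall n u v, (0 < n)%N ->
  has_derivn s u v -> exists2 T, trig_poly n T &
    nrm (fun x => u x - T x) <= K * (n%:R ^- s * nrm v) /\
    nrm (derive1n s T) <= K * nrm v.
Proof.
pose K1 := (2 ^+ 23 * (2 * C)) ^+ s; pose K2 := 1 + (1 + 2 ^+ 20 * (2 * C)) ^+ s.
have C2 : 0 <= 2 * C by rewrite mulr_ge0// ltW.
have K10 : 0 <= K1 by rewrite exprn_ge0// mulr_ge0// exprn_ge0.
have K20 : 0 <= K2 by rewrite addr_ge0// exprn_ge0// addr_ge0// mulr_ge0// exprn_ge0.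
exists (K1 + K2); first exact: addr_ge0.
move=> n u v n0 hu; have [cu cv] := has_derivn_cont_periodic hu.
have n0' : 0 < n%:R :> R by rewrite ltr0n.
(* the polynomials have degree [4 * (m - 1) <= n], while [4 * m >= n] keeps the
   gain [1 / m] comparable to [1 / n] *)
pose m := (n %/ 4).+1; have m0 : (0 < m)%N by [].
have m0' : 0 < m%:R :> R by rewrite ltr0n.
have nm : n%:R <= 4 * m%:R :> R.
  by rewrite -natrM ler_nat /m ltnW// mulnC ltn_ceil.
have sJ := derive_comm_id_sub_iter s (derive_comm_jackson (R := R) m0).
have [cI _] := sJ.
have nv := bl_norm_ge0 (bl_cont_periodic X cv).
exists (fun x => u x - id_sub_iter (jackson_op m) s u x).
  apply: (@trig_polyW R (4 * m.-1)); last exact: trig_poly_jackson_iter.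
  by rewrite /m /= mulnC leq_trunc_div.
split.
  have -> : (fun x => u x - (u x - id_sub_iter (jackson_op m) s u x)) =
      id_sub_iter (jackson_op m) s u.
    by apply/funext => x; rewrite opprB addrCA subrr addr0.
  apply: (le_trans (norm_jackson_iter_derivn m0 hu)).
  apply: (@le_trans _ _ (K1 * (n%:R ^- s * nrm v))).
    rewrite [leRHS]mulrA ler_wpM2r// /K1 -exprVn -exprMn lerXn2r ?nnegrE//.
    - by rewrite mulr_ge0// divr_ge0// exprn_ge0.
    - by rewrite mulr_ge0 ?invr_ge0// mulr_ge0// exprn_ge0.
    rewrite [leRHS]mulrAC ler_wpM2r//.
    rewrite ler_pdivrMr// mulrAC ler_pdivlMr//.
    have -> : 2 ^+ 23 * m%:R = 2 ^+ 21 * (4 * m%:R) :> R by ring.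
    by rewrite ler_wpM2l// exprn_ge0.
  rewrite ler_wpM2r//; last by rewrite lerDl.
  by rewrite mulr_ge0// invr_ge0 exprn_ge0.
rewrite (has_derivnE (has_derivnB hu (has_derivn_op sJ hu))).
apply: (le_trans (bl_normB (bl_cont_periodic X cv) (bl_cont_periodic X (cI v cv)))).
apply: (@le_trans _ _ (K2 * nrm v)); last by rewrite ler_wpM2r// lerDr.
by rewrite /K2 mulrDl mul1r lerD2l; exact: norm_jackson_iter_le.
Qed.

End jackson_iteration.

(** * Smoothing by iterated means *)

Section iterated_means.
Context {R : realType} (X : banach_lattice R).
Notation nrm := (bl_norm X).
Context (C : R) (C0 : 0 < C).
Context (bA : forall h : R, 0 < h -> bounded_op X (steklov h) C).
Implicit Types (f g u v w : R -> R) (h x y c t : R) (n m k : nat).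

Lemma cont_periodic_steklov_dot h u : 0 < h -> bl_set X u -> cont_periodic (steklov_dot h u).
Proof.
move=> h0 Xu; split; first by apply: continuous_steklov_dot => //; exact: locint_bl Xu.
have [_ b _] := bounded_op_steklov_dot bA h0; have [XD _] := b u Xu.
by have [] := bl_measurable XD.
Qed.

Lemma derive_comm_steklov_dot h : 0 < h -> derive_comm (@steklov_dot R h).
Proof.
move=> h0; split; first by move=> u cu; apply: cont_periodic_steklov_dot => //; exact: bl_cont_periodic.
by move=> u w cu [cw _] dw x; exact: is_derive_steklov_dot_comm.
Qed.

Section smoothing.
Context (s : nat) (h : R) (h0 : 0 < h).

Notation D := (@steklov_dot R h).
Let bD := bounded_op_steklov_dot bA h0.

(** The partial geometric sum of [I - D], so that [D] composed with it is
    [I - (I - D) ^ s]. *)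
Fixpoint geometric_sum i u : R -> R :=
  match i with
  | 0 => fun=> 0
  | i.+1 => fun x => geometric_sum i u x + id_sub_iter D i u x
  end.

Fixpoint geometric_bound i : R :=
  match i with 0 => 0 | i.+1 => geometric_bound i + (1 + 2 * C) ^+ i end.

Lemma bounded_op_geometric i : bounded_op X (geometric_sum i) (geometric_bound i).
Proof.
elim: i => [|i [g0 bg lg]].
  split => // [f Xf|c f g Xf Xg]; last by apply/funext => x; rewrite /= mulr0 addr0.
  by rewrite bl_norm0 mul0r; split => //; exact: bl_set0.
have [n0 bn ln] := bounded_op_id_sub_iter i bD; split => /=; first exact: addr_ge0.
  move=> f Xf; have [X1 n1] := bg f Xf; have [X2 n2] := bn f Xf.
  split; first exact: bl_setD.
  by apply: (le_trans (bl_normD X1 X2)); rewrite mulrDl lerD.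
by move=> c f g Xf Xg; apply/funext => x; rewrite lg// ln//; ring.
Qed.

Lemma cont_periodic_geometric i u : cont_periodic u -> cont_periodic (geometric_sum i u).
Proof.
move=> cu; elim: i => [|i IH] /=; first by split => //; exact: cst_continuous.
have [cI _] := derive_comm_id_sub_iter i (derive_comm_steklov_dot h0).
have := cont_periodic_lin 1 IH (cI u cu).
by congr cont_periodic; apply/funext => x; rewrite mul1r.
Qed.

Lemma steklov_dot_geometric i u : bl_set X u ->
  D (geometric_sum i u) = (fun x => u x - id_sub_iter D i u x).
Proof.
move=> Xu; have [_ _ lD] := bD; elim: i => [|i IH].
  apply/funext => x; rewrite /= subrr.
  by rewrite /steklov_dot steklovE /segint /Rintegral integral0 mulr0.
have [_ bg _] := bounded_op_geometric i; have [Xg _] := bg u Xu.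
have [_ bn _] := bounded_op_id_sub_iter i bD; have [Xn _] := bn u Xu.
have := lD 1 _ _ Xg Xn.
have -> : (fun x => 1 * geometric_sum i u x + id_sub_iter D i u x) = geometric_sum i.+1 u.
  by apply/funext => x; rewrite mul1r.
move=> ->; apply/funext => x; rewrite IH id_sub_iterS mul1r; ring.
Qed.

(** The geometric sum is a polynomial in [D], so it commutes with [D]. *)
Lemma geometric_steklov_dot i u : bl_set X u ->
  geometric_sum i (D u) = D (geometric_sum i u).
Proof.
move=> Xu; rewrite steklov_dot_geometric//.
have comm j : id_sub_iter D j (D u) = D (id_sub_iter D j u).
  elim: j => //= j IH; have [_ bn _] := bounded_op_id_sub_iter j bD.
  have [Xn _] := bn u Xu; have [_ bD' _] := bD; have [XDn _] := bD' _ Xn.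
  by rewrite -/(id_sub_iter _ _ _) IH -(bounded_opB bD Xn XDn).
apply/funext => x; elim: i => [|i IH]; first by rewrite /= subrr.
by rewrite /= IH comm -/(id_sub_iter _ _ _); ring.
Qed.

(** [I - (I - D) ^ s] is a combination of the averages [D, ..., D ^ s].  It is
    [D] composed with a geometric sum, and so gains one derivative, while its
    distance to the identity is the difference of order [s]. *)
Definition mean_op u : R -> R := fun x => u x - id_sub_iter D s u x.

Definition mean_bound : R := 1 + (1 + 2 * C) ^+ s.

Lemma bounded_op_mean : bounded_op X mean_op mean_bound.
Proof. exact: bounded_op_sub (bounded_op_id X) (bounded_op_id_sub_iter s bD). Qed.

Lemma derive_comm_mean : derive_comm mean_op.
Proof.
apply: (derive_commB derive_comm_id).
exact: (derive_comm_id_sub_iter s (derive_comm_steklov_dot h0)).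
Qed.

Lemma cont_periodic_mean u : bl_set X u -> cont_periodic (mean_op u).
Proof.
move=> Xu; rewrite /mean_op -steklov_dot_geometric//; apply: cont_periodic_steklov_dot => //.
by have [_ b _] := bounded_op_geometric s; have [] := b u Xu.
Qed.

(** The derivative of [mean_op (mean_op u)]: the latter is [D] of a function, and
    the derivative of an average is a difference quotient. *)
Definition mean_deriv u : R -> R := fun x =>
  h^-1 * (geometric_sum s (mean_op u) (x + h) - geometric_sum s (mean_op u) x).

Lemma cont_periodic_mean_deriv u : bl_set X u -> cont_periodic (mean_deriv u).
Proof.
move=> Xu; have [cg pg] := cont_periodic_geometric s (cont_periodic_mean Xu).
have cs : cont_periodic (fun x => geometric_sum s (mean_op u) (x + h)).
  by split; [exact: continuous_shift|move=> x; rewrite addrAC pg].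
have c0 : cont_periodic (fun=> 0 : R) by split => //; exact: cst_continuous.
have := cont_periodic_lin h^-1 (cont_periodicB cs (conj cg pg)) c0.
by congr cont_periodic; apply/funext => x; rewrite addr0.
Qed.

Lemma is_derive_mean2 u x : bl_set X u ->
  is_derive x 1 (mean_op (mean_op u)) (mean_deriv u x).
Proof.
move=> Xu; have [_ b _] := bounded_op_mean; have [XM _] := b u Xu.
have [cg _] := cont_periodic_geometric s (cont_periodic_mean Xu).
have E : D (geometric_sum s (mean_op u)) = mean_op (mean_op u).
  by rewrite steklov_dot_geometric.
by rewrite -E; exact: is_derive_steklov_dot.
Qed.

Definition deriv_bound : R := 8 * C * geometric_bound s ^+ 2.

(** Translations need not be bounded on the lattice, but a translate of an
    average is dominated by a longer average. *)
Lemma norm_mean_deriv u : bl_set X u -> nrm (mean_deriv u) <= deriv_bound / h * nrm u.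
Proof.
move=> Xu; have [g0 bg _] := bounded_op_geometric s.
have [XS nS] := bg u Xu; have [XSS nSS] := bg _ XS.
pose z := geometric_sum s (geometric_sum s u).
have zE : geometric_sum s (mean_op u) = D z.
  by rewrite /mean_op -steklov_dot_geometric// geometric_steklov_dot.
have Xz : bl_set X z by []. have lz := locint_bl Xz.
have h40 : 0 < 4 * h by rewrite mulr_gt0.
have [_ b4 _] := bA h40; have [XA nA] := b4 _ (bl_abs_set Xz).
have c0 : 0 <= 8 / h by rewrite divr_ge0// ltW.
have mW := (bl_measurable (bl_cont_periodic X (cont_periodic_mean_deriv Xu))).
have [|_ H] := bl_dom c0 mW XA.
  move=> x; rewrite /mean_deriv zE.
  rewrite [in leRHS]ger0_norm; last exact: steklov_ge0.
  rewrite normrM gtr0_norm ?invr_gt0// [leRHS](_ : _ =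
    h^-1 * (8 * steklov (4 * h) (fun t => `|z t|) x)); last by ring.
  apply: ler_wpM2l; first by rewrite invr_ge0 ltW.
  have dom y : `|y - x| + h <= 4 * h / 2 ->
      `|D z y| <= 4 * steklov (4 * h) (fun t => `|z t|) x.
    move=> yx; have := steklov_dot_window h0 h40 lz yx.
    by rewrite mulfK// gt_eqF.
  apply: (le_trans (ler_normB _ _)).
  have d1 : `|D z (x + h)| <= 4 * steklov (4 * h) (fun t => `|z t|) x.
    by apply: dom; rewrite addrAC subrr add0r gtr0_norm//; lra.
  have d2 : `|D z x| <= 4 * steklov (4 * h) (fun t => `|z t|) x.
    by apply: dom; rewrite subrr normr0; lra.
  lra.
apply: (le_trans H).
rewrite [leRHS](_ : _ = 8 / h * (C * (geometric_bound s * (geometric_bound s * nrm u)))).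
  rewrite ler_wpM2l//; apply: (le_trans nA); rewrite (bl_abs_norm Xz).
  rewrite ler_wpM2l ?(ltW C0)//; apply: (le_trans nSS).
  by rewrite ler_wpM2l.
by rewrite /deriv_bound; ring.
Qed.

(** One application of [mean2_op] gains one derivative and commutes with
    differentiation, so [s] applications gain [s] derivatives. *)
Definition mean2_op u : R -> R := mean_op (mean_op u).
Definition smoothing u : R -> R := iter s mean2_op u.

Lemma bounded_op_mean2 : bounded_op X mean2_op (mean_bound * mean_bound).
Proof. exact: bounded_op_comp bounded_op_mean bounded_op_mean. Qed.

Lemma derive_comm_mean2 : derive_comm mean2_op.
Proof. exact: derive_comm_comp derive_comm_mean derive_comm_mean. Qed.

Lemma bl_iter_mean_deriv k u : bl_set X u -> bl_set X (iter k mean_deriv u) /\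
  nrm (iter k mean_deriv u) <= (deriv_bound / h) ^+ k * nrm u.
Proof.
have d0 : 0 <= deriv_bound / h.
  by rewrite divr_ge0 ?(ltW h0)// /deriv_bound mulr_ge0 ?sqr_ge0// mulr_ge0// ltW.
move=> Xu; elim: k => [|k [Xk nk]]; first by rewrite expr0 mul1r.
rewrite iterS; split; first exact/bl_cont_periodic/cont_periodic_mean_deriv.
by apply: (le_trans (norm_mean_deriv Xk)); rewrite [_ ^+ k.+1]exprS -[leRHS]mulrA ler_wpM2l.
Qed.

Lemma has_derivn_smoothing k u : bl_set X u ->
  has_derivn k.+1 (iter k.+1 mean2_op u) (iter k.+1 mean_deriv u).
Proof.
move=> Xu; elim: k => [|k IH].
  have cM : cont_periodic (mean2_op u).
    by have [c _] := derive_comm_mean; apply: c; exact: cont_periodic_mean.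
  split => //; exists (mean_deriv u); last by split => //; exact: cont_periodic_mean_deriv.
  by move=> x; exact: is_derive_mean2.
have [Xk _] := bl_iter_mean_deriv k.+1 Xu.
apply: has_derivn_snoc (has_derivn_op derive_comm_mean2 IH) _ _.
  exact: cont_periodic_mean_deriv.
by move=> x; exact: is_derive_mean2.
Qed.

Fixpoint smoothing_bound k : R := match k with
  | 0 => 0
  | k.+1 => smoothing_bound k + (mean_bound * mean_bound) ^+ k * (1 + mean_bound)
  end.

(** The operators [M ^ j] are bounded, so [u - M ^ k u], which is the sum of
    the [M ^ j (u - M u)] for [j < k], is bounded by [u - M u]. *)
Lemma norm_smoothing_sub k u : bl_set X u ->
  nrm (fun x => u x - iter k mean2_op u x) <=
    smoothing_bound k * nrm (id_sub_iter D s u).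
Proof.
move=> Xu; pose e x := u x - mean_op u x.
have eE : e = id_sub_iter D s u.
  by apply/funext => x; rewrite /e /mean_op opprB addrCA subrr addr0.
have [mb0 bM _] := bounded_op_mean; have [XM _] := bM u Xu.
have Xe : bl_set X e by exact: bl_setB.
have [XMe nMe] := bM e Xe; have [XMM _] := bM _ XM.
have n1 : nrm (fun x => u x - mean2_op u x) <= (1 + mean_bound) * nrm e.
  apply: (le_trans (bl_norm_triangle Xu XM XMM)).
  rewrite mulrDl mul1r lerD2l /mean2_op; apply: le_trans nMe.
  by rewrite -(bounded_opB bounded_op_mean Xu XM).
rewrite -eE; elim: k => [|k IH] /=.
  rewrite (_ : (fun x => _) = fun=> 0); last by apply/funext => x; rewrite subrr.
  by rewrite bl_norm0 mul0r.
have bI := bounded_op_iter k bounded_op_mean2.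
have [i0 bI' _] := bI.
have [XI _] := bI' u Xu; have [XI1 _] := bI' _ XMM.
have E : (fun x => iter k mean2_op u x - mean2_op (iter k mean2_op u) x) =
    iter k mean2_op (fun x => u x - mean2_op u x).
  by rewrite (bounded_opB bI Xu XMM) -[iter k _ (mean2_op u)]iterSr.
have [_ b2 _] := bounded_op_mean2.
have [X2I _] := b2 _ XI.
apply: (le_trans (bl_norm_triangle Xu XI X2I)).
rewrite mulrDl lerD// E; have [_ nI] := bI' _ (bl_setB Xu XMM).
apply: (le_trans nI); rewrite -[leRHS]mulrA; exact: ler_wpM2l.
Qed.

End smoothing.

End iterated_means.

(** * Rates of approximation *)

Section big_oh.
Context {R : realType}.

(** The rate is positive, so the finitely many [n] that the asymptotic bound
    leaves out only enlarge the constant. *)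
Lemma eqO_powerP (a : nat -> R) (alpha : R) : (forall n, (0 < n)%N -> 0 <= a n) ->
  ((a : nat -> R^o) =O_\oo ((fun n => n%:R `^ (- alpha)) : nat -> R^o)) <->
  exists2 K : R, 0 <= K & forall n, (0 < n)%N -> a n <= K * n%:R `^ (- alpha).
Proof.
move=> a0; have w0 n : (0 < n)%N -> 0 < n%:R `^ (- alpha) :> R.
  by move=> n0; rewrite powR_gt0// ltr0n.
split=> [/eqOP H|[K K0 aK]]; last first.
  apply/eqOP; exists K; split; first exact: num_real.
  move=> k Kk; exists 1%N => // n /= n0.
  rewrite !ger0_norm ?a0 ?(ltW (w0 _ n0))//.
  by apply: (le_trans (aK n n0)); rewrite ler_wpM2r ?(ltW (w0 _ n0))// ltW.
have [k [k0 [N _ HN]]] : exists k : R, 0 < k /\ \forall n \near \oo,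
    `|a n : R^o| <= k * `|n%:R `^ (- alpha) : R^o|.
  have [M [_ HM]] := H; exists (`|M| + 1); split; first by rewrite ltr_wpDl.
  by apply: HM; rewrite (le_lt_trans (ler_norm _))// ltrDl.
have s0 n : 0 <= `|a n| / n%:R `^ (- alpha) by rewrite divr_ge0// powR_ge0.
exists (k + \sum_(n < N) `|a n| / n%:R `^ (- alpha)).
  by rewrite addr_ge0 ?(ltW k0)// sumr_ge0.
move=> n n0; have wn := w0 n n0; have [Nn|nN] := leqP N n.
  have := HN n Nn; rewrite /= !ger0_norm ?a0 ?(ltW wn)// => h.
  by apply: (le_trans h); rewrite ler_wpM2r ?(ltW wn)// lerDl sumr_ge0.
rewrite -ler_pdivrMr// (bigD1 (Ordinal nN))//= ger0_norm ?a0//.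
by rewrite addrCA lerDl addr_ge0 ?(ltW k0)// sumr_ge0.
Qed.

End big_oh.

Section rates.
Context {R : realType} (X : banach_lattice R).
Notation nrm := (bl_norm X).
Context (C : R) (C0 : 0 < C).
Context (bA : forall h : R, 0 < h -> bounded_op X (steklov h) C).
Implicit Types (f g u v w : R -> R).

(** The derivative of the smoothing of [f] at the scale [gamma / n] is compared
    with that at a much coarser scale.  This costs a constant factor, which the
    growth lemma absorbs because [alpha < s].  Once the derivative of the
    smoothing is known to be of order [n ^ (s - alpha)], Jackson's theorem
    replaces the smoothing by a polynomial. *)
Lemma realization (s : nat) (alpha gamma : R) f (Kf : R) : (0 < s)%N ->
  0 < alpha < s%:R -> 0 < gamma -> bl_set X f -> 0 <= Kf ->
  (forall n, (0 < n)%N ->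
     nrm (id_sub_iter (steklov_dot (gamma / n%:R)) s f) <= Kf * n%:R `^ (- alpha)) ->
  exists2 K : R, 0 <= K & forall n, (0 < n)%N -> exists2 T, trig_poly n T &
    nrm (fun x => f x - T x) <= K * n%:R `^ (- alpha) /\
    n%:R ^- s * nrm (derive1n s T) <= K * n%:R `^ (- alpha).
Proof.
move=> s0 als g0 Xf Kf0 fK; have hn n : (0 < n)%N -> 0 < gamma / n%:R.
  by move=> n0; rewrite divr_gt0// ltr0n.
pose P n := smoothing s (gamma / n%:R); pose v n := derive1n s (P n f).
pose db := deriv_bound C s / gamma; pose sb := smoothing_bound C s s.
pose mb := (mean_bound C s * mean_bound C s) ^+ s.
have XP n u : (0 < n)%N -> bl_set X u -> bl_set X (P n u) /\ nrm (P n u) <= mb * nrm u.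
  move=> n0 Xu; have [_ b _] := bounded_op_iter s (bounded_op_mean2 bA s (hn n n0)).
  exact: b.
have dP n u : (0 < n)%N -> bl_set X u -> has_derivn s (P n u)
    (iter s (mean_deriv s (gamma / n%:R)) u).
  move=> n0 Xu; have := has_derivn_smoothing C0 bA s (hn n n0) s.-1 Xu.
  by rewrite (prednK s0).
have nW n u : (0 < n)%N -> bl_set X u ->
    nrm (iter s (mean_deriv s (gamma / n%:R)) u) <= db ^+ s * n%:R ^+ s * nrm u.
  move=> n0 Xu; have [_] := bl_iter_mean_deriv C0 bA s (hn n n0) s Xu.
  by rewrite -exprMn /db invf_div mulrA mulrAC.
have db0 : 0 <= db ^+ s.
  rewrite exprn_ge0// /db divr_ge0 ?(ltW g0)// /deriv_bound mulr_ge0 ?sqr_ge0//.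
  by rewrite mulr_ge0// ltW.
have mean0 : 0 <= mean_bound C s by have [] := bounded_op_mean bA s g0.
have sb0 : 0 <= sb.
  rewrite /sb; elim: {2}s => //= k IH; rewrite addr_ge0// mulr_ge0 ?exprn_ge0 ?mulr_ge0//.
  by rewrite addr_ge0.
have mb0 : 0 <= mb by rewrite exprn_ge0// mulr_ge0.
have fP n : (0 < n)%N -> nrm (fun x => f x - P n f x) <= sb * Kf * n%:R `^ (- alpha).
  move=> n0; apply: (le_trans (norm_smoothing_sub bA s (hn n n0) s Xf)).
  by rewrite -mulrA ler_wpM2l// fK.
have vE n : (0 < n)%N -> v n = iter s (mean_deriv s (gamma / n%:R)) f.
  by move=> n0; exact: has_derivnE (dP n f n0 Xf).
have Xv n : (0 < n)%N -> bl_set X (v n).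
  by move=> n0; rewrite vE//; have [] := bl_iter_mean_deriv C0 bA s (hn n n0) s Xf.
pose L := db ^+ s * (nrm f + sb * Kf) + mb.
have nf := bl_norm_ge0 Xf.
have L0 : 0 <= L by rewrite addr_ge0// mulr_ge0// addr_ge0// mulr_ge0.
have [K K0 HK] := growth_bound als L0.
have a1 n : (0 < n)%N -> nrm (v n) <= L * n%:R ^+ s.
  move=> n0; rewrite vE//; apply: (le_trans (nW n f n0 Xf)).
  rewrite mulrAC ler_wpM2r ?exprn_ge0// /L mulrDr -addrA lerDl.
  by rewrite addr_ge0// mulr_ge0// mulr_ge0.
have a2 M n : (0 < M)%N -> (M <= n)%N ->
    nrm (v n) <= L * (n%:R ^+ s * M%:R `^ (- alpha) + nrm (v M)).
  move=> M0 Mn; have n0 := leq_trans M0 Mn.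
  have [XM _] := XP M f M0 Xf; have Xd := bl_setB Xf XM.
  have sP : derive_comm (P n).
    exact: (derive_comm_iter s (derive_comm_mean2 bA s (hn n n0))).
  have h1 := dP n _ n0 Xd.
  have h2 := has_derivn_op sP (dP M f M0 Xf); rewrite -(vE M M0) in h2.
  have bP : bounded_op X (P n) mb.
    exact: bounded_op_iter s (bounded_op_mean2 bA s (hn n n0)).
  have E : P n f = fun x => P n (fun y => f y - P M f y) x + P n (P M f) x.
    by apply/funext => x; rewrite (bounded_opB bP Xf XM) subrK.
  have vnE : v n = fun x => iter s (mean_deriv s (gamma / n%:R)) (fun y => f y - P M f y) x
      + P n (v M) x.
    by rewrite /v E; exact: has_derivnE (has_derivnD h1 h2).
  have [X1 _] := bl_iter_mean_deriv C0 bA s (hn n n0) s Xd.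
  have [X2 n2] := XP n _ n0 (Xv M M0).
  rewrite vnE; apply: (le_trans (bl_normD X1 X2)); rewrite mulrDr; apply: lerD.
    apply: (le_trans (nW n _ n0 Xd)).
    apply: (@le_trans _ _ (db ^+ s * n%:R ^+ s * (sb * Kf * M%:R `^ (- alpha)))).
      by rewrite ler_wpM2l ?fP// mulr_ge0// exprn_ge0.
    rewrite [leLHS](_ : _ = db ^+ s * (sb * Kf) * (n%:R ^+ s * M%:R `^ (- alpha))); last by ring.
    rewrite ler_wpM2r ?mulr_ge0 ?exprn_ge0 ?powR_ge0// /L mulrDr.
    by rewrite addrAC lerDr addr_ge0// mulr_ge0.
  apply: (le_trans n2); rewrite ler_wpM2r ?(bl_norm_ge0 (Xv M M0))// /L.
  by rewrite lerDr mulr_ge0// addr_ge0// mulr_ge0.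
have vK := HK (fun n => nrm (v n)) a1 a2.
have [J J0 HJ] := jackson_theorem C0 bA s.
exists (sb * Kf + J * K); first by rewrite addr_ge0 ?mulr_ge0.
move=> n n0; have n0' : 0 < n%:R :> R by rewrite ltr0n.
have := dP n f n0 Xf; rewrite -(vE n n0) => hv.
have [T TT [T1 T2]] := HJ n _ _ n0 hv; exists T => //.
have XT := bl_trig_poly X TT; have [XPn _] := XP n f n0 Xf.
have vn : n%:R ^- s * nrm (v n) <= K * n%:R `^ (- alpha).
  apply: (@le_trans _ _ (n%:R ^- s * (K * rate s alpha n))).
    by rewrite ler_wpM2l ?vK// invr_ge0 exprn_ge0.
  by rewrite /rate mulrCA mulrA mulrA -[K / _ * _]mulrA mulVf ?mulr1// expf_neq0// gt_eqF.
have w0 : 0 <= n%:R `^ (- alpha) :> R by exact: powR_ge0.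
split.
  apply: (le_trans (bl_norm_triangle Xf XPn XT)); rewrite mulrDl lerD ?fP//.
  by apply: (le_trans T1); rewrite -mulrA ler_wpM2l.
apply: (@le_trans _ _ (J * (n%:R ^- s * nrm (v n)))).
  by rewrite mulrCA ler_wpM2l// invr_ge0 exprn_ge0.
apply: (@le_trans _ _ (J * (K * n%:R `^ (- alpha)))); first by rewrite ler_wpM2l.
by rewrite mulrA ler_wpM2r// lerDr mulr_ge0.
Qed.

End rates.

(** * Sampling operators *)

Section sampling.
Context {R : realType} (X : banach_lattice R).
Notation nrm := (bl_norm X).
Context (s : nat) (s0 : (0 < s)%N).
Context (Phi : nat -> set (R -> R)) (hPhi : approximating_spaces X s Phi).
Context (m : nat -> nat) (x : nat -> nat -> R) (phi : nat -> nat -> R -> R).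
Context (hphi : forall n k, (0 < n)%N -> (1 <= k <= m n)%N -> Phi n (phi n k)).
Implicit Types (f g u v w : R -> R) (n k : nat).

Notation G := (sampling_op m x phi).

Lemma approximating_bl n g : Phi n g -> bl_set X g.
Proof. by have [PX _ _ _ _] := hPhi; exact: PX. Qed.

Lemma approximatingB n f g : Phi n f -> Phi n g -> Phi n (fun y => f y - g y).
Proof.
have [_ P _ _ _] := hPhi; have [_ lP] := P n => Pf Pg; have := lP (-1) g f Pg Pf.
by under eq_fun do rewrite mulN1r addrC.
Qed.

(** Both alternatives for the approximating spaces provide what the argument
    needs: an integral derivative of order [s] and its Bernstein inequality. *)
Lemma approximating_regular : exists2 B : R, 0 <= B & forall n g, Phi n g ->
  [/\ integral_derivative s g, bl_set X (derive1n s g) &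
      nrm (derive1n s g) <= (B * n%:R) ^+ s * nrm g].
Proof.
have [_ _ _ _ [B B0 H]] := hPhi; exists B; first exact: ltW.
case: H => [H n g /H[sg /(_ s)[Xg ng]]|[_ H] n g /H[sg /(_ s (leqnn s))[Xg ng]]].
  by split => //; exact: smooth_integral_derivative.
by split => //; apply: spline_integral_derivative => //; exact: locint_bl Xg.
Qed.

Lemma approximating_sampling n f : (0 < n)%N -> Phi n (G n f).
Proof.
move=> n0; have [_ P _ _ _] := hPhi; have [P0 lP] := P n.
suff H j : (j <= m n)%N -> Phi n (fun y => \sum_(1 <= k < j.+1) f (x n k) * phi n k y).
  exact: H.
elim: j => [_|j IH jm].
  by under eq_fun do rewrite big_geq//.
under eq_fun do rewrite big_nat_recr//= addrC.
by apply: lP; [apply: hphi|exact/IH/ltnW].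
Qed.

Lemma sampling_opB n f g :
  G n (fun y => f y - g y) = (fun y => G n f y - G n g y).
Proof.
apply/funext => y; rewrite /sampling_op -sumrB.
by apply: eq_bigr => k _; rewrite mulrBl.
Qed.

(** The sampled approximants at the levels [M <= N] differ by an element of the
    space of level [N], to which Bernstein's inequality applies; the growth
    lemma adds up these differences. *)
Lemma bernstein_rate (alpha Ke Kp : R) f (p : nat -> (R -> R) -> R) :
  0 < alpha < s%:R -> bl_set X f -> 0 <= Ke -> 0 <= Kp ->
  (forall n, (0 < n)%N -> nrm (fun y => f y - G n f y) <= Ke * n%:R `^ (- alpha)) ->
  (forall n u, (0 < n)%N -> bl_set X u -> 0 <= p n u) ->
  (forall n u v, (0 < n)%N -> bl_set X u -> bl_set X v ->
     p n u <= p n v + p n (fun y => u y - v y)) ->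
  (forall n N g, (0 < n)%N -> Phi N g ->
     n%:R ^+ s * p n g <= Kp * N%:R ^+ s * nrm g) ->
  exists2 K : R, 0 <= K & forall n, (0 < n)%N -> p n (G n f) <= K * n%:R `^ (- alpha).
Proof.
move=> als Xf Ke0 Kp0 fG p0 psub pB.
have XG n : (0 < n)%N -> bl_set X (G n f).
  by move=> n0; apply: approximating_bl; exact: approximating_sampling.
have nf := bl_norm_ge0 Xf.
have /andP[al0 _] := als.
have wmono M N : (0 < M)%N -> (M <= N)%N -> N%:R `^ (- alpha) <= M%:R `^ (- alpha) :> R.
  move=> M0 MN; have N0 := leq_trans M0 MN.
  rewrite !powRN lef_pV2 ?posrE ?powR_gt0 ?ltr0n//.
  by apply: ge0_ler_powR; rewrite ?nnegrE ?ler_nat// ltW.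
have w1 N : (0 < N)%N -> N%:R `^ (- alpha) <= 1 :> R.
  by move=> N0; have := wmono 1%N N isT N0; rewrite powR1.
pose L := Kp * (nrm f + 2 * Ke) + 1.
have L0 : 0 <= L by rewrite addr_ge0// mulr_ge0// addr_ge0// mulr_ge0.
have [K K0 HK] := growth_bound als L0; exists K => // n n0.
have n0' : 0 < n%:R :> R by rewrite ltr0n.
have ns0 : 0 < n%:R ^+ s :> R by exact: exprn_gt0.
pose a N := n%:R ^+ s * p n (G N f).
have a1 N : (0 < N)%N -> a N <= L * N%:R ^+ s.
  move=> N0; apply: (le_trans (pB n N _ n0 (approximating_sampling f N0))).
  rewrite mulrAC ler_wpM2r ?exprn_ge0//.
  have nG : nrm (G N f) <= nrm f + Ke.
    have := bl_normB Xf (bl_setB Xf (XG N N0)).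
    rewrite (_ : (fun y => f y - (f y - G N f y)) = G N f); last first.
      by apply/funext => y; rewrite opprB addrCA subrr addr0.
    move=> /le_trans; apply; rewrite lerD2l; apply: (le_trans (fG N N0)).
    by rewrite ler_piMr// w1.
  apply: (@le_trans _ _ (Kp * (nrm f + Ke))); first by rewrite ler_wpM2l.
  rewrite /L; apply: ler_wpDr => //; rewrite ler_wpM2l// lerD2l.
  by rewrite mulr_natl mulr2n lerDl.
have a2 M N : (0 < M)%N -> (M <= N)%N ->
    a N <= L * (N%:R ^+ s * M%:R `^ (- alpha) + a M).
  move=> M0 MN; have N0 := leq_trans M0 MN.
  have XN := XG N N0; have XM := XG M M0.
  have [_ _ Pm _ _] := hPhi.
  have PD : Phi N (fun y => G N f y - G M f y).
    apply: approximatingB; first exact: approximating_sampling.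
    by apply: (Pm M N MN); exact: approximating_sampling.
  have nD : nrm (fun y => G N f y - G M f y) <= 2 * Ke * M%:R `^ (- alpha).
    apply: (le_trans (bl_norm_triangle XN Xf XM)).
    rewrite (bl_normBC XN Xf) mulr_natl mulr2n mulrDl lerD//; last exact: fG.
    by apply: (le_trans (fG N N0)); rewrite ler_wpM2l// wmono.
  have h : a N <= a M + n%:R ^+ s * p n (fun y => G N f y - G M f y).
    by rewrite /a -mulrDr ler_wpM2l ?(ltW ns0)//; exact: psub.
  have h2 := pB n N _ n0 PD.
  have h3 : Kp * N%:R ^+ s * nrm (fun y => G N f y - G M f y) <=
      Kp * (2 * Ke) * (N%:R ^+ s * M%:R `^ (- alpha)).
    rewrite [leRHS](_ : _ = Kp * N%:R ^+ s * (2 * Ke * M%:R `^ (- alpha))); last by ring.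
    by rewrite ler_wpM2l// mulr_ge0// exprn_ge0.
  have w0 : 0 <= N%:R ^+ s * M%:R `^ (- alpha) :> R.
    by rewrite mulr_ge0 ?exprn_ge0// powR_ge0.
  have aM0 : 0 <= a M by rewrite mulr_ge0 ?(ltW ns0)// p0.
  have h4 : 0 <= Kp * (nrm f + 2 * Ke) * a M.
    by rewrite mulr_ge0// mulr_ge0// addr_ge0// mulr_ge0.
  have h5 : 0 <= Kp * nrm f * (N%:R ^+ s * M%:R `^ (- alpha)).
    by rewrite mulr_ge0// mulr_ge0.
  move: w0 h h2 h3 h4 h5; rewrite /L; set W := _ * M%:R `^ _.
  by move=> w0 h h2 h3 h4 h5; lra.
have := HK a a1 a2 n n0; rewrite /a /rate mulrCA => h.
by rewrite -(ler_pM2l ns0).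
Qed.

End sampling.

(** * The equivalence *)

Theorem corollary3p2 (R : realType) (X : banach_lattice R)
  (hA : assumptionA X)
  (r s : nat) (hr : (0 < r)%N) (hs : (0 < s)%N) (hrs : (s <= 2 * r)%N)
  (Phi : nat -> set (R -> R)) (hPhi : approximating_spaces X s Phi)
  (gamma gamma' : R) (hgamma : 0 < gamma) (hgamma' : 0 < gamma')
  (m : nat -> nat) (x : nat -> nat -> R)
  (hx : sampling_nodes gamma gamma' m x)
  (phi : nat -> nat -> R -> R)
  (hphi : forall n k, (0 < n)%N -> (1 <= k <= m n)%N -> Phi n (phi n k))
  (K1 K2 K3 : R) (hK1 : 0 < K1) (hK2 : 0 < K2) (hK3 : 0 < K3)
  (hstab : forall n, (0 < n)%N -> forall f : R -> R, bl_set X f ->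
     K2 * discrete_norm X m x n f <= bl_norm X (sampling_op m x phi n f) /\
     bl_norm X (sampling_op m x phi n f) <= K1 * discrete_norm X m x n f)
  (happrox : forall n, (0 < n)%N -> forall T : R -> R, trig_poly n T ->
     bl_norm X (fun y => T y - sampling_op m x phi n T y)
       <= K3 * n%:R ^- s * bl_norm X (derive1n s T)) :
  forall f : R -> R, bl_set X f -> forall alpha : R, 0 < alpha < s%:R ->
    (((fun n : nat => bl_norm X (fun y => f y - sampling_op m x phi n f y))
        : nat -> R^o)
       =O_\oo ((fun n : nat => n%:R `^ (- alpha)) : nat -> R^o))
    <->
    (((fun n : nat =>
         discrete_norm X m x n (id_sub_iter (steklov (gamma / n%:R)) r f) +
         bl_norm X (id_sub_iter (steklov_dot (gamma / n%:R)) s f))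
        : nat -> R^o)
       =O_\oo ((fun n : nat => n%:R `^ (- alpha)) : nat -> R^o)).
Proof.
have [C C0 bA] := assumptionA_bounded hA.
have hh n : (0 < n)%N -> 0 < gamma / n%:R by move=> n0; rewrite divr_gt0// ltr0n.
pose nrm := bl_norm X; pose dn := discrete_norm X m x.
pose G := sampling_op m x phi.
pose NA n := id_sub_iter (steklov (gamma / n%:R)) r.
pose ND n := id_sub_iter (steklov_dot (gamma / n%:R)) s.
have bNA n : (0 < n)%N -> bounded_op X (NA n) ((1 + C) ^+ r).
  by move=> n0; apply: bounded_op_id_sub_iter; exact: bA (hh n n0).
have bND n : (0 < n)%N -> bounded_op X (ND n) ((1 + 2 * C) ^+ s).
  by move=> n0; apply: bounded_op_id_sub_iter; exact: bounded_op_steklov_dot bA _ (hh n n0).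
have XG n g : (0 < n)%N -> bl_set X (G n g).
  by move=> n0; exact: (approximating_bl hPhi (approximating_sampling hPhi x hphi g n0)).
have dn0 n u : 0 <= dn n u by exact: discrete_norm_ge0.
have dnB n u v : dn n u <= dn n v + dn n (fun y => u y - v y).
  apply: discrete_norm_triangle => y.
  by rewrite -{1}(subrK (v y) (u y)) addrC ler_normD.
have dnC n u v : dn n (fun y => u y - v y) = dn n (fun y => v y - u y).
  by rewrite /dn /discrete_norm; congr (bl_norm X _); apply/funext => y;
    apply: eq_bigr => k _; rewrite distrC.
have [B B0 hB] := approximating_regular hs hPhi.
have [Ks Ks0 hKs] := discrete_norm_smoothing C0 bA hgamma hgamma' hx r.
have [Kd Kd0 hKd] := discrete_norm_difference C0 bA hgamma hgamma' hx hr hs hrs.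
have [Kt Kt0 hKt] := norm_dot_difference C0 bA hs.
(* subtracting the differences of [u] and [v] leaves averages of [u - v], which
   the norm of the lattice bounds at the nodes *)
have split_dn n u v : (0 < n)%N -> bl_set X u -> bl_set X v ->
    dn n (fun y => u y - v y) <=
    dn n (NA n u) + dn n (NA n v) + Ks * nrm (fun y => u y - v y).
  move=> n0 Xu Xv; have Xuv := bl_setB Xu Xv.
  apply: (le_trans (dnB n _ (NA n (fun y => u y - v y)))); apply: lerD.
    rewrite (bounded_opB (bNA n n0) Xu Xv).
    by apply: discrete_norm_triangle => y; exact: ler_normB.
  exact: hKs.
have trig_dn n T : (0 < n)%N -> trig_poly n T ->
    dn n (NA n T) <= Kd * gamma ^+ s * (n%:R ^- s * nrm (derive1n s T)).
  move=> n0 TT; have XT := bl_trig_poly X TT.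
  have := hKd n T n0 XT (smooth_integral_derivative hs (trig_poly_smooth TT))
    (bl_trig_poly X (trig_poly_derive1n s TT)).
  by rewrite expr_div_n !mulrA.
have error n u T : (0 < n)%N -> bl_set X u -> trig_poly n T ->
    nrm (fun y => u y - G n u y) <= nrm (fun y => u y - T y) +
      K3 * (n%:R ^- s * nrm (derive1n s T)) + K1 * dn n (fun y => u y - T y).
  move=> n0 Xu TT; have XT := bl_trig_poly X TT.
  have XGu := XG n u n0; have XGT := XG n T n0.
  apply: (le_trans (bl_norm_triangle Xu XT XGu)); rewrite -addrA lerD2l.
  apply: (le_trans (bl_norm_triangle XT XGT XGu)); apply: lerD.
    by rewrite mulrA; exact: happrox.
  rewrite (bl_normBC XGT XGu) /G -sampling_opB.
  by have [_] := hstab n n0 _ (bl_setB Xu XT).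
move=> f Xf alpha als; have nf := bl_norm_ge0 Xf.
rewrite eqO_powerP; last first.
  by move=> n n0; apply: bl_norm_ge0; apply: bl_setB => //; exact: XG.
rewrite eqO_powerP; last first.
  move=> n n0; apply: addr_ge0; first exact: dn0.
  by apply: bl_norm_ge0; have [_ b _] := bND n n0; have [] := b f Xf.
have w0 n : 0 <= n%:R `^ (- alpha) :> R by exact: powR_ge0.
split=> [[Ke Ke0 he]|[Ke Ke0 he]]; last first.
  have hdot n : (0 < n)%N -> nrm (ND n f) <= Ke * n%:R `^ (- alpha).
    by move=> n0; apply: le_trans (he n n0); rewrite lerDr; exact: dn0.
  have hdn n : (0 < n)%N -> dn n (NA n f) <= Ke * n%:R `^ (- alpha).
    move=> n0; apply: le_trans (he n n0); rewrite lerDl; apply: bl_norm_ge0.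
    by have [_ b _] := bND n n0; have [] := b f Xf.
  have [K K0 hK] := realization C0 bA hs als hgamma Xf Ke0 hdot.
  exists (K + K3 * K + K1 * (Ke + Kd * gamma ^+ s * K + Ks * K)).
    by rewrite !addr_ge0 ?mulr_ge0 ?addr_ge0 ?mulr_ge0 ?exprn_ge0 ?(ltW hK3) ?(ltW hK1)// ltW.
  move=> n n0; have [T TT [T1 T2]] := hK n n0.
  apply: (le_trans (error n f T n0 Xf TT)).
  rewrite 2!mulrDl; apply: lerD; first apply: lerD => //.
    by rewrite -[leRHS]mulrA ler_wpM2l// ltW.
  rewrite -[leRHS]mulrA ler_wpM2l ?(ltW hK1)//.
  apply: (le_trans (split_dn n f T n0 Xf (bl_trig_poly X TT))).
  rewrite 2!mulrDl; apply: lerD; first apply: lerD.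
  - exact: hdn.
  - apply: (le_trans (trig_dn n T n0 TT)); rewrite -[leRHS]mulrA ler_wpM2l//.
    by rewrite mulr_ge0// exprn_ge0// ltW.
  - by rewrite -[leRHS]mulrA ler_wpM2l.
(* [G n f] belongs to the approximating spaces, where differences of order [s]
   are bounded by the derivative and Bernstein's inequality is available; both
   differences are therefore instances of the same inverse estimate *)
have bern N g n : (0 < n)%N -> Phi N g ->
    (gamma / n%:R) ^+ s * nrm (derive1n s g) <=
    (gamma * B) ^+ s * N%:R ^+ s * nrm g / n%:R ^+ s.
  move=> n0 Pg; have [_ _ ng] := hB N g Pg.
  rewrite [leRHS](_ : _ = (gamma / n%:R) ^+ s * ((B * N%:R) ^+ s * nrm g)).
    by rewrite ler_wpM2l// exprn_ge0// ltW// hh.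
  by rewrite expr_div_n !exprMn [RHS]mulrAC !mulrA.
have gB : 0 <= (gamma * B) ^+ s by rewrite exprn_ge0// mulr_ge0// ltW.
have ns0 n : (0 < n)%N -> 0 < n%:R ^+ s :> R by move=> n0; rewrite exprn_gt0// ltr0n.
have inverse (p : nat -> (R -> R) -> R) K : 0 <= K ->
    (forall n u, (0 < n)%N -> bl_set X u -> 0 <= p n u) ->
    (forall n u v, (0 < n)%N -> bl_set X u -> bl_set X v ->
       p n u <= p n v + p n (fun y => u y - v y)) ->
    (forall n N g, (0 < n)%N -> Phi N g ->
       p n g <= K * ((gamma / n%:R) ^+ s * nrm (derive1n s g))) ->
    exists2 L : R, 0 <= L & forall n, (0 < n)%N -> p n (G n f) <= L * n%:R `^ (- alpha).
  move=> K0 p0 psub pK.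
  apply: (bernstein_rate hPhi hphi als Xf Ke0 (mulr_ge0 K0 gB) he p0 psub).
  move=> n N g n0 Pg; rewrite mulrC -ler_pdivlMr ?ns0//.
  apply: (le_trans (pK n N g n0 Pg)).
  rewrite [leRHS](_ : _ = K * ((gamma * B) ^+ s * N%:R ^+ s * nrm g / n%:R ^+ s)).
    by rewrite ler_wpM2l// bern.
  by rewrite !mulrA.
have [Lt Lt0 hLt] : exists2 L : R, 0 <= L &
    forall n, (0 < n)%N -> nrm (ND n (G n f)) <= L * n%:R `^ (- alpha).
  apply: (inverse (fun n u => nrm (ND n u)) Kt Kt0).
  - move=> n u n0 Xu; apply: bl_norm_ge0.
    by have [_ b _] := bND n n0; have [] := b u Xu.
  - move=> n u v n0 Xu Xv; rewrite (bounded_opB (bND n n0) Xu Xv).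
    have [_ b _] := bND n n0; have [XNu _] := b u Xu; have [XNv _] := b v Xv.
    have := bl_normD XNv (bl_setB XNu XNv); congr (nrm _ <= _).
    by apply/funext => y; rewrite addrC subrK.
  - move=> n N g n0 Pg; have [ig Xg _] := hB N g Pg.
    exact: hKt (hh n n0) (approximating_bl hPhi Pg) ig Xg.
have [Ld Ld0 hLd] : exists2 L : R, 0 <= L &
    forall n, (0 < n)%N -> dn n (NA n (G n f)) <= L * n%:R `^ (- alpha).
  apply: (inverse (fun n u => dn n (NA n u)) Kd Kd0).
  - by move=> n u n0 Xu; exact: dn0.
  - move=> n u v n0 Xu Xv; rewrite (bounded_opB (bNA n n0) Xu Xv); exact: dnB.
  - move=> n N g n0 Pg; have [ig Xg _] := hB N g Pg.
    exact: hKd n0 (approximating_bl hPhi Pg) ig Xg.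
pose Kf := (1 + 2 * C) ^+ s * Ke + Lt.
have c2 : 0 <= (1 + 2 * C) ^+ s.
  by rewrite exprn_ge0// addr_ge0// mulr_ge0// ltW.
have Kf0 : 0 <= Kf by rewrite addr_ge0// mulr_ge0.
have hdot n : (0 < n)%N -> nrm (ND n f) <= Kf * n%:R `^ (- alpha).
  move=> n0; have [_ b _] := bND n n0; have Xe := bl_setB Xf (XG n f n0).
  have [XNe nNe] := b _ Xe; have [XNG _] := b _ (XG n f n0).
  have := bl_normD XNe XNG.
  rewrite (_ : (fun y => _) = ND n f); last first.
    by apply/funext => y; rewrite (bounded_opB (bND n n0) Xf (XG n f n0)) subrK.
  move=> /le_trans; apply; rewrite mulrDl lerD ?hLt//.
  by apply: (le_trans nNe); rewrite -[leRHS]mulrA ler_wpM2l// he.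
have [K K0 hK] := realization C0 bA hs als hgamma Xf Kf0 hdot.
(* the sampled values of [f] and of [G n f] differ little, because [G n] almost
   reproduces [G n f] and is bounded below on samples *)
pose Kg := Ld + Kd * gamma ^+ s * K + Ks * (Ke + K).
have Kg0 : 0 <= Kg by rewrite !addr_ge0 ?mulr_ge0 ?addr_ge0 ?exprn_ge0// ltW.
pose Kh := (Ke + K + K3 * K + K1 * Kg) / K2.
have Kh0 : 0 <= Kh.
  by rewrite divr_ge0 ?(ltW hK2)// !addr_ge0 ?mulr_ge0// ltW.
have hfG n : (0 < n)%N -> dn n (fun y => f y - G n f y) <= Kh * n%:R `^ (- alpha).
  move=> n0; have [T TT [T1 T2]] := hK n n0; have XT := bl_trig_poly X TT.
  have XGf := XG n f n0.
  have GT : nrm (fun y => G n f y - T y) <= (Ke + K) * n%:R `^ (- alpha).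
    apply: (le_trans (bl_norm_triangle XGf Xf XT)).
    by rewrite mulrDl lerD// (bl_normBC XGf Xf) he.
  have dGT : dn n (fun y => G n f y - T y) <= Kg * n%:R `^ (- alpha).
    apply: (le_trans (split_dn n _ T n0 XGf XT)); rewrite 2!mulrDl.
    apply: lerD; first apply: lerD.
    - exact: hLd.
    - apply: (le_trans (trig_dn n T n0 TT)); rewrite -[leRHS]mulrA ler_wpM2l//.
      by rewrite mulr_ge0// exprn_ge0// ltW.
    - by rewrite -[leRHS]mulrA ler_wpM2l.
  have eG := error n (G n f) T n0 XGf TT.
  have eG' : nrm (fun y => G n f y - G n (G n f) y) <=
      (Ke + K + K3 * K + K1 * Kg) * n%:R `^ (- alpha).
    apply: (le_trans eG); rewrite 2!mulrDl; apply: lerD; first apply: lerD => //.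
      by rewrite -[leRHS]mulrA ler_wpM2l// ltW.
    by rewrite -[leRHS]mulrA ler_wpM2l// ltW.
  have [+ _] := hstab n n0 _ (bl_setB Xf XGf); rewrite sampling_opB => h.
  rewrite /Kh mulrAC ler_pdivlMr// mulrC; exact: le_trans eG'.
exists (Ld + Kh + Ks * Ke + Kf).
  by do 2 apply: addr_ge0 => //; [exact: addr_ge0|exact: mulr_ge0].
move=> n n0; rewrite mulrDl lerD ?hdot//.
have XGf := XG n f n0; have Xe := bl_setB Xf XGf.
apply: (le_trans (dnB n _ (NA n (G n f)))).
rewrite -addrA mulrDl lerD ?hLd//.
rewrite -(bounded_opB (bNA n n0) Xf XGf).
apply: (le_trans (dnB n _ (fun y => f y - G n f y))); rewrite mulrDl lerD ?hfG//.
rewrite dnC -mulrA; apply: (le_trans (hKs n _ n0 Xe)).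
by rewrite ler_wpM2l// he.
Qed.
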